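(* Let $C\ge c/(1-\beta)$, where $c$ and $\beta$ are the constants in the distortion condition (JF) for the tower map $F$. For every integer $n\ge1$ let $\varphi_n\in\mathcal C_n$ and $\lambda_n<1$ be the unique element of $\mathcal C_n$ and number with $\mathcal P_n\varphi_n=\lambda_n\varphi_n$, $\lambda_n=\|\mathcal P_n\varphi_n\|_{L^1(\Delta,\nu)}$. Then $\varphi_n\to\varphi$ in $L^1(\Delta,\nu)$ as $n\to\infty$, where $\varphi$ is the density (with respect to $\nu$) of the unique absolutely continuous invariant probability measure $\mu$ of the closed system $F:\Delta\to\Delta$.
   Context: MAP. Let $\alpha\in(0,1)$ and let $T:[0,1]\to[0,1]$ be a Pomeau--Manneville map: near $0$, $T(x)=x+c_\alpha x^{1+\alpha}+g(x)$ with $c_\alpha>0$, $g$ of class $C^2$ and $g'(x)=o(x^\alpha)$ as $x\to0$; there is $x_0\in(0,1)$ such that $T$ is one-to-one and onto $(0,1)$ on each of $(0,x_0)$ and $(x_0,1)$; $T$ is $C^2$ on $(x_0,1)$ and on $(\epsilon,x_0)$ for every $\epsilon>0$; and $T'>1$ on $(0,x_0)$ and on $(x_0,1)$. TOWER. Put $\Delta_0=[x_0,1]$, $R(x)=\min\{k>0: T^k(x)\in(x_0,1)\}$ (first return time, defined a.e.), $\Delta_{0,i}=\{x\in\Delta_0: R(x)=i\}$ for $i\ge1$, $\Delta=\{(x,\ell): x\in\Delta_0,\ \ell\in\{0,1,2,\dots\},\ \ell<R(x)\}$, cells $\Delta_{\ell,i}=\Delta_{0,i}\times\{\ell\}$ ($0\le\ell<i$),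 levels $\Delta_\ell=\bigcup_{i>\ell}\Delta_{\ell,i}$; the base $\Delta_0$ is identified with $\Delta_0\times\{0\}$. The tower map $F:\Delta\to\Delta$ is $F(x,\ell)=(x,\ell+1)$ if $\ell<R(x)-1$ and $F(x,R(x)-1)=(T^{R(x)}(x),0)$; each top cell $\Delta_{i-1,i}$ is mapped injectively onto $\Delta_0$ (mod null sets). The measure $\nu$ on $\Delta$ is Lebesgue measure on $\Delta_0$ lifted by upwards translation; it is finite. $JF=d(\nu\circ F)/d\nu$ is the Jacobian. The separation time $s(x,y)$ counts the number of returns to $\Delta_0$ before the orbits of $x$ and $y$ are in different elements of $\{\Delta_{0,i}\}$: for $x,y\in\Delta_0$, $s(x,y)$ is the least $k\ge0$ such that the $k$-th returns to $\Delta_0$ of $x$ and $y$ lie in different $\Delta_{0,i}$, and for $(x,\ell),(y,\ell)$ in the same cell, $s((x,\ell),(y,\ell))=s(x,y)$. It is assumed that $F$ is non-singular and satisfies, for constants $\beta\in(0,1)$ and $c<\infty$, (JF) $\left|\frac{JF(x)}{JF(y)}\right|\le e^{c\,\beta^{s(F(x),F(y))}}$ for $x,y$ in the same cell $\Delta_{\ell,i}$. HOLE AND OPERATORS. For an integer $n\ge1$ let $H_n=\bigcup_{i\ge n+1}\bigcup_{1\le\ell<i}\Delta_{\ell,i}$ be the hole and $H_n^1=\bigcup_{i\ge n+1}\Delta_{0,i}$. The Perron--Frobenius operator is $\mathcal P\varphi(x)=\sum_{y\in F^{-1}x}\varphi(y)/|JF(y)|$ on $L^1(\Delta,\nu)$,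 and the conditional operator is $\mathcal P_n\varphi=\chi_{\Delta\setminus H_n}\,\mathcal P(\varphi\,\chi_{\Delta\setminus H_n})$. CONES. Two points are comparable if both lie in the same cell $\Delta_{\ell,i}$ or both lie in $\Delta_0$. For a fixed $C>0$, $\mathcal C_*=\{\varphi\in L^1(\Delta,\nu): \varphi\ge0,\ \varphi(x)\le\varphi(y)e^{C\beta^{s(x,y)}}\text{ for a.e. comparable }x,y\}$ and $\mathcal C_n=\{\varphi\in\mathcal C_*: \int_{\Delta\setminus H_n}\varphi\,d\nu=1,\ \varphi|_{H_n}=0\}$. For $C\ge c/(1-\beta)$ an element $\varphi_n\in\mathcal C_n$ with $\mathcal P_n\varphi_n=\lambda_n\varphi_n$, $\lambda_n=\|\mathcal P_n\varphi_n\|_{L^1}$, exists and is unique in $\mathcal C_n$. *)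

(* Defs.v *)
From HB Require Import structures.
From mathcomp Require Import all_boot all_order all_algebra.
From mathcomp Require Import all_classical all_reals all_analysis.

Set Implicit Arguments.
Unset Strict Implicit.
Unset Printing Implicit Defensive.

Import Order.TTheory GRing.Theory Num.Theory.
Import numFieldNormedType.Exports.

Local Open Scope classical_set_scope.
Local Open Scope ring_scope.

(* The library has [sigma_finite_counting] but not the s-finiteness instance that
   makes [counting] a [sigma_finite_measure], as product measures require. *)
HB.instance Definition _ (R : realType) :=
  @isSFinite.Build _ _ _ (@counting nat R)
    (sfinite_measure_sigma_finite (@sigma_finite_counting R)).

Section PomeauManneville.
Context {R : realType}.

(* Only used for open intervals [D], where two-sided derivatives at the points
   of [D] are the right notion. *)
Definition C2_on (D : set R) (f : R -> R) : Prop :=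
  forall x, D x ->
    [/\ derivable f x 1, derivable (derive1 f) x 1 &
        {for x, continuous (derive1n 2 f)}].

(* [T] is a map of [0, 1]; its values outside of [0, 1] are irrelevant. The
   regularity of [g] is required on some interval ]0, delta[ only, and not at the
   endpoint 0, where all that is asked for is g'(x) = o(x^alpha); maps whose [g]
   is C^2 up to 0 are included. *)
Record pomeau_manneville (alpha x0 : R) (T : R -> R) : Prop := PomeauManneville {
  pm_alpha : 0 < alpha < 1 ;
  pm_x0 : 0 < x0 < 1 ;
  pm_stable : set_fun `[0, 1] `[0, 1] T ;
  pm_near0 : exists (ca delta : R) (g : R -> R),
    [/\ 0 < ca, 0 < delta, C2_on `]0, delta[ g,
        derive1 g x / x `^ alpha @[x --> 0^'+] --> 0 &
        forall x, 0 < x < delta -> T x = x + ca * x `^ (1 + alpha) + g x] ;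
  pm_bijL : set_bij `]0, x0[ `]0, 1[ T ;
  pm_bijR : set_bij `]x0, 1[ `]0, 1[ T ;
  pm_C2L : forall eps, 0 < eps -> C2_on `]eps, x0[ T ;
  pm_C2R : C2_on `]x0, 1[ T ;
  pm_expandL : forall x, 0 < x < x0 -> 1 < derive1 T x ;
  pm_expandR : forall x, x0 < x < 1 -> 1 < derive1 T x }.

End PomeauManneville.

Section Tower.
Context {R : realType}.
Variables (x0 : R) (T : R -> R).

(* 0 stands for an undefined return time; this happens on a Lebesgue-null set
   only, and the points concerned belong to no cell. *)
Definition return_time (x : R) : nat :=
  xget 0%N [set k | [/\ (0 < k)%N, x0 < iter k T x < 1 &
    forall j, (0 < j < k)%N -> ~ (x0 < iter j T x < 1)]].

Definition return_map (x : R) : R := iter (return_time x) T x.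

Definition base_cell (i : nat) : set R :=
  [set x | [/\ x0 <= x <= 1, (0 < i)%N & return_time x = i]].

Definition tower_pt : Type := (measurableTypeR R * nat)%type.

Definition tower : set tower_pt :=
  [set z | x0 <= z.1 <= 1 /\ (z.2 < return_time z.1)%N].

Definition cell (l i : nat) : set tower_pt :=
  [set z | [/\ (l < i)%N, base_cell i z.1 & z.2 = l]].

Definition tower_map (z : tower_pt) : tower_pt :=
  if (z.2.+1 < return_time z.1)%N then (z.1, z.2.+1) else (return_map z.1, 0%N).

(* Lebesgue measure on every level. The ambient measure lives on R * nat; it is
   always used through its restriction to [tower]. *)
Definition tower_measure : {measure set (measurableTypeR R * nat) -> \bar R} :=
  (@lebesgue_measure R \x @counting nat R)%E.

(* "Different elements of the partition" is read as "not in a common element",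
   so that points which cease to return are separated from all points. The
   value is [None] when the points are never separated. *)
Definition separation_time (x y : R) : option nat :=
  let together k :=
    exists i, base_cell i (iter k return_map x) /\
              base_cell i (iter k return_map y) in
  xget None (Some @` [set k | ~ together k /\
                              forall j, (j < k)%N -> together j]).

(* beta ^ s(z, w), for z and w on the same level; beta ^ oo = 0. *)
Definition sep_pow (beta : R) (z w : tower_pt) : R :=
  if separation_time z.1 w.1 is Some k then beta ^+ k else 0.

Definition nonsingular : Prop :=
  forall A : set (measurableTypeR R * nat), measurable A -> A `<=` tower ->
    tower_measure A = 0%E ->
    tower_measure (tower `&` tower_map @^-1` A) = 0%E.

(* [tower_map] is injective on the cells, up to null sets, hence the
   Radon-Nikodym property defining d(nu o F)/d nu is imposed on each cell. *)
Definition is_jacobian (JF : tower_pt -> R) : Prop :=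
  [/\ measurable_fun tower (JF : measurableTypeR R * nat -> R),
      forall z, tower z -> 0 <= JF z &
      forall l i (A : set (measurableTypeR R * nat)),
        measurable A -> A `<=` cell l i ->
        tower_measure (tower_map @` A) =
          (\int[tower_measure]_(z in A) (JF z)%:E)%E].

Definition distortion (beta c : R) (JF : tower_pt -> R) : Prop :=
  forall l i z w, cell l i z -> cell l i w ->
    `|JF z / JF w| <= expR (c * sep_pow beta (tower_map z) (tower_map w)).

Definition hole (n : nat) : set tower_pt :=
  [set z | exists i l, [/\ (n.+1 <= i)%N, (1 <= l < i)%N & cell l i z]].

(* The two sums over the fibre are the positive and negative parts of
   sum_(y in F^-1 x) phi y / |JF y|, an absolutely convergent series for almost
   every x when phi is integrable. *)
Definition perron_frobenius (JF phi : tower_pt -> R) : tower_pt -> R :=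
  fun x =>
    let fibre := [set y | tower y /\ tower_map y = x] in
    fine (\esum_(y in fibre) (Num.max (phi y) 0 / `|JF y|)%:E) -
    fine (\esum_(y in fibre) (Num.max (- phi y) 0 / `|JF y|)%:E).

Definition conditional_operator (JF : tower_pt -> R) (n : nat)
    (phi : tower_pt -> R) : tower_pt -> R :=
  \1_(tower `\` hole n) \*
  perron_frobenius JF (phi \* \1_(tower `\` hole n)).

Definition tower_L1 (phi : tower_pt -> R) : Prop :=
  tower_measure.-integrable tower
    (EFin \o (phi : measurableTypeR R * nat -> R)).

Definition L1_norm (phi : tower_pt -> R) : \bar R :=
  (\int[tower_measure]_(z in tower) `|phi z|%:E)%E.

Definition comparable (z w : tower_pt) : Prop :=
  (exists l i, cell l i z /\ cell l i w) \/
  [/\ tower z, tower w, z.2 = 0%N & w.2 = 0%N].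

Definition cone (beta C : R) (phi : tower_pt -> R) : Prop :=
  [/\ tower_L1 phi,
      {ae tower_measure, forall z, tower z -> 0 <= phi z} &
      exists2 N : set (measurableTypeR R * nat), tower_measure.-negligible N &
        forall z w, ~ N z -> ~ N w -> comparable z w ->
          phi z <= phi w * expR (C * sep_pow beta z w)].

Definition cone_n (beta C : R) (n : nat) (phi : tower_pt -> R) : Prop :=
  [/\ cone beta C phi,
      (\int[tower_measure]_(z in tower `\` hole n) (phi z)%:E)%E = 1%E &
      {ae tower_measure, forall z, hole n z -> phi z = 0}].

Definition conditional_eigenpair (beta C : R) (JF : tower_pt -> R) (n : nat)
    (phi : tower_pt -> R) (lambda : R) : Prop :=
  [/\ cone_n beta C n phi,
      {ae tower_measure, forall z, tower z ->
         conditional_operator JF n phi z = lambda * phi z} &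
      lambda%:E = L1_norm (conditional_operator JF n phi)].

Definition is_acip (mu : probability (measurableTypeR R * nat)%type R) : Prop :=
  [/\ mu tower = 1%E,
      forall A : set (measurableTypeR R * nat), measurable A ->
        A `<=` tower -> tower_measure A = 0%E -> mu A = 0%E &
      forall A : set (measurableTypeR R * nat), measurable A -> A `<=` tower ->
        mu (tower `&` tower_map @^-1` A) = mu A].

Definition is_density (mu : probability (measurableTypeR R * nat)%type R)
    (phi : tower_pt -> R) : Prop :=
  tower_L1 phi /\
  forall A : set (measurableTypeR R * nat), measurable A -> A `<=` tower ->
    mu A = (\int[tower_measure]_(z in A) (phi z)%:E)%E.

End Tower.

(* Main.v *)
Require Import Defs.
From mathcomp Require Import all_boot all_order all_algebra.
From mathcomp Require Import all_classical all_reals all_analysis.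
From mathcomp Require Import measurable_realfun ring lra.
From HB Require Import structures.

Set Implicit Arguments.
Unset Strict Implicit.
Unset Printing Implicit Defensive.

Import Order.TTheory GRing.Theory Num.Theory.
Import numFieldNormedType.Exports.

Local Open Scope classical_set_scope.
Local Open Scope ring_scope.

(** The theorem is proved on the base of the tower. Let G be the return map, R
    the return time, L the transfer operator of G, and h the density on the base
    with L h = h. Below the top of a column F is a translation, so the invariant
    density of the tower is, up to normalisation, the function (x, l) |-> h x.
    In the same way a conditional eigenfunction phi_n is known from its values
    psi_n on the base: it is multiplied by 1 / lambda_n from one level to the
    next over {R <= n}, and vanishes above the base over {R > n}. The relation
    at level 0 becomes psi_n = L (lambda_n^(-R) 1_{R <= n} psi_n), and it has to
    be shown that the factor lambda_n^(-R) 1_{R <= n} disappears in the limit.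

    The first ingredient is a spectral gap in a weak form. The branches of G are
    onto and (JF) bounds their distortion, so L maps a cone of densities into a
    smaller one, whence the distance in sup norm of the iterates of two densities
    of the cone decays exponentially ([contraction]). Therefore h exists, and a
    density f of the cone for which f - L f is uniformly small is uniformly close
    to h ([near_inv_density]).

    The second ingredient is 1 - lambda_n = o(1/n). Integrating the relation for
    psi_n bounds 1 - lambda_n by a multiple of the measure of {R > n}
    ([lam_defect]). There are more than n levels over that set, so n times its
    measure is at most the mass of the part of the tower over {R > n}
    ([late_tail_mass]), which tends to 0 as the tower has finite measure. Hence
    lambda_n^(-n) tends to 1 ([lam_pow]), the normalised psi_n are almost invariant
    under L ([profile_almost_invariant]), and they converge to h uniformly. The
    columns with R > n carry little mass, which gives the convergence of phi_n in
    L^1 ([eigen_near], [eigen_lim]).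

    Finiteness of the tower is where alpha < 1 is used. A base point with R > n + 1
    is at distance less than x_n from x0, where x_n is the n-th preimage of x0 in
    (0, x0), and T x >= x + kappa x^(1 + alpha) there; so x^(1 - alpha) decreases
    by a multiple of x_n at each step backwards, and the sum of the x_n telescopes
    ([left_preimage_sum]).

    The measure with density proportional to h (x) is invariant by construction
    ([acip_exists]). Any other absolutely continuous invariant probability
    restricts to a G-invariant measure on the base, and such a measure is a
    multiple of h times Lebesgue measure because G is ergodic: the cylinders of G
    shrink to points, and their images fill the base with bounded distortion
    ([cylinder_mixing], [ergodic], [invariant_unique], [acip_unique]).

    The hypotheses hold almost everywhere only. They are used at all levels over
    the points of a set Y of full measure in the base, which is mapped into itself
    by G and by all of its inverse branches, and avoids a given null set
    ([good_set_exists]). *)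

(** * Transfer operator of a full-branch map *)

Section FullBranch.
Context {R : realType} {d : measure_display} {X : measurableType d}.
Variable m : {measure set X -> \bar R}.
Variables (Y : set X) (G : X -> X) (idx : X -> nat) (br : nat -> X -> X).
Variables (w : nat -> X -> R) (sp : X -> X -> R) (b C V : R).

Definition piece i : set X := Y `&` idx @^-1` [set i].

(** [w i] is the density, with respect to [m], of the i-th inverse branch; it
    is characterised by the change of variables [fb_transfer], so that no
    derivative is involved. [sp] stands for beta to the power of the
    separation time, of which only the scaling by [b] along the branches
    matters. *)
Record full_branch : Prop := FullBranch {
  fb_b : 0 < b < 1 ;
  fb_C : 0 < C ;
  fb_V : 0 < V ;
  fb_mY : measurable Y ;
  fb_mYV : m Y = V%:E ;
  fb_GY : forall x, Y x -> Y (G x) ;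
  fb_brY : forall i x, Y x -> Y (br i x) ;
  fb_idx_br : forall i x, Y x -> idx (br i x) = i ;
  fb_brK : forall i x, Y x -> G (br i x) = x ;
  fb_GK : forall x, Y x -> br (idx x) (G x) = x ;
  fb_mG : measurable_fun Y G ;
  fb_mpiece : forall i, measurable (piece i) ;
  fb_mbr : forall i, measurable_fun Y (br i) ;
  fb_mw : forall i, measurable_fun Y (w i) ;
  fb_w_gt0 : forall i x, Y x -> 0 < w i x ;
  fb_transfer : forall (i : nat) (f : X -> \bar R), measurable_fun Y f ->
    (forall x, Y x -> (0 <= f x)%E) ->
    (\int[m]_(x in Y) ((w i x)%:E * f (br i x)) =
     \int[m]_(x in piece i) f x)%E ;
  fb_dist : forall i x x', Y x -> Y x' ->
    w i x <= w i x' * expR (C * (1 - b) * sp x x') ;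
  fb_sp : forall x x', 0 <= sp x x' <= 1 ;
  fb_sp_br : forall i x x', Y x -> Y x' ->
    sp (br i x) (br i x') = b * sp x x' }.

Hypothesis FB : full_branch.

Let b0 : 0 < b. Proof. by have /andP[] := fb_b FB. Qed.
Let b1 : b < 1. Proof. by have /andP[] := fb_b FB. Qed.
Let C0 := fb_C FB.
Let V0 := fb_V FB.
Let mY := fb_mY FB.
Let mYV := fb_mYV FB.

Implicit Types (f g : X -> R) (B : set X) (x z : X) (D a : R).

Let w_ge0 i x : Y x -> 0 <= w i x.
Proof. by move=> Yx; rewrite ltW ?(fb_w_gt0 FB). Qed.

Definition bounded_on (f : X -> R) := exists M, forall x, Y x -> `|f x| <= M.

Definition transfer (f : X -> R) (x : X) : R :=
  limn (series (fun i => w i x * f (br i x))).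

Definition agree k x x' :=
  forall j, (j < k)%N -> idx (iter j G x) = idx (iter j G x').

(** The inequality is required of the points with the same first [k] symbols
    only: the indicator function of a union of cylinders of rank [k] satisfies
    it in this form. *)
Definition cone_on k D (f : X -> R) := forall x x', Y x -> Y x' ->
  agree k x x' -> f x <= f x' * expR (D * sp x x').

Record density k D a (f : X -> R) : Prop := Density {
  dens_meas : measurable_fun Y f ;
  dens_ge0 : forall x, Y x -> 0 <= f x ;
  dens_cone : cone_on k D f ;
  dens_bnd : bounded_on f ;
  dens_int : (\int[m]_(x in Y) (f x)%:E = a%:E)%E }.

Lemma sub_piece i : piece i `<=` Y. Proof. by move=> x []. Qed.

Lemma bigcup_piece : \bigcup_i piece i = Y.
Proof.
apply/seteqP; split=> [x [i _] []//|x Yx].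
by exists (idx x).
Qed.

Lemma trivIset_piece : trivIset setT piece.
Proof. by move=> i j _ _ [x [[_ /= <-] [_ /= <-]]]. Qed.

Definition mass i : R := fine (m (piece i)).

Lemma piece_fin i : m (piece i) \is a fin_num.
Proof.
rewrite ge0_fin_numE//; apply: (@le_lt_trans _ _ (m Y)).
  by apply: le_measure; rewrite ?inE; [exact: fb_mpiece| |exact: sub_piece].
by rewrite mYV ltry.
Qed.

Lemma massE i : (mass i)%:E = m (piece i).
Proof. by rewrite fineK// piece_fin. Qed.

Lemma mass_ge0 i : 0 <= mass i.
Proof. by rewrite fine_ge0. Qed.

Lemma sum_mass : (\sum_(i <oo) (mass i)%:E = V%:E)%E.
Proof.
under eq_eseriesr do rewrite massE.
rewrite -mYV -bigcup_piece measure_bigcup//.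
- by apply: eq_eseriesl => i; rewrite in_setT.
- by move=> i _; exact: fb_mpiece.
- exact: trivIset_piece.
Qed.

Lemma cvg_mass : cvgn (series mass).
Proof.
by apply: nnseries_is_cvg => [i|]; rewrite ?mass_ge0// sum_mass ltry.
Qed.

Lemma int_w i : (\int[m]_(x in Y) (w i x)%:E = (mass i)%:E)%E.
Proof.
have := fb_transfer FB i (measurable_cst 1%E) (fun _ _ => lee01).
under eq_integral do rewrite mule1.
by rewrite integral_cst ?mul1e -?massE//; exact: fb_mpiece.
Qed.

(** Integrating the cone inequality in one of its variables compares the
    values of the function with its mean. *)
Lemma cone_le D a f x : 0 <= D -> density 0 D a f -> Y x ->
  f x * V <= a * expR D.
Proof.
move=> D0 [mf f0 cf _ fa] Yx; rewrite -lee_fin EFinM (EFinM a) -mYV -fa.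
rewrite -integral_cst// muleC -ge0_integralZl//=; last first.
  exact/measurable_EFinP.
apply: ge0_le_integral => //.
- by move=> z _; rewrite lee_fin f0.
- by apply: emeasurable_funM => //; exact/measurable_EFinP.
- move=> z Yz; rewrite -EFinM lee_fin mulrC.
  apply: (le_trans (cf x z Yx Yz _)) => //.
  rewrite ler_wpM2l ?f0// ler_expR ler_piMr//.
  by have /andP[] := fb_sp FB x z.
Qed.

Lemma cone_ge D a f x : 0 <= D -> density 0 D a f -> Y x ->
  a <= f x * V * expR D.
Proof.
move=> D0 [mf f0 cf _ fa] Yx; rewrite -lee_fin mulrAC EFinM -mYV -fa.
rewrite -integral_cst//; apply: ge0_le_integral => //.
- exact/measurable_EFinP.
- move=> z Yz; rewrite lee_fin.
  apply: (le_trans (cf z x Yz Yx _)) => //.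
  rewrite ler_wpM2l ?f0// ler_expR ler_piMr//.
  by have /andP[] := fb_sp FB z x.
Qed.

Lemma cone_bounded D f : 0 <= D -> (forall x, Y x -> 0 <= f x) ->
  cone_on 0 D f -> bounded_on f.
Proof.
move=> D0 f0 cf.
have [Y0|/set0P[x0 Yx0]] := eqVneq Y set0; first by exists 0; rewrite Y0.
exists (f x0 * expR D) => x Yx; rewrite ger0_norm ?f0//.
apply: (le_trans (cf _ _ Yx Yx0 _)) => //.
rewrite ler_wpM2l ?f0// ler_expR ler_piMr//.
by have /andP[] := fb_sp FB x x0.
Qed.

Lemma w_dens i : density 0 C (mass i) (w i).
Proof.
have w0 x : Y x -> 0 <= w i x by move=> Yx; rewrite ltW ?(fb_w_gt0 FB).
have cw : cone_on 0 C (w i).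
  move=> x x' Yx Yx' _; apply: (le_trans (fb_dist FB i Yx Yx')).
  rewrite ler_wpM2l ?w0// ler_expR -mulrA ler_wpM2l//; first exact: ltW.
  have /andP[s0 _] := fb_sp FB x x'.
  by rewrite ler_piMl// lerBlDr lerDl (ltW b0).
split => //; first exact: fb_mw.
- exact: (cone_bounded (ltW C0)).
- exact: int_w.
Qed.

Lemma w_le i x : Y x -> w i x <= mass i * (expR C / V).
Proof.
move=> Yx; have := cone_le (ltW C0) (w_dens i) Yx.
by rewrite mulrA ler_pdivlMr.
Qed.

(** By [w_le] the weights are dominated by the masses of the pieces, which
    have a finite sum. *)
Lemma cvg_transfer_norm f x : bounded_on f -> Y x ->
  cvgn [normed series (fun i => w i x * f (br i x))].
Proof.
move=> [M fM] Yx; have [M0|M0] := leP 0 M; last first.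
  by have := le_lt_trans (fM _ Yx) M0; rewrite normr_lt0.
apply: (@series_le_cvg _ _ (fun i => M * (expR C / V) * mass i)).
- by move=> i; rewrite normr_ge0.
- by move=> i; rewrite !mulr_ge0 ?expR_ge0 ?mass_ge0// invr_ge0 ltW.
- move=> i /=; rewrite normrM gtr0_norm ?(fb_w_gt0 FB)//.
  rewrite -mulrA (mulrC M) (mulrC (_ / _)) ler_pM ?w_ge0 ?w_le//.
  exact/fM/fb_brY.
- exact/is_cvg_seriesZ/cvg_mass.
Qed.

Lemma cvg_transfer f x : bounded_on f -> Y x ->
  cvgn (series (fun i => w i x * f (br i x))).
Proof. by move=> bf Yx; apply/normed_cvg/cvg_transfer_norm. Qed.

Lemma bounded_onD f g : bounded_on f -> bounded_on g -> bounded_on (f \+ g).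
Proof.
move=> [M fM] [N gN]; exists (M + N) => x Yx.
by rewrite (le_trans (ler_normD _ _))// lerD ?fM ?gN.
Qed.

Lemma bounded_onZ k f : bounded_on f -> bounded_on (fun x => k * f x).
Proof.
move=> [M fM]; exists (`|k| * M) => x Yx.
by rewrite normrM ler_wpM2l ?fM.
Qed.

Lemma bounded_on_cst k : bounded_on (cst k).
Proof. by exists `|k|. Qed.

Lemma eq_transfer f g x : (forall z, Y z -> f z = g z) -> Y x ->
  transfer f x = transfer g x.
Proof.
move=> fg Yx; congr (limn (series _)); apply/funext => i.
by rewrite fg//; exact: fb_brY.
Qed.

Lemma transferD f g x : bounded_on f -> bounded_on g -> Y x ->
  transfer (f \+ g) x = transfer f x + transfer g x.
Proof.
move=> bf bg Yx; rewrite /transfer -lim_seriesD; last 2 first.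
- exact: cvg_transfer.
- exact: cvg_transfer.
by congr (limn (series _)); apply/funext => i; rewrite /= mulrDr.
Qed.

Lemma transferZ k f x : bounded_on f -> Y x ->
  transfer (fun z => k * f z) x = k * transfer f x.
Proof.
move=> bf Yx; rewrite /transfer -[RHS]/(k *: _) -lim_seriesZ; last first.
  exact: cvg_transfer.
by congr (limn (series _)); apply/funext => i; rewrite /= mulrCA.
Qed.

Lemma le_transfer f g x : bounded_on f -> bounded_on g ->
  (forall z, Y z -> f z <= g z) -> Y x -> transfer f x <= transfer g x.
Proof.
move=> bf bg fg Yx; apply: lim_series_le; do ?exact: cvg_transfer.
move=> i; rewrite ler_wpM2l// ?fg//; first by rewrite ltW ?(fb_w_gt0 FB).
exact: fb_brY.
Qed.

Lemma transfer_ge0 f x : (forall z, Y z -> 0 <= f z) -> bounded_on f -> Y x ->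
  0 <= transfer f x.
Proof.
move=> f0 bf Yx; rewrite (le_trans _ (le_transfer (bounded_on_cst 0) bf f0 Yx))//.
rewrite -[X in transfer X](_ : (fun z => 0 * cst 0 z) = _); last first.
  by apply/funext => z /=; rewrite mul0r.
by rewrite transferZ ?mul0r//; exact: bounded_on_cst.
Qed.

Lemma bounded_onB f g : bounded_on f -> bounded_on g -> bounded_on (f \- g).
Proof.
move=> bf bg; have := bounded_onD bf (bounded_onZ (-1) bg).
by congr bounded_on; apply/funext => x /=; rewrite mulN1r.
Qed.

Lemma transferB f g x : bounded_on f -> bounded_on g -> Y x ->
  transfer (f \- g) x = transfer f x - transfer g x.
Proof.
move=> bf bg Yx; rewrite -mulN1r -transferZ// -transferD//; last exact: bounded_onZ.
by apply: eq_transfer => // z _ /=; rewrite mulN1r.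
Qed.

Lemma EFin_transfer f x : (forall z, Y z -> 0 <= f z) -> bounded_on f -> Y x ->
  ((transfer f x)%:E = \sum_(i <oo) (w i x * f (br i x))%:E)%E.
Proof.
move=> f0 bf Yx; rewrite /transfer -EFin_lim; last exact: cvg_transfer.
by congr (limn _); apply/funext => n /=; rewrite /series /= sumEFin.
Qed.

Lemma norm_transfer_le f g x : bounded_on f -> bounded_on g ->
  (forall z, Y z -> `|f z| <= g z) -> Y x -> `|transfer f x| <= transfer g x.
Proof.
move=> bf bg fg Yx; rewrite ler_norml; apply/andP; split; last first.
  by apply: le_transfer => // z Yz; rewrite (le_trans (ler_norm _)) ?fg.
rewrite -mulN1r -transferZ//; apply: le_transfer => //.
  exact: bounded_onZ.
by move=> z Yz; rewrite mulN1r lerNl (le_trans _ (fg z Yz))// -normrN ler_norm.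
Qed.

Lemma measurable_transfer f : measurable_fun Y f -> bounded_on f ->
  measurable_fun Y (transfer f).
Proof.
move=> mf bf; apply: (@measurable_fun_cvg _ _ _ _
    (fun n x => series (fun i => w i x * f (br i x)) n)); last first.
  by move=> x Yx; exact: cvg_transfer.
move=> n; rewrite /series /=; apply: measurable_sum => i.
apply: measurable_funM; first exact: fb_mw.
apply: (measurable_comp mY _ mf); last exact: fb_mbr.
by move=> _ [x Yx <-]; exact: fb_brY.
Qed.

(** The change of variables is summed over the branches, whose images are the
    pieces. *)
Lemma int_transfer f B : measurable_fun Y f -> (forall z, Y z -> 0 <= f z) ->
  bounded_on f -> measurable B -> B `<=` Y ->
  (\int[m]_(x in B) (transfer f x)%:E =
   \int[m]_(x in Y `&` G @^-1` B) (f x)%:E)%E.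
Proof.
move=> mf f0 bf mB BY.
have mGB : measurable (Y `&` G @^-1` B) by exact: (fb_mG FB).
transitivity (\int[m]_(x in B) (\sum_(i <oo) (w i x * f (br i x))%:E))%E.
  by apply: eq_integral => x /[!inE] Bx; rewrite EFin_transfer//; exact: BY.
have mbr i : measurable_fun Y (fun x => w i x * f (br i x)).
  apply: measurable_funM; first exact: fb_mw.
  apply: (measurable_comp mY _ mf); last exact: fb_mbr.
  by move=> _ [x Yx <-]; exact: fb_brY.
have wf0 i x : Y x -> (0 <= w i x * f (br i x)).
  by move=> Yx; rewrite mulr_ge0 ?w_ge0//; exact/f0/fb_brY.
rewrite integral_nneseries//; last 2 first.
- by move=> i; apply/measurable_EFinP; apply: measurable_funS (mbr i).
- by move=> i x Bx; rewrite lee_fin wf0//; exact: BY.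
pose g z := (f z * \1_B (G z))%:E.
have mg : measurable_fun Y g.
  apply/measurable_EFinP/measurable_funM => //.
  exact: (measurable_comp measurableT _ _ (fb_mG FB)).
have g0 x : Y x -> (0 <= g x)%E by move=> Yx; rewrite lee_fin mulr_ge0 ?f0.
have -> : Y `&` G @^-1` B = \bigcup_i (piece i `&` G @^-1` B).
  by rewrite -setI_bigcupl bigcup_piece.
rewrite ge0_integral_bigcup//; last 4 first.
- by move=> i; rewrite -[piece i](setIidl (@sub_piece i)) -setIA;
    apply: measurableI => //; exact: fb_mpiece.
- rewrite -setI_bigcupl bigcup_piece; apply/measurable_EFinP.
  by apply: measurable_funS mf => // x [].
- by move=> x [i _ [[Yx _] _]]; rewrite lee_fin f0.
- exact: trivIset_setIr trivIset_piece.
apply: eq_eseriesr => i _.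
rewrite -[in LHS](setIidr BY) (@integral_mkcondr _ _ _ m Y B).
rewrite (@integral_mkcondr _ _ _ m (piece i) (G @^-1` B)).
transitivity (\int[m]_(x in Y) ((w i x)%:E * g (br i x)))%E.
  apply: eq_integral => x /[!inE] Yx; rewrite /g (fb_brK FB)//.
  rewrite patchE indicE; case: (x \in B); rewrite ?mulr1// mulr0 mule0//.
rewrite (fb_transfer FB)//.
apply: eq_integral => x /[!inE] -[Yx _].
rewrite /g patchE indicE.
have -> : (x \in G @^-1` B) = (G x \in B) by apply/idP/idP; rewrite !inE.
by case: (G x \in B); rewrite ?mulr1 ?mulr0.
Qed.

Lemma agree_br k i x x' : Y x -> Y x' -> agree k x x' ->
  agree k.+1 (br i x) (br i x').
Proof.
move=> Yx Yx' xx' [_|j jk]; first by rewrite /= !(fb_idx_br FB).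
by rewrite !iterSr !(fb_brK FB)//; exact: xx'.
Qed.

Lemma cone_onW k l D f : (k <= l)%N -> cone_on k D f -> cone_on l D f.
Proof.
move=> kl cf x x' Yx Yx' xx'; apply: cf => // j jk.
by apply: xx'; exact: leq_trans kl.
Qed.

Lemma cone_onWD k D D' f : (forall x, Y x -> 0 <= f x) -> D <= D' ->
  cone_on k D f -> cone_on k D' f.
Proof.
move=> f0 DD' cf x x' Yx Yx' xx'; apply: (le_trans (cf _ _ Yx Yx' xx')).
rewrite ler_wpM2l ?f0// ler_expR ler_wpM2r//.
by have /andP[] := fb_sp FB x x'.
Qed.

(** Along a branch the exponent [sp] is multiplied by [b], while the
    distortion of the weight costs [C * (1 - b)]; one more symbol is shared by
    the preimages. The constant [C] is a fixed point of [D |-> D * b + C * (1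
    - b)]. *)
Lemma transfer_cone k D f : (forall x, Y x -> 0 <= f x) -> bounded_on f ->
  cone_on k.+1 D f -> cone_on k (D * b + C * (1 - b)) (transfer f).
Proof.
move=> f0 bf cf x x' Yx Yx' xx'.
rewrite mulrC -[_ * transfer f x']/(_ *: _) -lim_seriesZ; last exact: cvg_transfer.
apply: lim_series_le; [exact: cvg_transfer| |move=> i].
  by apply: is_cvg_seriesZ; exact: cvg_transfer.
have Yi z : Y z -> Y (br i z) by exact: fb_brY.
have := cf _ _ (Yi _ Yx) (Yi _ Yx') (agree_br i Yx Yx' xx').
rewrite (fb_sp_br FB)// => cfi.
have := ler_pM (w_ge0 _ Yx) (f0 _ (Yi _ Yx)) (fb_dist FB i Yx Yx') cfi.
move=> /le_trans; apply; rewrite mulrACA -expRD mulrC.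
rewrite le_eqVlt; apply/orP; left; apply/eqP.
by rewrite /GRing.scale/=; congr (expR _ * _); ring.
Qed.

Lemma agree0 x x' : agree 0 x x'. Proof. by []. Qed.

Lemma density_cst a : 0 <= a -> density 0 0 (a * V) (cst a).
Proof.
move=> a0; split => //.
- by move=> x x' _ _ _; rewrite mul0r expR0 mulr1.
- exact: bounded_on_cst.
- by under eq_integral do [rewrite [cst a _]/=]; rewrite integral_cst// mYV -EFinM.
Qed.

Lemma transfer_cst1_cone : cone_on 0 C (transfer (cst 1)).
Proof.
have [m1 p1 c1 b1' _] := density_cst ler01.
have := transfer_cone p1 b1' (cone_onW (leq0n 1) c1).
rewrite mul0r add0r; apply: cone_onWD.
  by move=> x Yx; exact: transfer_ge0.
by rewrite ler_piMr ?ltW// gtrBl.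
Qed.

Lemma transfer_cst1_density : density 0 C V (transfer (cst 1)).
Proof.
have t0 x : Y x -> 0 <= transfer (cst 1) x.
  by move=> Yx; apply: transfer_ge0 => //; exact: bounded_on_cst.
have b1' := bounded_on_cst 1.
split => //.
- exact: measurable_transfer.
- exact: transfer_cst1_cone.
- by apply: (cone_bounded (ltW C0)) transfer_cst1_cone.
- rewrite int_transfer// ?setIidl//.
  + by have := dens_int (density_cst ler01); rewrite mul1r.
  + by move=> z Yz; exact: (fb_GY FB).
Qed.

(** The image of the constant 1 lies in the cone and has mean 1. *)
Lemma transfer_sup f (e : R) x : bounded_on f -> (forall z, Y z -> `|f z| <= e) ->
  Y x -> `|transfer f x| <= expR C * e.
Proof.
move=> bf fe Yx; have b1' := bounded_on_cst 1.
have e0 : 0 <= e by rewrite (le_trans _ (fe _ Yx)).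
apply: (@le_trans _ _ (transfer (fun z => e * cst 1 z) x)).
  apply: norm_transfer_le => //; first exact: bounded_onZ.
  by move=> z Yz; rewrite /= mulr1 fe.
rewrite transferZ// mulrC ler_wpM2r//.
rewrite -(ler_pM2r V0) [leRHS]mulrC; apply: cone_le => //; first exact: ltW.
exact: transfer_cst1_density.
Qed.

Lemma transfer_bounded f : bounded_on f -> bounded_on (transfer f).
Proof.
by move=> bf; have [M fM] := bf; exists (expR C * M) => x; exact: transfer_sup.
Qed.

Lemma transfer_density k D a f : density k.+1 D a f ->
  density k (D * b + C * (1 - b)) a (transfer f).
Proof.
move=> [mf f0 cf bf fa]; split.
- exact: measurable_transfer.
- by move=> x Yx; exact: transfer_ge0.
- exact: transfer_cone.
- exact: transfer_bounded.
- rewrite int_transfer// -fa; congr (integral _ _ _).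
  by rewrite setIidl// => x Yx; exact: (fb_GY FB).
Qed.

Lemma density_weaken k l D D' a f : (k <= l)%N -> D <= D' -> density k D a f ->
  density l D' a f.
Proof.
move=> kl DD' [mf f0 cf bf fa]; split => //.
exact/(cone_onWD f0 DD')/(cone_onW kl).
Qed.

Lemma transfer_density0 k a f : density k.+1 C a f -> density k C a (transfer f).
Proof.
by move=> /transfer_density; rewrite -mulrDr addrC subrK mulr1.
Qed.

Lemma iter_transfer_density k a f : density k C a f ->
  density 0 C a (iter k transfer f).
Proof.
elim: k f => // k IH f /transfer_density0 /IH; by rewrite iterSr.
Qed.

Lemma int_le_near f g (e : R) : measurable_fun Y f -> measurable_fun Y g ->
  (forall x, Y x -> 0 <= f x) -> (forall x, Y x -> 0 <= g x) ->
  0 <= e -> (forall x, Y x -> `|f x - g x| <= e) ->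
  (\int[m]_(x in Y) (f x)%:E <= \int[m]_(x in Y) (g x)%:E + (e * V)%:E)%E.
Proof.
move=> mf mg f0 g0 e0 fg; rewrite -(dens_int (density_cst e0)).
rewrite -ge0_integralD//; last 2 first.
- exact/measurable_EFinP.
- exact/measurable_EFinP.
apply: ge0_le_integral => //.
- exact/measurable_EFinP.
- by apply: emeasurable_funD => //; exact/measurable_EFinP.
- move=> x Yx; rewrite -EFinD lee_fin /= addrC -lerBlDr.
  by rewrite (le_trans (ler_norm _)) ?fg.
Qed.

Lemma eq_iter_transfer k f g x : (forall z, Y z -> f z = g z) -> Y x ->
  iter k transfer f x = iter k transfer g x.
Proof.
elim: k x => [|k IH] x fg Yx; first exact: fg.
by rewrite !iterS; apply: eq_transfer => // z Yz; exact: IH.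
Qed.

Lemma iter_transfer_bounded k f : bounded_on f -> bounded_on (iter k transfer f).
Proof. by elim: k => // k IH bf; apply: transfer_bounded; exact: IH. Qed.

Lemma iter_transferD k f g x : bounded_on f -> bounded_on g -> Y x ->
  iter k transfer (f \+ g) x = iter k transfer f x + iter k transfer g x.
Proof.
elim: k x => // k IH x bf bg Yx; rewrite !iterS -transferD//; last 2 first.
- exact: iter_transfer_bounded.
- exact: iter_transfer_bounded.
by apply: eq_transfer => // z Yz; exact: IH.
Qed.

Lemma expR_sub1_le (u M : R) : 0 <= u <= M -> expR u - 1 <= u * expR M.
Proof.
move=> /andP[u0 uM]; apply: (@le_trans _ _ (u * expR u)); last first.
  by rewrite ler_wpM2l// ler_expR.
have eu : expR (- u) * expR u = 1 by rewrite -expRD addNr expR0.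
have := expR_ge1Dx (- u); have := expR_gt0 u; nra.
Qed.

(** The size of the constant, relative to a lower bound of the function, that
    can be subtracted in [cone_sub]. *)
Definition kap : R := (1 - b) / 2 * expR (- (2 * C)).

Lemma kap_gt0 : 0 < kap.
Proof. by rewrite !mulr_gt0 ?expR_gt0// ?invr_gt0// subr_gt0. Qed.

Let exp2C_le1 : expR (- (2 * C)) <= 1.
Proof. by rewrite -[leRHS]expR0 ler_expR; have := C0; lra. Qed.

Lemma kap_le1 : kap <= 1.
Proof.
rewrite -[leRHS]mul1r ler_pM ?expR_ge0//.
- by rewrite divr_ge0// subr_ge0 ltW.
- by rewrite ler_pdivrMr// mul1r lerBlDr; have := b0; lra.
Qed.

(** Subtracting a constant increases the cone constant; there is room between
    [C * (1 + b)] and [2 * C]. *)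
Lemma cone_sub (lo : R) f : (forall x, Y x -> lo <= f x) -> 0 <= lo ->
  cone_on 0 (C * (1 + b)) f ->
  cone_on 0 (2 * C) (fun x => f x - kap * lo).
Proof.
move=> lof lo0 cf x y Yx Yy _.
have := cf x y Yx Yy (@agree0 _ _).
have /andP[s0 s1] := fb_sp FB x y.
set s := sp x y in s0 s1 *.
have fy := lof _ Yy => fxy.
suff : kap * lo * (expR (2 * C * s) - 1) <=
    f y * (expR (2 * C * s) - expR (C * (1 + b) * s)) by lra.
have k0 := ltW kap_gt0.
apply: (@le_trans _ _ (lo * (C * (1 - b) * s))).
  rewrite -mulrA mulrCA ler_wpM2l//.
  apply: (@le_trans _ _ (kap * (2 * C * s * expR (2 * C)))).
    rewrite ler_wpM2l// expR_sub1_le//.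
    by rewrite mulr_ge0 ?ler_piMr// mulr_ge0// ltW.
  rewrite /kap le_eqVlt; apply/orP; left; apply/eqP.
  rewrite expRN; field; rewrite gt_eqF ?expR_gt0//.
apply: ler_pM => //.
  by rewrite !mulr_ge0 ?subr_ge0// ltW.
have -> : 2 * C * s = C * (1 + b) * s + C * (1 - b) * s by ring.
rewrite expRD.
have e1 : 1 <= expR (C * (1 + b) * s).
  by rewrite -[leLHS]expR0 ler_expR !mulr_ge0 ?addr_ge0// ltW.
have := expR_ge1Dx (C * (1 - b) * s).
set u := C * (1 - b) * s => eu.
have u0 : 0 <= u by rewrite !mulr_ge0 ?subr_ge0// ltW.
nra.
Qed.

Definition theta : R := 1 - kap * expR (- (2 * C)).

Lemma theta_ge0 : 0 <= theta.
Proof.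
rewrite subr_ge0 -[leRHS]mul1r ler_pM ?expR_ge0 ?kap_le1//.
exact/ltW/kap_gt0.
Qed.

Lemma theta_lt1 : theta < 1.
Proof. by rewrite gtrBl mulr_gt0 ?kap_gt0 ?expR_gt0. Qed.

(** The operator sends the cone constant [2 * C] to [C * (1 + b)]. This leaves
    room to split off a constant function of mass a fixed fraction of [a], the
    remainder being again in the cone of constant [2 * C]. *)
Lemma density_split a f : 0 <= a -> density 0 (2 * C) a f ->
  density 0 (2 * C) (a * theta)
    (fun x => transfer f x - kap * (a * expR (- (2 * C)) / V)).
Proof.
move=> a0 /(density_weaken (leqnSn 0) (lexx _)) /transfer_density df.
have CE : 2 * C * b + C * (1 - b) = C * (1 + b) by ring.
rewrite CE in df; set e := kap * _.
have C1C : C * (1 + b) <= 2 * C by rewrite mulrC ler_wpM2r// ?ltW//; have := b1; lra.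
have lo x : Y x -> a * expR (- (2 * C)) / V <= transfer f x.
  move=> Yx; rewrite ler_pdivrMr// -ler_pdivlMr ?expR_gt0// -expRN opprK.
  apply: cone_ge => //; first by rewrite mulr_ge0// ltW.
  exact: density_weaken df.
have lo0 : 0 <= a * expR (- (2 * C)) / V by rewrite divr_ge0 ?mulr_ge0 ?expR_ge0// ltW.
have k0 := ltW kap_gt0.
have k1 := kap_le1.
have [mL L0 cL bL iL] := df.
have e0 x : Y x -> 0 <= transfer f x - e.
  move=> Yx; rewrite subr_ge0 (le_trans _ (lo _ Yx))//.
  by rewrite ler_piMl.
split => //.
- exact: measurable_funB.
- exact: cone_sub.
- by apply: (@bounded_onD (transfer f) (cst (- e))) => //; exact: bounded_on_cst.
- set I := integral _ _ _.
  suff EI : ((e * V)%:E + I = a%:E)%E.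
    have -> : I = (I + (e * V)%:E - (e * V)%:E)%E by rewrite addeK.
    rewrite [X in (X - _)%E]addeC EI -EFinB; congr EFin; rewrite /e /theta; field.
    by rewrite gt_eqF.
  have [_ _ _ _ <-] := density_cst (mulr_ge0 k0 lo0).
  rewrite -ge0_integralD//; last 3 first.
  + by move=> x _; rewrite lee_fin mulr_ge0.
  + exact/measurable_EFinP.
  + by apply/measurable_EFinP; exact: measurable_funB.
  by under eq_integral do rewrite -EFinD addrC subrK.
Qed.

(** The constant functions split off from the two densities at each step are
    the same, so that only the remainders, of mass [a * theta ^+ k],
    contribute to the difference. *)
Lemma contraction k a f g x : 0 <= a -> density 0 (2 * C) a f ->
  density 0 (2 * C) a g -> Y x ->
  `|iter k transfer f x - iter k transfer g x| <=
    a * theta ^+ k * (expR (2 * C) / V).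
Proof.
elim: k a f g => [|k IH] a f g a0 df dg Yx.
  have C2 : 0 <= 2 * C by rewrite mulr_ge0// ltW.
  rewrite expr0 mulr1 mulrA /=.
  have := cone_le C2 df Yx; have := cone_le C2 dg Yx.
  rewrite -!ler_pdivlMr// ler_norml.
  by have := dens_ge0 df Yx; have := dens_ge0 dg Yx; lra.
rewrite !iterSr; set e := kap * (a * expR (- (2 * C)) / V).
have spl (u : X -> R) : density 0 (2 * C) a u -> iter k transfer (transfer u) x =
    iter k transfer (fun x => transfer u x - e) x + iter k transfer (cst e) x.
  move=> du; have [_ _ _ bu _] := density_split a0 du.
  rewrite -iter_transferD//; last exact: bounded_on_cst.
  by apply: eq_iter_transfer => // z _; rewrite /= subrK.
rewrite spl// spl// opprD addrACA subrr addr0.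
apply: (le_trans (IH _ _ _ _ (density_split a0 df) (density_split a0 dg) Yx)).
  by rewrite mulr_ge0// theta_ge0.
by rewrite exprS !mulrA.
Qed.

Section InvariantDensity.

Let e0 : X -> R := cst V^-1.

Let de0 : density 0 (2 * C) 1 e0.
Proof.
have := @density_cst V^-1; rewrite invr_ge0 mulVf ?gt_eqF// => /(_ (ltW V0)).
by apply: density_weaken => //; rewrite mulr_ge0// ltW.
Qed.

Definition inv_density : X -> R := fun x => limn (fun k => iter k transfer e0 x).

Lemma transfer_density2 k a f : density 0 (2 * C) a f ->
  density 0 (2 * C) a (iter k transfer f).
Proof.
elim: k => // k IH /IH /(density_weaken (leqnSn 0) (lexx _)).
move=> /transfer_density; apply: density_weaken => //.
have := b1; have := C0; nra.
Qed.

Definition rate : R := expR (2 * C) / V.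

Lemma rate_gt0 : 0 < rate.
Proof. by rewrite divr_gt0 ?expR_gt0. Qed.

Lemma inv_density_cauchy k x l : Y x ->
  `|iter k transfer e0 x - iter (k + l) transfer e0 x| <= theta ^+ k * rate.
Proof.
move=> Yx; rewrite iterD -[theta ^+ k]mul1r.
by apply: contraction => //; exact: transfer_density2.
Qed.

Lemma cvg_theta : theta ^+ k * rate @[k --> \oo] --> 0.
Proof.
rewrite -[X in _ --> X](mul0r rate); apply: cvgMl.
by apply: cvg_expr; rewrite ger0_norm ?theta_ge0 ?theta_lt1.
Qed.

Lemma theta_small (e : R) : 0 < e -> exists k, theta ^+ k * rate <= e.
Proof.
move=> e0'; have /cvgr0Pnorm_le/(_ _ e0')[k _ /(_ k (leqnn _))] := cvg_theta.
by move=> /(le_trans (ler_norm _)) ?; exists k.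
Qed.

Lemma inv_density_is_cvg x : Y x -> cvgn (fun k => iter k transfer e0 x).
Proof.
move=> Yx; apply/cauchy_cvgP/cauchy_exP => e e_gt0.
have [k ke] := theta_small (divr_gt0 e_gt0 (ltr0n R 2)).
exists (iter k transfer e0 x); exists k => // n /= kn.
rewrite /ball/= -(subnKC kn).
rewrite (le_lt_trans (inv_density_cauchy k (n - k) Yx))// (le_lt_trans ke)//.
by rewrite ltr_pdivrMr// ltr_pMr// ltr1n.
Qed.

Lemma inv_density_near k x : Y x ->
  `|iter k transfer e0 x - inv_density x| <= theta ^+ k * rate.
Proof.
move=> Yx.
have : `|iter k transfer e0 x - iter n transfer e0 x| @[n --> \oo] -->
    `|iter k transfer e0 x - inv_density x|.
  by apply: cvg_norm; apply: cvgB; [exact: cvg_cst|exact: inv_density_is_cvg].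
move=> /cvgr_to_le; apply; exists k => // n /= kn.
by rewrite -(subnKC kn); exact: inv_density_cauchy.
Qed.

Lemma inv_density_density : density 0 (2 * C) 1 inv_density.
Proof.
have dk k : density 0 (2 * C) 1 (iter k transfer e0) by exact: transfer_density2.
have h0 x : Y x -> 0 <= inv_density x.
  move=> Yx; apply: limr_ge; first exact: inv_density_is_cvg.
  by apply: nearW => k; exact: (dens_ge0 (dk k)).
have mh : measurable_fun Y inv_density.
  apply: (@measurable_fun_cvg _ _ _ _ (fun k => iter k transfer e0)).
    by move=> k; exact: dens_meas (dk k).
  by move=> x Yx; exact: inv_density_is_cvg.
have ch : cone_on 0 (2 * C) inv_density.
  move=> x y Yx Yy xy; rewrite mulrC.
  have cx := inv_density_is_cvg Yx; have cy := inv_density_is_cvg Yy.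
  rewrite -[leRHS](cvg_lim _ (cvgMr cy))//; apply: ler_lim => //.
    by apply: is_cvgMr.
  by apply: nearW => k; rewrite mulrC; exact: (dens_cone (dk k)).
split => //.
- by apply: cone_bounded ch => //; rewrite mulr_ge0// ltW.
- apply/eqP; rewrite eq_le; apply/andP; split; apply/lee_addgt0Pr => e e_gt0.
  + have [k ke] := theta_small (divr_gt0 e_gt0 V0).
    have [mk k0 _ _ <-] := dk k.
    rewrite -[e in leRHS](divfK (lt0r_neq0 V0)).
    apply: int_le_near => //; first by rewrite divr_ge0 ?ltW.
    by move=> x Yx; rewrite distrC (le_trans (inv_density_near k Yx)).
  + have [k ke] := theta_small (divr_gt0 e_gt0 V0).
    have [mk k0 _ _ <-] := dk k.
    rewrite -[e in leRHS](divfK (lt0r_neq0 V0)).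
    apply: int_le_near => //; first by rewrite divr_ge0 ?ltW.
    by move=> x Yx; rewrite (le_trans (inv_density_near k Yx)).
Qed.

Lemma transfer_inv_density x : Y x -> transfer inv_density x = inv_density x.
Proof.
move=> Yx; apply/eqP; rewrite -subr_eq0 -normr_le0; apply/ler_addgt0Pl => e e_gt0.
rewrite addr0.
pose K := expR C + 1.
have K0 : 0 < K by rewrite addr_gt0// expR_gt0.
have [k ke] := theta_small (divr_gt0 e_gt0 K0).
have bh := dens_bnd inv_density_density.
have be : bounded_on (iter k transfer e0).
  by apply: iter_transfer_bounded; exact: bounded_on_cst.
have near_k z : Y z -> `|(inv_density \- iter k transfer e0) z| <= e / K.
  by move=> Yz; rewrite distrC (le_trans (inv_density_near k Yz)).
have near_k1 : `|iter k.+1 transfer e0 x - inv_density x| <= e / K.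
  rewrite (le_trans (inv_density_near k.+1 Yx))// (le_trans _ ke)//.
  rewrite ler_wpM2r//; first exact: ltW rate_gt0.
  by rewrite exprS ler_piMl ?exprn_ge0 ?theta_ge0 ?(ltW theta_lt1).
have := transfer_sup (bounded_onB bh be) near_k Yx.
rewrite transferB// => A1.
rewrite -(subrKA (iter k.+1 transfer e0 x)) (le_trans (ler_normD _ _))//.
rewrite (le_trans (lerD A1 near_k1))// /K.
rewrite -{2}[e / _]mul1r -mulrDl mulrC divfK// gt_eqF//.
Qed.

Lemma iter_transfer_sup k f (e : R) x : bounded_on f ->
  (forall z, Y z -> `|f z| <= e) -> Y x ->
  `|iter k transfer f x| <= expR C ^+ k * e.
Proof.
move=> bf fe; elim: k x => [|k IH] x Yx; first by rewrite expr0 mul1r fe.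
rewrite exprS -mulrA iterS; apply: transfer_sup => //.
exact: iter_transfer_bounded.
Qed.

(** The difference is the telescoping sum of the images of [f - transfer f]
    under the first [k] iterates. *)
Lemma almost_invariant k f (e : R) x : bounded_on f ->
  (forall x, Y x -> `|f x - transfer f x| <= e) -> Y x ->
  `|f x - iter k transfer f x| <= (\sum_(j < k) expR C ^+ j) * e.
Proof.
move=> bf fe; elim: k => [|k IH] Yx.
  by rewrite subrr normr0 big_ord0 mul0r.
rewrite -(subrKA (iter k transfer f x)) big_ord_recr/= mulrDl.
rewrite (le_trans (ler_normD _ _))// lerD ?IH//.
have bt := transfer_bounded bf.
have -> : iter k transfer f x - transfer (iter k transfer f) x =
    iter k transfer (f \- transfer f) x.
  rewrite -iterS iterSr; elim: (k) (x) Yx => // n IHn z Yz.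
  rewrite iterS iterS -transferB//; do ?exact: iter_transfer_bounded.
  by rewrite -[RHS]/(transfer _ z); apply: eq_transfer => // y Yy; exact: IHn.
by apply: iter_transfer_sup => //; exact: bounded_onB.
Qed.

(** The number [k] of iterations is chosen first, to bring all densities of
    the cone close to the invariant one; then [dl] is chosen to keep [f] close
    to its k-th iterate. *)
Lemma near_inv_density (e : R) : 0 < e -> exists2 dl, 0 < dl & forall f,
  density 0 C 1 f -> (forall x, Y x -> `|f x - transfer f x| <= dl) ->
  forall x, Y x -> `|f x - inv_density x| <= e.
Proof.
move=> e_gt0; have e3 : 0 < e / 3 by rewrite divr_gt0.
have [k ke] := theta_small e3.
pose S := \sum_(j < k) expR C ^+ j + 1.
have S0 : 0 <= \sum_(j < k) expR C ^+ j.
  by apply: sumr_ge0 => j _; rewrite exprn_ge0// expR_ge0.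
exists (e / 3 / S); first by rewrite divr_gt0// ltr_wpDl.
move=> f df fdl x Yx.
have A1 := almost_invariant k (dens_bnd df) fdl Yx.
have A2 := inv_density_near k Yx.
have df2 : density 0 (2 * C) 1 f.
  by apply: density_weaken df => //; have := C0; lra.
have A3 := contraction k ler01 df2 de0 Yx.
have A1' : `|f x - iter k transfer f x| <= e / 3.
  apply: (le_trans A1); rewrite mulrCA ler_piMr ?(ltW e3)//.
  by rewrite ler_pdivrMr ?mul1r ?lerDl ?ltr_wpDl.
rewrite -(subrKA (iter k transfer e0 x)).
rewrite (le_trans (ler_normD _ _))//.
apply: (@le_trans _ _ (e / 3 + e / 3 + e / 3)); last by lra.
rewrite lerD//; last exact: le_trans ke.
rewrite -(subrKA (iter k transfer f x)).
rewrite (le_trans (ler_normD _ _))// lerD//.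
by rewrite (le_trans A3)// mul1r.
Qed.

End InvariantDensity.

(** * Mixing of cylinders *)

Lemma iterG_Y k x : Y x -> Y (iter k G x).
Proof. by move=> Yx; elim: k => // k; exact: (fb_GY FB). Qed.

Lemma measurable_iterG k : measurable_fun Y (iter k G).
Proof.
elim: k => [|k IH]; first exact: measurable_id.
apply: (measurable_comp mY _ (fb_mG FB) IH).
by move=> _ [x Yx <-]; exact: iterG_Y.
Qed.

Lemma int_iter_transfer k f B : measurable_fun Y f -> (forall z, Y z -> 0 <= f z) ->
  bounded_on f -> measurable B -> B `<=` Y ->
  (\int[m]_(x in B) (iter k transfer f x)%:E =
   \int[m]_(x in Y `&` iter k G @^-1` B) (f x)%:E)%E.
Proof.
move=> mf f0 bf; elim: k B => [|k IH] B mB BY; first by rewrite setIidr.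
have mi j : measurable_fun Y (iter j transfer f) /\ (forall z, Y z -> 0 <= iter j transfer f z).
  elim: j => // j [mj j0]; have bj := iter_transfer_bounded j bf.
  by split; [exact: measurable_transfer|move=> z Yz; exact: transfer_ge0].
rewrite -/(iter k.+1 transfer f) [X in X = _](_ : _ =
    \int[m]_(x in B) (transfer (iter k transfer f) x)%:E)%E//.
rewrite int_transfer//; first last.
- exact: iter_transfer_bounded.
- by apply: (mi k).2.
- by apply: (mi k).1.
rewrite IH//; last exact: (fb_mG FB).
congr (integral _ _ _); apply/seteqP; split => x [Yx /=].
  by move=> [].
by split => //; split => //; exact: iterG_Y.
Qed.

Lemma inv_density_invariant B : measurable B -> B `<=` Y ->
  (\int[m]_(x in Y `&` G @^-1` B) (inv_density x)%:E =
   \int[m]_(x in B) (inv_density x)%:E)%E.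
Proof.
move=> mB BY; have [mh h0 _ bh _] := inv_density_density.
rewrite -int_transfer//; apply: eq_integral => x /[!inE] /BY Yx.
by rewrite transfer_inv_density.
Qed.

Definition saturated k A := forall x x', Y x -> Y x' -> agree k x x' -> A x -> A x'.

Lemma agree_sym k x x' : agree k x x' -> agree k x' x.
Proof. by move=> xx' j /xx'. Qed.

Lemma saturated_density k A : measurable A -> A `<=` Y -> saturated k A ->
  density k C (fine (m A)) \1_A.
Proof.
move=> mA AY sA; split.
- exact: measurable_indic.
- by move=> x _; rewrite indicE.
- move=> x x' Yx Yx' xx'; rewrite !indicE.
  have -> : (x \in A) = (x' \in A).
    by apply/idP/idP; rewrite !inE; apply: sA => //; exact: agree_sym.
  rewrite ler_peMr// -[leLHS]expR0 ler_expR mulr_ge0// ?(ltW C0)//.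
  by have /andP[] := fb_sp FB x x'.
- by exists 1 => x _; rewrite indicE; case: (_ \in _); rewrite ?normr1 ?normr0.
- rewrite integral_indic// setIidl// fineK//.
  rewrite ge0_fin_numE// (@le_lt_trans _ _ (m Y)) ?mYV ?ltry//.
  by rewrite -mYV le_measure// inE.
Qed.

(** The k-th iterate of the operator turns the indicator of [A] into a density
    of the cone, which is bounded below by a multiple of its mass. *)
Lemma cylinder_mixing k A B : measurable A -> A `<=` Y -> saturated k A ->
  measurable B -> B `<=` Y ->
  (m A * m B <= m (A `&` iter k G @^-1` B) * (V * expR C)%:E)%E.
Proof.
move=> mA AY sA mB BY.
have fA : m A \is a fin_num.
  rewrite ge0_fin_numE// (@le_lt_trans _ _ (m Y)) ?mYV ?ltry//.
  by rewrite -mYV le_measure// inE.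
have d1 := saturated_density mA AY sA.
have [m1 p1 _ bd1 _] := d1.
have dL := iter_transfer_density d1; have [mL L0 _ _ _] := dL.
have -> : (m (A `&` iter k G @^-1` B) =
    \int[m]_(x in B) (iter k transfer \1_A x)%:E)%E.
  rewrite int_iter_transfer// integral_indic//; last exact: measurable_iterG.
  by rewrite setIA (setIidl AY).
have mLB : measurable_fun B (iter k transfer \1_A) by apply: measurable_funS mL.
rewrite [leRHS]muleC -ge0_integralZl//; last 3 first.
- exact/measurable_EFinP.
- by move=> x /BY Yx; rewrite lee_fin L0.
- by rewrite lee_fin mulr_ge0 ?expR_ge0// ltW.
rewrite -(fineK fA) -integral_cst//; apply: ge0_le_integral => //.
- by move=> x _; rewrite lee_fin fine_ge0.
- by apply: emeasurable_funM => //; exact/measurable_EFinP.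
move=> x /BY Yx; rewrite -EFinM lee_fin mulrC mulrA.
exact: cone_ge (ltW C0) dL Yx.
Qed.

Lemma mass_gt0 i : 0 < mass i.
Proof.
have [Y0|/set0P[x Yx]] := eqVneq Y set0.
  by have := mYV; rewrite Y0 measure0 => -[] V0'; move: V0; rewrite -V0' ltxx.
have := w_le i Yx; have /lt_le_trans h := fb_w_gt0 FB i Yx.
by move=> /h; rewrite pmulr_lgt0// divr_gt0// expR_gt0.
Qed.

Lemma null_preimage N : measurable N -> N `<=` Y -> m N = 0 ->
  m (Y `&` G @^-1` N) = 0.
Proof.
move=> mN NY N0.
have mGN : measurable (Y `&` G @^-1` N) by exact: (fb_mG FB).
rewrite -[LHS]mul1e -integral_cst//.
have := @int_transfer (cst 1) N (measurable_cst _) (fun _ _ => ler01)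
  (bounded_on_cst 1) mN NY.
move=> <-; apply: null_set_integral => //.
have [mL _ _ _ _] := transfer_cst1_density.
by apply/measurable_EFinP; exact: measurable_funS mL.
Qed.

End FullBranch.

(** * Ergodicity and uniqueness of the invariant measure on the base *)

Section Ergodic.
Context {R : realType}.
Local Notation X := (measurableTypeR R).
Local Notation leb := (@lebesgue_measure R).
Variables (Y : set X) (G : X -> X) (idx : X -> nat) (br : nat -> X -> X).
Variables (w : nat -> X -> R) (sp : X -> X -> R) (b C V p q : R).

Hypothesis FB : full_branch leb Y G idx br w sp b C V.
Hypothesis YI : forall x : R, Y x -> p < x < q.
Hypothesis IY : leb (`]p, q[ `\` Y) = 0%E.
Hypothesis convY : forall x y z : R, Y x -> Y y -> Y z -> x <= y <= z ->
  idx x = idx z -> idx y = idx x.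
Hypothesis monoG : forall x y : R, Y x -> Y y -> x <= y ->
  idx x = idx y -> (G x : R) <= G y.

Let mY := fb_mY FB.
Let V0 := fb_V FB.

Local Notation agree := (agree G idx).

Let le_leb (A B : set X) : measurable A -> measurable B -> A `<=` B ->
  (leb A <= leb B)%E.
Proof. by move=> mA mB AB; apply: le_measure; rewrite ?inE. Qed.

Let mixing k (A B : set X) : measurable A -> A `<=` Y -> saturated Y G idx k A ->
  measurable B -> B `<=` Y ->
  (leb A * leb B <= leb (A `&` iter k G @^-1` B) * (V * expR C)%:E)%E.
Proof. exact: (cylinder_mixing FB). Qed.

Definition cyl k (x : X) : set X := Y `&` [set z | agree k x z].

Lemma cyl_self k x : Y x -> cyl k x x.
Proof. by split. Qed.

Lemma cylS k x : cyl k.+1 x =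
  cyl k x `&` (iter k G @^-1` piece Y idx (idx (iter k G x))).
Proof.
apply/seteqP; split=> z.
- move=> [Yz xz]; split; last by split; [exact: iterG_Y FB _ _ Yz|rewrite /= -xz].
  by split=> // j jk; exact/xz/leqW.
- move=> [[Yz xz] [_ /= xk]]; split=> // j; rewrite ltnS leq_eqVlt => /predU1P[->//|].
  exact: xz.
Qed.

Lemma measurable_cyl k x : Y x -> measurable (cyl k x).
Proof.
move=> Yx; elim: k => [|k IH]; first by rewrite /cyl (_ : [set z | _] = setT) ?setIT//;
  apply/seteqP; split.
rewrite cylS -[cyl k x](setIidl (@subIsetl _ Y _)) -setIA; apply: measurableI => //.
by apply: (measurable_iterG FB) => //; exact: (fb_mpiece FB).
Qed.

Lemma saturated_cyl k x : saturated Y G idx k (cyl k x).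
Proof.
move=> y z Yy Yz yz [_ xy]; split=> // j jk; rewrite xy//; exact: yz.
Qed.

Lemma cyl_convex k x (s t u : R) : cyl k x s -> cyl k x u -> Y t ->
  s <= t <= u -> cyl k x t.
Proof.
move=> [Ys xs] [Yu xu] Yt stu; split=> // j.
suff H : (j < k)%N -> (iter j G s : R) <= iter j G t <= iter j G u /\
    idx (iter j G x) = idx (iter j G t) by move=> /H[].
have idj n : (n < k)%N -> (iter n G s : R) <= iter n G t <= iter n G u ->
   idx (iter n G x) = idx (iter n G t).
  move=> nk sn; rewrite xs//; apply/esym/(convY _ _ _ sn); do ?exact: (iterG_Y FB).
  by rewrite -xs// xu.
elim: j => [|j IH] jk; first by split => //; exact: idj.
suff sj : (iter j.+1 G s : R) <= iter j.+1 G t <= iter j.+1 G u by split => //; exact: idj.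
have [/andP[stj tuj] xt] := IH (ltnW jk).
rewrite !iterS; apply/andP; split; apply: monoG => //; do ?exact: (iterG_Y FB).
- by rewrite -xt -xs// ltnW.
- by rewrite -xt -xu// ltnW.
Qed.

Lemma leb_sub_fin (A : set X) : A `<=` Y -> measurable A -> leb A \is a fin_num.
Proof.
move=> AY mA; rewrite ge0_fin_numE//.
rewrite (@le_lt_trans _ _ (leb Y)) ?(fb_mYV FB) ?ltry//.
by rewrite -(fb_mYV FB) le_measure// inE.
Qed.

Lemma cyl_sub k x : cyl k x `<=` Y. Proof. by move=> z []. Qed.

(** A cylinder contains the points of [Y] between any two of its points, and
    [Y] has full measure in the interval. *)
Lemma cyl_diam k x (s t : R) : Y x -> cyl k x s -> cyl k x t ->
  ((`|s - t|)%:E <= leb (cyl k x))%E.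
Proof.
move=> Yx; wlog st : s t / s <= t.
  have [st h|/ltW ts h] := leP s t; first exact: h.
  by move=> cs ct; rewrite distrC; exact: h.
move=> cs ct; rewrite distrC ger0_norm ?subr_ge0//.
move: st; rewrite le_eqVlt => /predU1P[->|st]; first by rewrite subrr.
have sub : `]s, t[ `<=` cyl k x `|` (`]p, q[ `\` Y).
  move=> z /=; rewrite in_itv/= => /andP[sz zt].
  have [Yz|nYz] := pselect (Y z).
    by left; apply: (cyl_convex cs ct) => //; rewrite !ltW.
  right; split => //=; rewrite in_itv/=.
  have /andP[ps _] := YI (cyl_sub cs); have /andP[_ tq] := YI (cyl_sub ct).
  by rewrite (lt_trans ps)// (lt_trans _ tq).
have mc := measurable_cyl k Yx.
have mD : measurable (`]p, q[ `\` Y : set X) by apply: measurableD => //; exact: measurable_itv.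
have mst : measurable (`]s, t[ : set X) by exact: measurable_itv.
have := le_leb mst (measurableU _ _ mc mD) sub.
rewrite lebesgue_measure_itv/= lte_fin st -EFinB => /le_trans; apply.
apply: (@le_trans _ _ (leb (cyl k x) + leb (`]p, q[ `\` Y))%E).
  exact: measureU2.
by rewrite IY adde0.
Qed.

Let mmin := Order.min (mass leb Y idx 0) (mass leb Y idx 1).

(** The image of a cylinder of rank k under the k-th iterate fills [Y] with
    bounded distortion. A refinement keeps the part over one piece only, so it
    loses at least the part over piece 0 or the part over piece 1. *)
Definition shrink : R := 1 - mmin / (V * expR C).

Let VC0 : 0 < V * expR C. Proof. by rewrite mulr_gt0 ?expR_gt0. Qed.

Let mmin_gt0 : 0 < mmin.
Proof. by rewrite lt_min !(mass_gt0 FB). Qed.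

Lemma shrink_lt1 : shrink < 1.
Proof. by rewrite gtrBl divr_gt0. Qed.

Let piece_meas i := fb_mpiece FB i.

Lemma shrink_ge0 : 0 <= shrink.
Proof.
rewrite subr_ge0 ler_pdivrMr// mul1r ge_min; apply/orP; left.
apply: (@le_trans _ _ V); last first.
  by rewrite ler_peMr ?(ltW V0)// -[leLHS]expR0 ler_expR ltW// (fb_C FB).
rewrite -lee_fin (massE FB) -(fb_mYV FB) le_measure// ?inE//.
exact: sub_piece.
Qed.

Lemma leb_cyl_le k x : Y x -> (leb (cyl k x) <= (shrink ^+ k * V)%:E)%E.
Proof.
move=> Yx; elim: k => [|k IH].
  rewrite expr0 mul1r -(fb_mYV FB) le_measure// ?inE//; first exact: measurable_cyl.
  exact: cyl_sub.
have mk := measurable_cyl k Yx; have mk1 := measurable_cyl k.+1 Yx.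
set j := idx (iter k G x).
pose B := Y `\` piece Y idx j.
have mB : measurable B by exact: measurableD.
have BY : B `<=` Y by move=> z [].
have minB : (mmin%:E <= leb B)%E.
  have [i [ij imin]] : exists i, i != j /\ mmin <= mass leb Y idx i.
    have [->|j0] := eqVneq j 0%N; [exists 1%N|exists 0%N].
      by rewrite /mmin ge_min lexx orbT.
    by rewrite eq_sym j0 /mmin ge_min lexx.
  rewrite (@le_trans _ _ (mass leb Y idx i)%:E) ?lee_fin// (massE FB).
  rewrite le_measure ?inE// => z [Yz /= zi]; split => // -[_ /= zj].
  by move: ij; rewrite -zi zj eqxx.
have := mixing mk (@cyl_sub k x) (@saturated_cyl k x) mB BY.
set D := cyl k x `&` _.
have mD : measurable D.
  rewrite /D -[cyl k x](setIidl (@cyl_sub k x)) -setIA; apply: measurableI => //.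
  exact: (measurable_iterG FB).
have cylE : leb (cyl k x) = (leb (cyl k.+1 x) + leb D)%E.
  rewrite -measureU//.
    congr (leb _); rewrite cylS -/j /D -setIUr; apply/esym/setIidl => z [Yz _].
    have Yk : Y (iter k G z) by exact: (iterG_Y FB).
    have [zj|zj] := eqVneq (idx (iter k G z)) j; [by left|right; split => //].
    by move=> [_ /= zj']; rewrite zj' eqxx in zj.
  apply/seteqP; split => // z []; rewrite cylS => -[_ /= zj] [_ [_]]; exact.
have fD : leb D \is a fin_num by apply: leb_sub_fin => // z [/cyl_sub].
have fk1 : leb (cyl k.+1 x) \is a fin_num by apply: leb_sub_fin => //; exact: cyl_sub.
move=> mix; rewrite cylE in IH mix; move: IH minB mix.
have fB : leb B \is a fin_num by exact: leb_sub_fin.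
rewrite -(fineK fD) -(fineK fk1) -(fineK fB) -!EFinD -!EFinM !lee_fin => IH minB mix.
set u := fine (leb (cyl k.+1 x)) in IH mix *.
set v := fine (leb D) in IH mix *.
have v0 : 0 <= v by rewrite fine_ge0.
have u0 : 0 <= u by rewrite fine_ge0.
have : (u + v) * (mmin / (V * expR C)) <= v.
  rewrite mulrA ler_pdivrMr//; apply: le_trans mix.
  by rewrite ler_wpM2l// addr_ge0.
move=> h; apply: (@le_trans _ _ (shrink * (u + v))).
  by rewrite /shrink mulrBl mul1r mulrC; lra.
by rewrite exprS -mulrA ler_wpM2l// shrink_ge0.
Qed.

Lemma cyl_small (x : X) (e : R) : Y x -> 0 < e ->
  exists k, forall z, cyl k x z -> `|(z : R) - x| < e.
Proof.
move=> Yx e0.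
have : shrink ^+ k * V @[k --> \oo] --> 0.
  rewrite -[X in _ --> X](mul0r V); apply: cvgMl.
  by apply: cvg_expr; rewrite ger0_norm ?shrink_ge0 ?shrink_lt1.
move=> /cvgr0Pnorm_lt/(_ _ e0)[k _ /(_ k (leqnn _))] ke; exists k => z xz.
have := le_trans (cyl_diam Yx xz (cyl_self k Yx)) (leb_cyl_le k Yx).
by rewrite lee_fin => /le_lt_trans; apply; exact: le_lt_trans (ler_norm _) ke.
Qed.

(** The set is a union of cylinders of rank [k], and there are countably many
    of them. *)
Lemma measurable_saturated k A : A `<=` Y -> saturated Y G idx k A -> measurable A.
Proof.
move=> AY sA.
pose F s := A `&` [set z | [seq idx (iter j G z) | j <- iota 0 k] = s].
have -> : A = \bigcup_s F s.
  apply/seteqP; split=> [z Az|z [s _ []]//].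
  by exists [seq idx (iter j G z) | j <- iota 0 k].
apply: countable_bigcupT_measurable; first exact: countableP.
move=> s; have [[x [Ax xs]]|h] := pselect (exists x, F s x); last first.
  by rewrite (_ : F s = set0)//; apply/seteqP; split=> // x Fx; apply: h; exists x.
suff -> : F s = cyl k x by apply: measurable_cyl; exact: AY.
have agreeE (y z : X) : agree k y z <->
   [seq idx (iter j G y) | j <- iota 0 k] = [seq idx (iter j G z) | j <- iota 0 k].
  split=> [yz|yz j jk].
    by apply/eq_in_map => j; rewrite mem_iota => /andP[_]; rewrite add0n; exact: yz.
  have /eq_in_map := yz; apply; by rewrite mem_iota.
apply/seteqP; split=> [z [Az zs]|z [Yz xz]].
  by split; [exact: AY|apply/agreeE; rewrite xs zs].
split; first exact: (sA x z (AY _ Ax) Yz).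
by rewrite /= -xs; apply/esym/agreeE.
Qed.

Lemma null_iter_preimage B k : measurable B -> B `<=` Y ->
  leb ((Y `&` G @^-1` B) `\` B) = 0%E ->
  leb ((Y `&` iter k G @^-1` B) `\` B) = 0%E.
Proof.
move=> mB BY N0.
have mGB j : measurable (Y `&` iter j G @^-1` B) by exact: (measurable_iterG FB).
elim: k => [|k IH].
  by rewrite (_ : _ `\` _ = set0) ?measure0//; apply/seteqP; split=> // z [[_]].
set Nk := (_ `\` B) in IH; set N1 := (_ `\` B) in N0.
have mN1 : measurable N1 by apply: measurableD => //; exact: (fb_mG FB).
have mNk : measurable Nk by exact: measurableD.
have NkY : Nk `<=` Y by move=> z [[]].
have := null_preimage FB mNk NkY IH; set M := Y `&` G @^-1` Nk => M0.
have mM : measurable M by exact: (fb_mG FB).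
apply/eqP; rewrite -measure_le0.
apply: (@le_trans _ _ (leb (M `|` N1))).
  apply: le_measure; rewrite ?inE//; [exact: measurableD|exact: measurableU|].
  move=> z [[Yz]]; rewrite /= -iterS iterSr => zk nBz.
  have [Bz|nBGz] := pselect (B (G z)); [by right|left; split => //].
  by split => //; split => //; exact: (fb_GY FB).
apply: (@le_trans _ _ (leb M + leb N1)%E); first exact: measureU2.
by rewrite M0 N0 adde0.
Qed.

(** The open set [U] is exhausted by the unions of the cylinders of rank k
    that it contains, to which [cylinder_mixing] applies; the preimages of [B]
    can be replaced by [B]. The proportion of [B] in [U] is thus bounded below
    independently of [U]. *)
Lemma invariant_mixing B U : measurable B -> B `<=` Y ->
  leb ((Y `&` G @^-1` B) `\` B) = 0%E -> open (U : set R) ->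
  (leb (Y `&` U) * leb B <= leb (U `&` B) * (V * expR C)%:E)%E.
Proof.
move=> mB BY N0 oU.
have mU : measurable (U : set X) by exact: open_measurable.
pose W k := Y `&` [set x | cyl k x `<=` U].
have WY k : W k `<=` Y by move=> x [].
have sW k : saturated Y G idx k (W k).
  move=> x y Yx Yy xy [_ /= xU]; split => //= z [Yz yz]; apply: xU.
  by split => // j jk; rewrite xy// yz.
have mW k : measurable (W k) by exact: measurable_saturated (WY k) (sW k).
have WU : \bigcup_k W k = Y `&` U.
  apply/seteqP; split=> [x [k _ [Yx xU]]|x [Yx Ux]].
    by split => //; apply: xU; exact: cyl_self.
  have /nbhs_ballP[e /= e0 xeU] : nbhs (x : R) U by exact: open_nbhs_nbhs.
  have [k ke] := cyl_small Yx e0.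
  exists k => //; split => //= z /ke zx; apply: xeU.
  by rewrite /ball/= distrC.
have ndW : {homo W : n k / (n <= k)%N >-> (n <= k)%O}.
  move=> n k nk; apply/subsetPset => x [Yx xU]; split => //= z [Yz xz].
  by apply: xU; split => // j jn; apply: xz; exact: leq_trans nk.
have cW : (leb \o W) x @[x --> \oo] --> leb (Y `&` U).
  rewrite -WU; apply: nondecreasing_cvg_mu => //.
  by rewrite WU; exact: measurableI.
have fB : leb B \is a fin_num by exact: leb_sub_fin.
have cWB : (leb (W k) * leb B)%E @[k --> \oo] --> (leb (Y `&` U) * leb B)%E.
  exact: cvgeZr.
rewrite -(cvg_lim _ cWB)//; apply: lime_le.
  by apply/cvg_ex; eexists; exact: cWB.
apply: nearW => k.
apply: (le_trans (mixing (mW k) (WY k) (sW k) mB BY)).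
rewrite lee_wpmul2r//; first by rewrite lee_fin ltW.
have mGB : measurable (Y `&` iter k G @^-1` B) by exact: (measurable_iterG FB).
have mN := measurableD mGB mB.
apply: (@le_trans _ _ (leb ((U `&` B) `|` ((Y `&` iter k G @^-1` B) `\` B)))).
  apply: le_measure; rewrite ?inE.
  - by rewrite -[W k](setIidl (WY k)) -setIA; apply: measurableI.
  - by apply: measurableU => //; exact: measurableI.
  move=> x [[Yx xU] xB]; have [Bx|nBx] := pselect (B x); [left|right] => //.
  by split => //; apply: xU; exact: cyl_self.
apply: (@le_trans _ _ (leb (U `&` B) + leb ((Y `&` iter k G @^-1` B) `\` B))%E).
  by apply: measureU2 => //; exact: measurableI.
by rewrite null_iter_preimage// adde0.
Qed.

(** An open set close to the complement of [B] contains little of [B], which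
    contradicts the lower bound of [invariant_mixing] unless one of the two
    sets is null. *)
Lemma ergodic B : measurable B -> B `<=` Y ->
  leb ((Y `&` G @^-1` B) `\` B) = 0%E -> leb B = 0%E \/ leb (Y `\` B) = 0%E.
Proof.
move=> mB BY N0; pose A := Y `\` B.
have mA : measurable A by exact: measurableD.
have AY : A `<=` Y by move=> x [].
suff : (leb A * leb B <= 0)%E.
  rewrite le_eqVlt ltNge mule_ge0// orbF mule_eq0 => /orP[]/eqP; by [right|left].
apply/lee_addgt0Pr => e e0; rewrite add0e.
have fA : (leb A < +oo)%E by rewrite ltey_eq leb_sub_fin.
have [U [oU AU Ue]] := lebesgue_regularity_outer mA fA (divr_gt0 e0 VC0).
have mU : measurable (U : set X) by exact: open_measurable.
apply: (@le_trans _ _ (leb (Y `&` U) * leb B)%E).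
  rewrite lee_wpmul2r// le_measure ?inE//; first exact: measurableI.
  by move=> x Ax; split; [exact: AY|exact: AU].
apply: (le_trans (invariant_mixing mB BY N0 oU)).
rewrite -[e in leRHS](divfK (lt0r_neq0 VC0)) [leRHS]EFinM lee_wpmul2r//; first by rewrite lee_fin ltW.
rewrite (le_trans _ (ltW Ue))// le_measure ?inE//.
- exact: measurableI.
- exact: measurableD.
- by move=> x [Ux Bx]; split => // -[].
Qed.

(** Let [B] be the set where the density of [nu] exceeds [nu Y * h]. Both
    measures are invariant, so they give equal masses to [B \ G^-1 B] and to
    [G^-1 B \ B]; as they are ordered in opposite ways on these two sets, the
    first one is null. By ergodicity [B] is null or of full measure, and the
    latter is excluded because the total masses agree. Hence [nu] is at most
    [nu Y * h], with equal total mass. *)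
Lemma invariant_unique (nu : {finite_measure set X -> \bar R}) :
  (forall A, measurable A -> A `<=` Y -> leb A = 0%E -> nu A = 0%E) ->
  nu (~` Y) = 0%E ->
  (forall A, measurable A -> A `<=` Y -> nu (Y `&` G @^-1` A) = nu A) ->
  forall A, measurable A -> A `<=` Y ->
    nu A = (nu Y * \int[leb]_(x in A) (inv_density br w V x)%:E)%E.
Proof.
move=> nu_abs nuY nu_inv.
have sp_nu (S D : set X) : measurable S -> measurable D ->
    nu S = (nu (S `&` D) + nu (S `\` D))%E.
  by move=> mS mD; rewrite addeC -measureDI.
have sp_leb (S D : set X) : measurable S -> measurable D ->
    leb S = (leb (S `&` D) + leb (S `\` D))%E.
  by move=> mS mD; rewrite addeC -measureDI.
have numu : nu `<< leb.
  apply/null_content_dominatesP => A mA A0.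
  have mAY : measurable (A `&` Y) by exact: measurableI.
  have AY0 : nu (A `&` Y) = 0%E.
    apply: nu_abs => //; apply/eqP; rewrite -measure_le0 -[leRHS]A0.
    exact: le_leb.
  have AY1 : nu (A `\` Y) = 0%E.
    apply/eqP; rewrite -measure_le0 -nuY; apply: le_measure; rewrite ?inE.
    - exact: measurableD.
    - exact: measurableC.
    - by move=> z [].
  by rewrite [LHS](sp_nu A Y)// AY0 AY1 adde0.
have [f [f0 ff intf fE]] := radon_nikodym_sigma_finite numu.
have [mh h0 _ bh ih] := inv_density_density FB.
set h := inv_density br w V in mh h0 bh ih *.
have mf : measurable_fun setT f by exact: measurable_int intf.
pose fr x := fine (f x).
have frE x : f x = (fr x)%:E by rewrite /fr fineK.
have fr0 x : 0 <= fr x by rewrite -lee_fin -frE.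
have mfr : measurable_fun setT fr.
  by apply/measurable_EFinP; rewrite (_ : _ \o _ = f)//; apply/funext => x; rewrite /= -frE.
have fnu S : measurable S -> nu S \is a fin_num by move=> mS; exact: fin_num_measure.
pose t := fine (nu Y).
have tE : nu Y = t%:E by rewrite fineK// fnu.
have t0 : 0 <= t by rewrite fine_ge0.
pose g x := t * h x.
have mg : measurable_fun Y g by exact: measurable_funM.
have g0 x : Y x -> 0 <= g x by move=> Yx; rewrite mulr_ge0// h0.
pose e S := (\int[leb]_(x in S) (g x)%:E)%E.
have eE S : measurable S -> S `<=` Y -> e S = (t%:E * \int[leb]_(x in S) (h x)%:E)%E.
  move=> mS SY; rewrite -ge0_integralZl//; last 2 first.
  - by apply/measurable_EFinP; exact: measurable_funS mh.
  - by move=> x /SY Yx; rewrite lee_fin h0.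
have eY : e Y = nu Y by rewrite eE// ih mule1.
have fe S : measurable S -> S `<=` Y -> e S \is a fin_num.
  move=> mS SY; rewrite ge0_fin_numE; last first.
    by apply: integral_ge0 => x /SY Yx; rewrite lee_fin g0.
  apply: (@le_lt_trans _ _ (e Y)); last by rewrite eY ltey_eq fnu.
  apply: ge0_subset_integral => //; first exact/measurable_EFinP.
have nuint S : measurable S -> nu S = (\int[leb]_(x in S) (fr x)%:E)%E.
  by move=> mS; rewrite fE//; apply: eq_integral => x _; rewrite -frE.
pose B := Y `&` [set x | g x < fr x].
have mB : measurable B.
  by apply: measurable_fun_ltr => //; exact: measurable_funTS.
have BY : B `<=` Y by move=> x [].
have ltB S : measurable S -> S `<=` B -> e S = nu S -> leb S = 0%E.
  move=> mS SB eSnu; have SY x : S x -> Y x by move=> /SB[].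
  pose u x := fr x - g x.
  have mu : measurable_fun S u.
    by apply: measurable_funB; [exact: measurable_funTS|exact: measurable_funS mg].
  have u0 x : S x -> 0 < u x by move=> /SB[_ /=]; rewrite subr_gt0.
  have : (nu S = e S + \int[leb]_(x in S) (u x)%:E)%E.
    rewrite -ge0_integralD//; last 4 first.
    - by move=> x /SY Yx; rewrite lee_fin g0.
    - by apply/measurable_EFinP; exact: measurable_funS mg.
    - by move=> x /u0 /ltW; rewrite lee_fin.
    - exact/measurable_EFinP.
    rewrite nuint//; apply: eq_integral => x _.
    by rewrite -EFinD /u addrC subrK.
  rewrite eSnu => iu0.
  have iu : (\int[leb]_(x in S) `|(u x)%:E| = 0)%E.
    under eq_integral => x /[!inE] Sx do rewrite gee0_abs ?lee_fin ?(ltW (u0 _ Sx))//.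
    set I := integral _ _ _ in iu0 *.
    have -> : I = (I + nu S - nu S)%E by rewrite addeK// fnu.
    by rewrite [X in (X - _)%E]addeC -iu0 subee// fnu.
  have muE : measurable_fun S (EFin \o u) by exact/measurable_EFinP.
  have /(ae_eq_integral_abs leb mS muE) [N [mN N0 SN]] := iu.
  apply: measure_negligible => //; exists N; split => // x Sx; apply: SN => /=.
  by move=> /(_ Sx)[] /eqP; rewrite gt_eqF// u0.
have leB S : measurable S -> S `<=` B -> (e S <= nu S)%E.
  move=> mS SB; rewrite nuint//; apply: ge0_le_integral => //.
  - by move=> x /SB[Yx _]; rewrite lee_fin g0.
  - apply/measurable_EFinP; apply: measurable_funS mg => // x /SB[]//.
  - by apply/measurable_EFinP; exact: measurable_funTS.
  - by move=> x /SB[_ /=] /ltW; rewrite lee_fin.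
have geB S : measurable S -> S `<=` Y -> (forall x, S x -> ~ B x) -> (nu S <= e S)%E.
  move=> mS SY SB; rewrite nuint//; apply: ge0_le_integral => //.
  - by move=> x _; rewrite lee_fin.
  - by apply/measurable_EFinP; exact: measurable_funTS.
  - by apply/measurable_EFinP; exact: measurable_funS mg.
  - move=> x Sx; rewrite lee_fin leNgt; apply/negP => gf; apply: (SB _ Sx).
    by split => //; exact: SY.
have e_sp S D : measurable S -> S `<=` Y -> measurable D -> e S = (e (S `&` D) + e (S `\` D))%E.
  move=> mS SY mD; rewrite -ge0_integral_setU//.
  - by rewrite setUIDK.
  - exact: measurableI.
  - exact: measurableD.
  - by rewrite setUIDK; apply/measurable_EFinP; exact: measurable_funS mg.
  - by rewrite setUIDK => x /SY Yx; rewrite lee_fin g0.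
  - by apply/disj_set2P/seteqP; split=> // z [[_ +] [_]].
pose GB := Y `&` G @^-1` B.
have mGB : measurable GB by exact: (fb_mG FB).
have GBY : GB `<=` Y by move=> x [].
have mP := measurableD mB mGB; have mQ := measurableD mGB mB.
have nuGB : nu GB = nu B by exact: nu_inv.
have eGB : e GB = e B by rewrite !eE// (inv_density_invariant FB).
have PQnu : nu (B `\` GB) = nu (GB `\` B).
  have := sp_nu B GB mB mGB; rewrite -nuGB (sp_nu GB B)// setIC => /esym.
  have fI := fnu _ (measurableI _ _ mGB mB).
  have fP := fnu _ mP; have fQ := fnu _ mQ.
  rewrite (setIC B) -(fineK fI) -(fineK fP) -(fineK fQ) -!EFinD => -[] /addrI ->//.
have PQe : e (B `\` GB) = e (GB `\` B).
  have := e_sp B GB mB BY mGB; rewrite -eGB (e_sp GB B)// setIC => /esym.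
  have fI : e (GB `&` B) \is a fin_num by apply: fe; [exact: measurableI|move=> x []/GBY].
  have fP : e (B `\` GB) \is a fin_num by apply: fe => // x []/BY.
  have fQ : e (GB `\` B) \is a fin_num by apply: fe => // x []/GBY.
  rewrite (setIC B) -(fineK fI) -(fineK fP) -(fineK fQ) -!EFinD => -[] /addrI ->//.
have leP0 : leb (B `\` GB) = 0%E.
  have PB : B `\` GB `<=` B by move=> x [].
  apply: ltB => //; apply/eqP; rewrite eq_le leB//= PQnu PQe.
  by apply: geB => // x [] // /GBY.
have mYB : measurable (Y `\` B) by exact: measurableD.
have [] := ergodic mYB (@subDsetl _ Y B).
- rewrite (_ : _ `\` _ = B `\` GB)//; apply/seteqP; split => x /=.
  + move=> [[Yx [_ GBx]] nB]; have Bx : B x by apply: contrapT => nBx; apply: nB.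
    by split => // -[_].
  + move=> [Bx nGB]; have Yx := BY _ Bx; split; last by move=> [_].
    split => //; split; first exact: (fb_GY FB).
    by move=> GBx; apply: nGB.
- move=> YB0.
  have B0 : leb B = 0%E.
    apply: ltB => //; have := eY.
    rewrite (e_sp Y B)// (sp_nu Y B)// (nu_abs _ mYB)//.
    rewrite setIidr// [e (_ `\` _)]null_set_integral ?adde0//.
    by apply/measurable_EFinP; exact: measurable_funS mg.
  have := sp_leb Y B mY mB; rewrite setIidr// YB0 B0 adde0 (fb_mYV FB) => -[] V0'.
  by move: V0; rewrite V0' ltxx.
rewrite setDD setIidr// => B0 A mA AY.
have lee S : measurable S -> S `<=` Y -> (nu S <= e S)%E.
  move=> mS SY; rewrite (sp_nu S B)// (e_sp S B)//.
  have SB0 : leb (S `&` B) = 0%E.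
    by apply/eqP; rewrite -measure_le0 -B0 le_measure ?inE//; exact: measurableI.
  have mSB := measurableI _ _ mS mB.
  rewrite nu_abs//; last by move=> x [_ /BY].
  rewrite [e (_ `&` _)]null_set_integral// ?add0e.
    by apply: geB; [exact: measurableD|move=> x []/SY|move=> x []].
  by apply/measurable_EFinP; apply: measurable_funS mg => // x [/SY].
rewrite tE -eE//; apply/eqP; rewrite eq_le lee//=.
have mYA : measurable (Y `\` A) by exact: measurableD.
have YAY : Y `\` A `<=` Y by move=> x [].
have := eY; rewrite (sp_nu Y A)// (e_sp Y A)// (setIidr AY).
have := lee _ mYA YAY.
have f1 := fnu _ mA; have f2 := fnu _ mYA; have f3 := fe _ mA AY; have f4 := fe _ mYA YAY.
rewrite -(fineK f1) -(fineK f2) -(fineK f3) -(fineK f4) -!EFinD !lee_fin => + []; lra.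
Qed.

End Ergodic.

(** * Monotone and expanding functions *)

Section Monotone.
Context {R : realType}.

Lemma measurable_homo_itv (D : set R) (f : R -> R) : is_interval D ->
  (forall x y, D x -> D y -> x <= y -> f x <= f y) -> measurable_fun D f.
Proof.
move=> iD fD.
apply: (measurability (@RGenCInfty.G R)) => [|/= _ [_] [r] -> <-].
  exact: RGenCInfty.measurableE.
apply: is_interval_measurable => s t/=.
rewrite !in_itv/= !andbT => -[Ds fs] [Dt ft] u /andP[su ut].
have Du : D u by apply: (iD s t) => //; rewrite su ut.
by split => //; rewrite /= in_itv/= andbT (le_trans fs)// fD.
Qed.

Lemma expanding_lt (f : R -> R) (p q : R) :
  (forall x, p < x < q -> derivable f x 1) ->
  (forall x, p < x < q -> 1 < derive1 f x) ->
  forall x y, p < x -> x < y -> y < q -> y - x < f y - f x.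
Proof.
move=> df f1 x y px xy yq.
have inI z : z \in `[x, y] -> p < z < q.
  by rewrite in_itv/= => /andP[xz zy]; rewrite (lt_le_trans px)// (le_lt_trans zy).
have [|//|c cxy ->] := @MVT R f (derive1 f) x y xy.
- move=> z zxy; rewrite derive1E; apply: derivableP; apply: df; apply: inI.
  exact: subset_itv_oo_cc zxy.
- apply: derivable_within_continuous => z zxy; apply: df; exact: inI.
- rewrite -[ltLHS]mul1r ltr_pM2r ?subr_gt0//; apply: f1; apply: inI.
  exact: subset_itv_oo_cc cxy.
Qed.

Variables (p q : R) (T : R -> R).
Hypothesis bijT : set_bij `]p, q[ `]0, 1[ T.
Hypothesis expT : forall x y, p < x -> x < y -> y < q -> y - x < T y - T x.

Definition inv_on (y : R) : R := xget 0 [set x | p < x < q /\ T x = y].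

Lemma bij_on_image x : p < x < q -> 0 < T x < 1.
Proof.
by move=> xI; have [fT _ _] := bijT; have := fT x; rewrite /= !in_itv/=; apply.
Qed.

Lemma inv_onP (y : R) : 0 < y < 1 -> p < inv_on y < q /\ T (inv_on y) = y.
Proof.
move=> yI; have [_ _ sT] := bijT.
suff : exists x, p < x < q /\ T x = y by move=> /(@xgetPex _ 0).
have /sT[x] : [set` `]0, 1[] y by rewrite /= in_itv.
by rewrite /= in_itv/= => xI <-; exists x.
Qed.

Lemma expanding_homo x y : p < x < q -> p < y < q -> (T x < T y) = (x < y).
Proof.
move=> /andP[x1 x2] /andP[y1 y2].
have [xy|yx|->] := ltgtP x y; last by rewrite ltxx.
- by have := expT x1 xy y2; rewrite -subr_gt0 => h; apply/idP; lra.
- by have := expT y1 yx x2 => h; apply/negbTE; rewrite -leNgt; lra.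
Qed.

Lemma inv_onK x : p < x < q -> inv_on (T x) = x.
Proof.
move=> xI; have [aI aT] := inv_onP (bij_on_image xI).
by have := expanding_homo aI xI; have := expanding_homo xI aI; rewrite aT ltxx; case: ltgtP.
Qed.

Lemma inv_on_lt y z : 0 < y < 1 -> 0 < z < 1 -> (inv_on y < inv_on z) = (y < z).
Proof.
move=> yI zI; have [aI aT] := inv_onP yI; have [bI bT] := inv_onP zI.
by have := expanding_homo aI bI; rewrite aT bT.
Qed.

End Monotone.

Lemma powR_base_le1 {R : realType} (x r : R) : 0 < x <= 1 -> 0 <= r -> x `^ r <= 1.
Proof.
move=> /andP[x_gt0 x1] r0; have := @ge0_ler_powR R r r0 x 1.
by rewrite powR1 !nnegrE (ltW x_gt0) ler01 => ->.
Qed.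

(** * Branches and return times of a Pomeau-Manneville map *)

Section PM.
Context {R : realType}.
Variables (alpha x0 : R) (T : R -> R).
Hypothesis pmT : pomeau_manneville alpha x0 T.

Let x0_gt0 : 0 < x0. Proof. by have /andP[] := pm_x0 pmT. Qed.
Let x0_lt1 : x0 < 1. Proof. by have /andP[] := pm_x0 pmT. Qed.

Lemma T_expandL x y : 0 < x -> x < y -> y < x0 -> y - x < T y - T x.
Proof.
move=> x_gt0 xy yx0; apply: (@expanding_lt _ _ (x / 2) x0) => //.
- move=> z /andP[xz zx0]; have [] // := @pm_C2L _ _ _ _ pmT (x / 2) _ z.
    by rewrite divr_gt0.
  by rewrite /= in_itv/= xz.
- move=> z /andP[xz zx0]; apply: (pm_expandL pmT); rewrite zx0 andbT.
  by rewrite (lt_trans _ xz)// divr_gt0.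
- by rewrite ltr_pdivrMr// ltr_pMr// ltr1n.
Qed.

Lemma T_expandR x y : x0 < x -> x < y -> y < 1 -> y - x < T y - T x.
Proof.
move=> x_gt0 xy yx0; apply: (@expanding_lt _ _ x0 1) => //.
- by move=> z zx; have [] // := @pm_C2R _ _ _ _ pmT z; rewrite /= in_itv.
- by move=> z zx; apply: (pm_expandR pmT).
Qed.

Definition left_inv : R -> R := inv_on 0 x0 T.
Definition right_inv : R -> R := inv_on x0 1 T.

Let bijL := pm_bijL pmT.
Let bijR := pm_bijR pmT.

Let T_left x : 0 < x < x0 -> 0 < T x < 1. Proof. exact: bij_on_image. Qed.
Let T_right x : x0 < x < 1 -> 0 < T x < 1. Proof. exact: bij_on_image. Qed.

Lemma left_invP y : 0 < y < 1 -> 0 < left_inv y < x0 /\ T (left_inv y) = y.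
Proof. exact: (inv_onP bijL). Qed.

Lemma right_invP y : 0 < y < 1 -> x0 < right_inv y < 1 /\ T (right_inv y) = y.
Proof. exact: (inv_onP bijR). Qed.

Lemma T_homoL x y : 0 < x < x0 -> 0 < y < x0 -> (T x < T y) = (x < y).
Proof. exact: expanding_homo T_expandL _ _. Qed.

Lemma T_homoR x y : x0 < x < 1 -> x0 < y < 1 -> (T x < T y) = (x < y).
Proof. exact: expanding_homo T_expandR _ _. Qed.

Lemma left_invK x : 0 < x < x0 -> left_inv (T x) = x.
Proof. exact: (inv_onK bijL T_expandL). Qed.

Lemma right_invK x : x0 < x < 1 -> right_inv (T x) = x.
Proof. exact: (inv_onK bijR T_expandR). Qed.

Lemma left_inv_lt y z : 0 < y < 1 -> 0 < z < 1 -> (left_inv y < left_inv z) = (y < z).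
Proof. exact: (inv_on_lt bijL T_expandL). Qed.

Lemma right_inv_lt y z : 0 < y < 1 -> 0 < z < 1 -> (right_inv y < right_inv z) = (y < z).
Proof. exact: (inv_on_lt bijR T_expandR). Qed.

Lemma iter_left_inv k y : 0 < y < 1 ->
  0 < iter k left_inv y < 1 /\ ((0 < k)%N -> iter k left_inv y < x0).
Proof.
move=> yI; elim: k => // k [kI _]; rewrite iterS.
have [/andP[-> h] _] := left_invP kI.
by rewrite h (lt_trans h x0_lt1).
Qed.

Lemma iter_left_inv_lt k y z : 0 < y < 1 -> 0 < z < 1 ->
  (iter k left_inv y < iter k left_inv z) = (y < z).
Proof.
move=> yI zI; elim: k => // k IH; rewrite !iterS left_inv_lt//.
- by have [] := iter_left_inv k yI.
- by have [] := iter_left_inv k zI.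
Qed.

Lemma iter_left_invK j k y : 0 < y < 1 -> (j <= k)%N ->
  iter j T (iter k left_inv y) = iter (k - j) left_inv y.
Proof.
move=> yI; elim: j => [|j IH] jk; first by rewrite subn0.
rewrite iterS IH ?(ltnW jk)//.
have -> : (k - j = (k - j.+1).+1)%N by rewrite subnSK.
rewrite iterS; apply: (left_invP _).2.
by have [] := iter_left_inv (k - j.+1) yI.
Qed.

Definition branch i y := right_inv (iter i left_inv y).

Lemma base01 y : x0 < y < 1 -> 0 < y < 1.
Proof. by move=> /andP[h ->]; rewrite (lt_trans x0_gt0). Qed.

Lemma branch_base i y : 0 < y < 1 -> x0 < branch i y < 1.
Proof. by move=> yI; have [/right_invP[]] := iter_left_inv i yI. Qed.

Lemma T_branch i y : 0 < y < 1 -> T (branch i y) = iter i left_inv y.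
Proof. by move=> yI; have [/right_invP[]] := iter_left_inv i yI. Qed.

Lemma iter_branch j i y : 0 < y < 1 -> (j <= i)%N ->
  iter j.+1 T (branch i y) = iter (i - j) left_inv y.
Proof. by move=> yI ji; rewrite iterSr T_branch// iter_left_invK. Qed.

Lemma branch_lt i y z : 0 < y < 1 -> 0 < z < 1 -> (branch i y < branch i z) = (y < z).
Proof.
move=> yI zI; rewrite right_inv_lt ?iter_left_inv_lt//.
- by have [] := iter_left_inv i yI.
- by have [] := iter_left_inv i zI.
Qed.

Lemma return_timeP x k : (0 < k)%N -> x0 < iter k T x < 1 ->
  (forall j, (0 < j < k)%N -> ~ (x0 < iter j T x < 1)) -> return_time x0 T x = k.
Proof.
move=> k0 xk xj; apply: xget_unique => //= l [l0 xl xlj].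
have [kl|lk|//] := ltngtP k l.
- by exfalso; apply: (xlj k) => //; rewrite k0.
- by exfalso; apply: (xj l) => //; rewrite l0.
Qed.

Lemma return_time_branch i y : x0 < y < 1 -> return_time x0 T (branch i y) = i.+1.
Proof.
move=> yI; have y01 := base01 yI.
apply: return_timeP => //; first by rewrite iter_branch// subnn.
case=> // j; rewrite ltnS => /= ji; rewrite -iterS iter_branch//; last exact: ltnW.
have [_] := iter_left_inv (i - j) y01.
by rewrite subn_gt0 => /(_ ji) h /andP[h' _]; have := lt_trans h h'; rewrite ltxx.
Qed.

Lemma return_map_branch i y : x0 < y < 1 -> return_map x0 T (branch i y) = y.
Proof.
by move=> yI; rewrite /return_map return_time_branch// iter_branch ?subnn ?base01.
Qed.

(** The function [g] is known through [g' x = o(x ^ alpha)] only. On an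
    interval [u, x] the mean value theorem controls [g x - g u], and [T u > 0]
    for [u] tending to 0 replaces the value of [g] at 0. Away from 0, [T x -
    x] is increasing and thus stays above its value at a fixed point [s]. *)
Lemma T_escape : exists2 kap, 0 < kap &
  forall x, 0 < x < x0 -> x + kap * x `^ (1 + alpha) <= T x.
Proof.
have /andP[al0 al1] := pm_alpha pmT.
have [ca [delta [g [ca0 d0 gC2 gsmall Tg]]]] := pm_near0 pmT.
have ca2 : 0 < ca / 2 by rewrite divr_gt0.
have [e /= e0 ge] : exists2 e, 0 < e & forall x, 0 < x < e ->
    `|derive1 g x| <= ca / 2 * x `^ alpha.
  move/cvgr0Pnorm_le : gsmall => /(_ _ ca2).
  move=> [e /= e0 he]; exists e => // x /andP[x_gt0 xe].
  have := he x; rewrite /ball/= sub0r normrN gtr0_norm// => /(_ xe x_gt0).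
  by rewrite normrM normfV (gtr0_norm (powR_gt0 _ x_gt0)) ler_pdivrMr// powR_gt0.
pose r := Order.min (Order.min e delta) x0.
have r0 : 0 < r by rewrite !lt_min e0 d0 x0_gt0.
have near x : 0 < x < r -> x + ca / 2 * x `^ (1 + alpha) <= T x.
  move=> /andP[x_gt0]; rewrite !lt_min => /andP[/andP[xe xd] xx0].
  apply/ler_addgt0Pl => t t0.
  (* [u] is so small that the terms [u] and [ca * u `^ (1 + alpha)] stay below [t] *)
  pose u := Order.min (x / 2) (Order.min 1 (t / (ca + 1))).
  have c10 : 0 < ca + 1 by rewrite addr_gt0.
  have u0 : 0 < u by rewrite !lt_min ltr01 !divr_gt0.
  have ux : u < x by rewrite !gt_min ltr_pdivrMr// ltr_pMr// ltr1n.
  have u1 : u <= 1 by rewrite !ge_min lexx orbT.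
  have ut : (ca + 1) * u <= t.
    by rewrite mulrC -ler_pdivlMr// !ge_min lexx !orbT.
  have dg z : u <= z <= x -> derivable g z 1.
    move=> /andP[uz zx]; have [] // := gC2 z.
    by rewrite /= in_itv/= (lt_le_trans u0)// (le_lt_trans zx).
  have [z zux gz] : exists2 z, z \in `]u, x[ & g x - g u = derive1 g z * (x - u).
    apply: MVT => //.
    - move=> z; rewrite in_itv/= => /andP[uz zx]; rewrite derive1E.
      by apply: derivableP; apply: dg; rewrite !ltW.
    - by apply: derivable_within_continuous => z; rewrite in_itv/=; exact: dg.
  move: zux; rewrite in_itv/= => /andP[uz zx].
  have z0 := lt_trans u0 uz.
  have gxu : - (ca / 2 * x `^ (1 + alpha)) <= g x - g u.
    rewrite lerNl; apply: (le_trans (ler_norm _)); rewrite normrN gz normrM.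
    rewrite (gtr0_norm (_ : 0 < x - u)) ?subr_gt0//.
    rewrite powRD; last by rewrite (gt_eqF x_gt0) implybT.
    rewrite powRr1 ?(ltW x_gt0)// mulrCA [leRHS]mulrC ler_pM//.
    - by rewrite subr_ge0 ltW.
    - apply: (le_trans (ge z _)); first by rewrite z0 (lt_trans zx).
      rewrite ler_wpM2l ?(ltW ca2)// ge0_ler_powR ?nnegrE ?(ltW al0) ?(ltW z0) ?(ltW x_gt0)//.
      exact: ltW.
    - by rewrite lerBlDr lerDl ltW.
  have Tx := Tg x; have Tu := Tg u.
  have uI : 0 < u < x0 by rewrite u0 (lt_trans ux).
  have /andP[Tu0 _] := T_left uI.
  have upow : u `^ (1 + alpha) <= u.
    rewrite powRD; last by rewrite (gt_eqF u0) implybT.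
    by rewrite powRr1 ?(ltW u0)// ler_piMr ?(ltW u0) ?powR_base_le1 ?u0 ?(ltW al0).
  rewrite Tx ?x_gt0 ?xd//; rewrite Tu ?u0 ?(lt_trans ux)// in Tu0.
  nra.
pose s := r / 2.
have sr : s < r by rewrite ltr_pdivrMr// ltr_pMr// ltr1n.
have s0 : 0 < s by rewrite divr_gt0.
have pow1 z : 0 < z <= 1 -> z `^ (1 + alpha) <= 1.
  by move=> zI; rewrite powR_base_le1 ?addr_ge0 ?(ltW al0).
have Ts : s + ca / 2 * s `^ (1 + alpha) <= T s by apply: near; rewrite s0.
pose eta := ca / 2 * s `^ (1 + alpha).
have eta0 : 0 < eta by rewrite mulr_gt0// powR_gt0.
exists (Order.min (ca / 2) eta); first by rewrite lt_min ca2.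
move=> x /andP[x_gt0 xx0].
have xp0 : 0 <= x `^ (1 + alpha) by rewrite powR_ge0.
have [xr|rx] := ltP x r.
  apply: le_trans (near x _); last by rewrite x_gt0.
  by rewrite lerD2l ler_wpM2r// ge_min lexx.
have := T_expandL s0 (lt_le_trans sr rx) xx0.
have : Order.min (ca / 2) eta * x `^ (1 + alpha) <= eta.
  apply: (@le_trans _ _ (eta * x `^ (1 + alpha))).
    by rewrite ler_wpM2r// ge_min lexx orbT.
  by rewrite ler_piMr ?(ltW eta0)// pow1// x_gt0 (ltW (lt_trans xx0 _)).
by rewrite -/eta in Ts *; lra.
Qed.

Definition left_preimage k := iter k left_inv x0.

Lemma left_preimage_bounds k : 0 < left_preimage k <= x0.
Proof.
have x001 : 0 < x0 < 1 by rewrite x0_gt0.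
case: k => [|k]; first by rewrite /left_preimage/= lexx x0_gt0.
have [/andP[-> _] /(_ isT)] := iter_left_inv k.+1 x001.
exact: ltW.
Qed.

(** By [T_escape], [x `^ (1 - alpha)] decreases from one preimage to the next
    by at least a multiple of the latter; the sum telescopes. *)
Lemma left_preimage_sum : exists M : R, forall n, \sum_(k < n) left_preimage k <= M.
Proof.
have /andP[al0 al1] := pm_alpha pmT.
have [kap kap0 Tk] := T_escape.
pose kp := Order.min kap 1.
have kp0 : 0 < kp by rewrite lt_min kap0 ltr01.
pose b := 1 - alpha.
have b0 : 0 < b by rewrite subr_gt0.
have step k : kp * b / 2 * left_preimage k.+1 <= left_preimage k `^ b - left_preimage k.+1 `^ b.
  have x001 : 0 < x0 < 1 by rewrite x0_gt0.
  have [xk01 _] := iter_left_inv k x001; rewrite -/(left_preimage k) in xk01.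
  have [yI Ty] := left_invP xk01; rewrite -/(left_preimage k.+1) in yI Ty.
  set y := left_preimage k.+1 in yI Ty *.
  have := Tk _ yI; rewrite Ty; set x := left_preimage k => xy.
  have /andP[y0 yx0] := yI.
  have y1 : y <= 1 by rewrite ltW// (lt_trans yx0).
  pose t := kp * y `^ alpha.
  have ya0 : 0 < y `^ alpha by rewrite powR_gt0.
  have t0 : 0 < t by rewrite mulr_gt0.
  have t1 : t <= 1.
    rewrite -[leRHS]mulr1 ler_pM ?(ltW kp0) ?(ltW ya0)//.
      by rewrite ge_min lexx orbT.
    by rewrite powR_base_le1 ?y0 ?(ltW al0).
  have xyt : y * (1 + t) <= x.
    apply: le_trans xy; rewrite mulrDr mulr1 lerD2l /t mulrCA.
    rewrite powRD; last by rewrite (gt_eqF y0) implybT.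
    rewrite powRr1 ?(ltW y0)// ler_wpM2r ?mulr_ge0 ?(ltW y0) ?(ltW ya0)//.
    by rewrite ge_min lexx.
  have t1' : 0 < 1 + t by rewrite addr_gt0.
  have yt0 : 0 < y * (1 + t) by rewrite mulr_gt0.
  have h1 : (y * (1 + t)) `^ b <= x `^ b.
    by rewrite ge0_ler_powR ?nnegrE ?(ltW b0) ?(ltW yt0) ?(le_trans (ltW yt0)).
  rewrite powRM ?(ltW y0) ?(ltW t1')// in h1.
  (* from [ln (1 + t) >= t / (1 + t) >= t / 2] *)
  have h2 : 1 + b * t / 2 <= (1 + t) `^ b.
    rewrite /powR (gt_eqF t1'); apply: le_trans (expR_ge1Dx _).
    rewrite lerD2l -mulrA ler_wpM2l ?(ltW b0)//.
    have : ln ((1 + t)^-1) <= (1 + t)^-1 - 1.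
      rewrite -[X in ln X](addKr 1) [X in ln X]addrCA [- 1 + _]addrC.
      by rewrite le_ln1Dx// ltrBrDr addNr invr_gt0.
    rewrite lnV ?posrE// lerNl; apply: le_trans.
    rewrite opprB -[X in _ <= X - _](divff (lt0r_neq0 t1')) -[X in _ <= _ - X]mul1r -mulrBl.
    rewrite addrC addKr ler_wpM2l ?(ltW t0)// lef_pV2 ?posrE//.
    by lra.
  have yb0 : 0 < y `^ b by rewrite powR_gt0.
  have h3 : y `^ b * (1 + b * t / 2) <= x `^ b.
    by apply: le_trans h1; rewrite ler_wpM2l ?(ltW yb0).
  have yy : y `^ b * y `^ alpha = y.
    rewrite -powRD; last by rewrite (gt_eqF y0) implybT.
    by rewrite subrK powRr1 ?(ltW y0).
  rewrite lerBrDl; apply: le_trans h3.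
  suff -> : y `^ b * (1 + b * t / 2) = y `^ b + kp * b / 2 * y by [].
  have -> : kp * b / 2 * y = kp * b / 2 * (y `^ b * y `^ alpha) by rewrite yy.
  by rewrite /t; field.
pose D := kp * b / 2.
have D0 : 0 < D by rewrite divr_gt0// mulr_gt0.
exists (x0 + D^-1 * x0 `^ b) => n.
apply: (@le_trans _ _ (x0 + \sum_(k < n) left_preimage k.+1)).
  case: n => [|n]; first by rewrite !big_ord0 addr0 ltW.
  rewrite big_ord_recl /= [leRHS]addrC big_ord_recr/= addrAC [leLHS]addrC lerDl.
  by have /andP[/ltW] := left_preimage_bounds n.+1.
rewrite lerD2l ler_pdivlMl// mulr_sumr.
apply: (@le_trans _ _ (\sum_(k < n) (left_preimage k `^ b - left_preimage k.+1 `^ b))).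
  by apply: ler_sum => k _; exact: step.
rewrite -(big_mkord xpredT (fun k => left_preimage k `^ b - left_preimage k.+1 `^ b)) .
rewrite -[leLHS]opprK -sumrN.
under eq_bigr do rewrite opprB.
by rewrite telescope_sumr// opprB lerBlDr lerDl powR_ge0.
Qed.

Lemma left_preimage_small (e : R) : 0 < e -> exists k, left_preimage k < e.
Proof.
move=> e0; have [M Mn] := left_preimage_sum; apply: contrapT => h.
have ge k : e <= left_preimage k by rewrite leNgt; apply/negP => ?; apply: h; exists k.
have := Mn (Num.trunc (M / e)).+1.
apply/negP; rewrite -ltNge.
apply: (@lt_le_trans _ _ (\sum_(k < (Num.trunc (M / e)).+1) e)).
  rewrite sumr_const card_ord -mulr_natr mulrC -ltr_pdivrMr//.
  exact: truncnS_gt.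
by apply: ler_sum.
Qed.

(** The orbit of [T u] is followed until it leaves [(0, x0)], and traced back
    with the left inverse. It does leave, since otherwise [T u] would be below
    all the preimages of [x0], which tend to 0. *)
Lemma branchP u : x0 < u < 1 -> (forall j, u <> branch j x0) ->
  exists i, exists2 y, x0 < y < 1 & u = branch i y.
Proof.
move=> uI nu; pose v := T u.
have vI : 0 < v < 1 by exact: T_right.
have uE : u = right_inv v by rewrite right_invK.
have back j : (forall l, (l < j)%N -> iter l T v < x0) ->
    0 < iter j T v < 1 /\ v = iter j left_inv (iter j T v).
  elim: j => [|j IH] lj //.
  have [/andP[jI _] vE] := IH (fun l lj' => lj l (ltnW lj')).
  have jL : 0 < iter j T v < x0 by rewrite jI lj.
  split; first by rewrite iterS; exact: T_left.
  by rewrite iterSr iterS left_invK.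
have [[k xk]|h] := pselect (exists k, x0 <= iter k T v); last first.
  have small j : v < left_preimage j.
    have lx0 l : iter l T v < x0 by rewrite ltNge; apply/negP => ?; apply: h; exists l.
    have [jI ->] := back j (fun l _ => lx0 l).
    by rewrite /left_preimage iter_left_inv_lt// x0_gt0.
  have [k] := left_preimage_small (andP vI).1.
  by move=> /(lt_trans (small k)); rewrite ltxx.
have [k' xk' kmin] := ex_minnP (ex_intro (fun k => x0 <= iter k T v) k xk).
have [|kI vE] := back k'.
  by move=> l lk; rewrite ltNge; apply/negP => /kmin; rewrite leqNgt lk.
exists k', (iter k' T v); last by rewrite uE {1}vE.
have /andP[_ ->] := kI; rewrite andbT lt_neqAle xk' andbT.
apply/eqP => xE; apply: (nu k'); by rewrite uE {1}vE -xE.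
Qed.

Definition window i : set R := branch i @` [set y | x0 < y < 1].

Lemma window_base i u : window i u -> x0 < u < 1.
Proof. by move=> [y /base01 yI <-]; exact: branch_base. Qed.

(** Both halves of [T] are monotone and onto, so a point between two points of
    the window has its successive images between theirs. *)
Lemma window_convex i u v z : window i u -> window i v -> u <= z <= v -> window i z.
Proof.
move=> [y yI <-] [y' y'I <-] /andP[uz zv].
have y01 := base01 yI; have y'01 := base01 y'I.
have zI : x0 < z < 1.
  have /andP[h _] := branch_base i y01; have /andP[_ h'] := branch_base i y'01.
  by rewrite (lt_le_trans h)// (le_lt_trans zv).
have Tle a b : x0 < a < 1 -> x0 < b < 1 -> a <= b -> T a <= T b.
  by move=> aI bI ab; rewrite leNgt T_homoR// -leNgt.
have Tz : iter i left_inv y <= T z <= iter i left_inv y'.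
  by rewrite -!T_branch// !Tle// branch_base.
suff [x xI zx] : exists2 x, x0 < x < 1 & T z = iter i left_inv x.
  by exists x => //; rewrite /branch -zx right_invK.
move: (T z) Tz; elim: i {uz zv} => [|i IH] r /= /andP[yr ry'].
  exists r => //; have /andP[h _] := yI; have /andP[_ h'] := y'I.
  by rewrite (lt_le_trans h)// (le_lt_trans ry').
have [iy01 _] := iter_left_inv i y01; have [iy'01 _] := iter_left_inv i y'01.
have [lI lT] := left_invP iy01; have [l'I l'T] := left_invP iy'01.
have rI : 0 < r < x0.
  have /andP[h _] := lI; have /andP[_ h'] := l'I.
  by rewrite (lt_le_trans h)// (le_lt_trans ry').
have TleL a b : 0 < a < x0 -> 0 < b < x0 -> a <= b -> T a <= T b.
  by move=> aI bI ab; rewrite leNgt T_homoL// -leNgt.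
have [|x xI rx] := IH (T r).
  by rewrite -{1}lT -l'T !TleL.
by exists x => //; rewrite -rx left_invK.
Qed.

Lemma measurable_window i : measurable (window i : set R).
Proof.
apply: is_interval_measurable => u v wu wv z; exact: window_convex.
Qed.

Lemma windowK i u : window i u ->
  [/\ return_time x0 T u = i.+1, x0 < return_map x0 T u < 1 &
      branch i (return_map x0 T u) = u].
Proof.
by move=> [y yI <-]; rewrite return_time_branch// return_map_branch.
Qed.

Lemma return_map_homo i u v : window i u -> window i v -> u <= v ->
  return_map x0 T u <= return_map x0 T v.
Proof.
move=> wu wv uv; have [_ uI uE] := windowK wu; have [_ vI vE] := windowK wv.
by rewrite leNgt -(branch_lt i) ?base01// uE vE -leNgt.
Qed.

Lemma measurable_return_map i : measurable_fun (window i) (return_map x0 T).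
Proof.
apply: measurable_homo_itv.
  by move=> u v wu wv z; exact: window_convex.
by move=> u v; exact: return_map_homo.
Qed.

Lemma measurable_branch i : measurable_fun [set y | x0 < y < 1] (branch i).
Proof.
apply: measurable_homo_itv.
  move=> u v /= /andP[x0u u1] /andP[x0v v1] z /andP[uz zv].
  by rewrite (lt_le_trans x0u)// (le_lt_trans zv).
move=> u v uI vI uv.
by rewrite leNgt branch_lt ?base01// -leNgt.
Qed.

Lemma countable_base_exc :
  countable ([set x | x0 <= x <= 1] `\` \bigcup_i window i).
Proof.
(* the exceptions are 1, [x0] and the points whose orbit hits [x0] *)
pose e j := if j is j'.+1 then if j' is k.+1 then branch k x0 else x0 else 1.
apply: (@sub_countable _ _ _ (range e)); last first.
  by apply: (card_le_trans (card_image_le _ _)); exact: countableP.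
apply: subset_card_le => u [/=] /andP[x0u u1] nw.
have [->|ux0] := eqVneq u x0; first by exists 1%N.
have [->|u1'] := eqVneq u 1; first by exists 0%N.
apply: contrapT => nu; apply: nw.
have [||i [y yI uE]] := @branchP u.
- by rewrite !lt_neqAle eq_sym ux0 x0u u1' u1.
- by move=> j uj; apply: nu; exists j.+2.
- by exists i => //; exists y.
Qed.

(** [T u] is below the n-th left preimage of [x0], and [T] expands the
    distance from [u] to [x0]. As [T] may jump at [x0], this point is
    approached by points [z > x0], at which [T z > 0]. *)
Lemma late_return n i u : window i u -> (n < i)%N -> x0 < u < x0 + left_preimage n.
Proof.
move=> wu ni; have uI := window_base wu.
have [y yI uE] := wu; have y01 := base01 yI.
have x001 : 0 < x0 < 1 by rewrite x0_gt0.
have Tu : T u < left_preimage n.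
  rewrite -uE T_branch// -(subnKC ni) addSnnS iterD iter_left_inv_lt//.
    by have [_] := iter_left_inv (i - n.+1).+1 y01; apply.
  by have [] := iter_left_inv (i - n.+1).+1 y01.
have /andP[x0u u1] := uI; rewrite x0u/=.
apply: (@le_lt_trans _ _ (x0 + T u)); last by rewrite ltrD2l.
apply/ler_addgt0Pl => t t0.
pose z := x0 + Order.min ((u - x0) / 2) t.
have ux0 : 0 < (u - x0) / 2 by rewrite divr_gt0// subr_gt0.
have x0z : x0 < z by rewrite ltrDl lt_min ux0.
have zu : z < u.
  rewrite /z -ltrBrDl gt_min; apply/orP; left.
  by rewrite ltr_pdivrMr// ltr_pMr ?ltr1n// subr_gt0.
have zt : z <= x0 + t by rewrite lerD2l ge_min lexx orbT.
have zI : x0 < z < 1 by rewrite x0z (lt_trans zu).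
have := T_expandR x0z zu u1.
by have /andP[+ _] := T_right zI; lra.
Qed.

End PM.

(** * Change of variables and the tower measure *)

Section ChangeOfVariables.
Local Open Scope ereal_scope.
Context {R : realType} {d : measure_display} {X : measurableType d}.
Variable m : {measure set X -> \bar R}.
Import HBNNSimple.

(** The hypothesis is the case of indicator functions; simple functions and
    monotone limits follow. *)
Lemma ge0_change_of_variables (D E : set X) (b : X -> X) (J f : X -> \bar R) :
  measurable D -> measurable E -> measurable_fun D b ->
  (forall x, D x -> E (b x)) ->
  measurable_fun E J -> (forall x, E x -> 0 <= J x) ->
  (forall x, E x -> J x \is a fin_num) ->
  (forall A, measurable A -> A `<=` E -> m (D `&` b @^-1` A) = \int[m]_(x in A) J x) ->
  measurable_fun E f -> (forall x, E x -> 0 <= f x) ->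
  \int[m]_(x in D) f (b x) = \int[m]_(x in E) (f x * J x).
Proof.
move=> mD mE mb bE mJ J0 Jfin mJint mf f0.
pose h := nnsfun_approx mE mf.
have hcvg x : E x -> EFin \o h ^~ x @ \oo --> f x by exact: cvg_nnsfun_approx.
have mhb n : measurable_fun D (fun x => (h n (b x))%:E).
  apply/measurable_EFinP; apply: (measurable_comp measurableT) => //.
have -> : \int[m]_(x in D) f (b x) = lim (\int[m]_(x in D) (h n (b x))%:E @[n --> \oo]).
  rewrite -monotone_convergence//.
  - apply: eq_integral => x /[!inE] Dx; apply/esym/cvg_lim => //.
    exact/hcvg/bE.
  - by move=> n x Dx; rewrite lee_fin.
  - by move=> x Dx n k nk; rewrite lee_fin; exact/lefP/nd_nnsfun_approx.
have -> : \int[m]_(x in E) (f x * J x) =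
    lim (\int[m]_(x in E) ((h n x)%:E * J x) @[n --> \oo]).
  rewrite -monotone_convergence//.
  - apply: eq_integral => x /[!inE] Ex; apply/esym/cvg_lim => //.
    apply: cvgeZr; first exact: Jfin.
    exact: hcvg.
  - move=> n; apply: emeasurable_funM => //; apply/measurable_EFinP.
    exact: measurable_funTS.
  - by move=> n x Ex; rewrite mule_ge0 ?lee_fin ?J0.
  - by move=> x Ex n k nk; rewrite lee_wpmul2r ?J0// lee_fin; exact/lefP/nd_nnsfun_approx.
congr (lim (_ @ \oo)); apply/funext => n /=.
have mhy (y : R) : measurable (h n @^-1` [set y]) by [].
have bB y : D `&` b @^-1` (h n @^-1` [set y]) = D `&` b @^-1` (E `&` h n @^-1` [set y]).
  by apply/seteqP; split => x [Dx /=]; [split => //; split => //; exact: bE|move=> []].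
transitivity (\sum_(y \in range (h n)) (y%:E * m (D `&` b @^-1` (h n @^-1` [set y])))).
  transitivity (\int[m]_(x in D) (\sum_(y \in range (h n))
      (y * \1_(h n @^-1` [set y]) (b x))%:E)).
    by apply: eq_integral => x _; rewrite fimfunE -fsumEFin.
  rewrite ge0_integral_fsum//; last 2 first.
  - move=> y; apply/measurable_EFinP/measurable_funM => //.
    exact: (measurable_comp measurableT).
  - by move=> y x Dx; exact: nnfun_muleindic_ge0.
  apply: eq_fsbigr => y /[!inE] -[z _ yE].
  under eq_integral do rewrite EFinM.
  rewrite ge0_integralZl//; last 2 first.
  - by apply/measurable_EFinP; exact: (measurable_comp measurableT).
  - by rewrite lee_fin -yE.
  congr (_ * _).
  have mB : measurable (D `&` b @^-1` (h n @^-1` [set y])) by exact: mb.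
  rewrite -[in RHS](setIid D) -setIA setIC -integral_indic//.
  apply: eq_integral => x /[!inE] Dx; rewrite !indicE.
  have -> // : (b x \in h n @^-1` [set y]) =
      (x \in D `&` b @^-1` (h n @^-1` [set y])).
  by apply/idP/idP; rewrite !inE; [|move=> []].
transitivity (\int[m]_(x in E) (\sum_(y \in range (h n))
      ((y * \1_(h n @^-1` [set y]) x)%:E * J x))); last first.
  apply: eq_integral => x _; rewrite -ge0_mule_fsuml => [|y]; last exact: nnfun_muleindic_ge0.
  by rewrite fimfunE -fsumEFin.
rewrite ge0_integral_fsum//; last 2 first.
- move=> y; apply: emeasurable_funM => //; apply/measurable_EFinP.
  exact: measurable_funM.
- by move=> y x Ex; rewrite mule_ge0 ?J0// nnfun_muleindic_ge0.
apply: eq_fsbigr => y /[!inE] -[z _ yE].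
under eq_integral do rewrite EFinM -muleA.
have mEy : measurable (E `&` h n @^-1` [set y]) by exact: measurableI.
rewrite ge0_integralZl//; last 3 first.
- by apply: emeasurable_funM => //; apply/measurable_EFinP.
- by move=> x Ex; rewrite mule_ge0 ?J0// lee_fin.
- by rewrite lee_fin -yE.
congr (_ * _); rewrite bB mJint//.
rewrite integral_mkcondr; apply: eq_integral => x _.
by rewrite patchE indicE; case: ifPn; rewrite ?mul1e ?mul0e.
Qed.

End ChangeOfVariables.

Section Slices.
Context {R : realType}.
Local Notation leb := (@lebesgue_measure R).
Local Notation nu := (@tower_measure R).
Local Notation XN := (measurableTypeR R * nat)%type.

Definition lift (l : nat) (A : set (measurableTypeR R)) : set XN := A `*` [set l].
Definition slice (l : nat) (S : set XN) : set (measurableTypeR R) := [set x | S (x, l)].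

Lemma measurable_lift l A : measurable A -> measurable (lift l A).
Proof. by move=> mA; exact: measurableX. Qed.

Lemma measurable_slice l S : measurable S -> measurable (slice l S).
Proof.
move=> mS; have := @pair2_measurable _ _ (measurableTypeR R) nat l measurableT S mS.
by rewrite setTI.
Qed.

Lemma slice_lift l A : slice l (lift l A) = A.
Proof. by apply/seteqP; split => x //= []. Qed.

Lemma lift_slices S : S = \bigcup_l lift l (slice l S).
Proof.
apply/seteqP; split=> [[x l] Sxl|[x l] [k _ [/= Sxk ->]]//].
by exists l.
Qed.

Lemma trivIset_lift (F : nat -> set (measurableTypeR R)) :
  trivIset setT (fun l => lift l (F l)).
Proof. by move=> i j _ _ [[x l] [[_ /= ->] [_ /= ->]]]. Qed.

Lemma nu_lift l A : measurable A -> nu (lift l A) = leb A.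
Proof.
move=> mA; rewrite /tower_measure.
have := @product_measure1E _ _ (measurableTypeR R) nat R leb (@counting nat R) A [set l] mA I.
move=> h; transitivity (leb A * @counting nat R [set l])%E; first exact: h.
by rewrite /counting asboolT// fset_set1 finmap.cardfs1 mule1.
Qed.

Lemma nu_slices S : measurable S -> (nu S = \sum_(l <oo) leb (slice l S))%E.
Proof.
move=> mS; rewrite {1}(lift_slices S) measure_bigcup//; last 2 first.
- by move=> l _; apply: measurable_lift; exact: measurable_slice.
- exact: trivIset_lift.
transitivity (\sum_(l <oo) nu (lift l (slice l S)))%E.
  by apply: eq_eseriesl => l; rewrite in_setT.
by apply: eq_eseriesr => l _; rewrite nu_lift//; exact: measurable_slice.
Qed.

Lemma measurable_fun_lift d (Z : measurableType d) l A (f : XN -> Z) : measurable A ->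
  measurable_fun (lift l A) f -> measurable_fun A (fun x => f (x, l)).
Proof.
move=> mA mf; apply: (measurable_comp (measurable_lift l mA) _ mf).
  by move=> _ [x Ax <-].
exact/measurable_funTS/pair2_measurable.
Qed.

Lemma int_lift l A (f : XN -> \bar R) : measurable A ->
  measurable_fun (lift l A) f -> (forall z, lift l A z -> (0 <= f z)%E) ->
  (\int[nu]_(z in lift l A) f z = \int[leb]_(x in A) f (x, l))%E.
Proof.
move=> mA mf f0; have mp := @pair2_measurable _ _ (measurableTypeR R) nat l.
rewrite (@eq_measure_integral _ _ _ _ (pushforward leb (pair^~ l : measurableTypeR R -> XN)) nu).
  rewrite ge0_integral_pushforward//.
  - congr (integral _ _ _); exact: slice_lift.
  - exact: measurable_lift.
  - by move=> z /[!inE]; exact: f0.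
move=> S mS SA; rewrite /pushforward -[RHS]/(leb (slice l S)) -(nu_lift l (measurable_slice l mS)).
congr (nu _); apply/seteqP; split => [[x k] Sxk|[x k] [/= ? ->]//].
by have [_ /= kl] := SA _ Sxk; split => //=; rewrite /slice/= -kl.
Qed.

Lemma int_slices S (f : XN -> \bar R) : measurable S ->
  measurable_fun S f -> (forall z, S z -> (0 <= f z)%E) ->
  (\int[nu]_(z in S) f z = \sum_(l <oo) \int[leb]_(x in slice l S) f (x, l))%E.
Proof.
move=> mS mf f0; have msl l := measurable_slice l mS.
have SE := lift_slices S.
rewrite {1}SE ge0_integral_bigcup//=; last 4 first.
- by move=> l; exact: measurable_lift.
- by rewrite -SE.
- by rewrite -SE.
- exact: trivIset_lift.
apply: eq_eseriesr => l _; apply: int_lift => //.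
- by apply: measurable_funS mf => // z; rewrite {2}SE => zl; exists l.
- by move=> [x k] [Sxl /= ->]; exact: f0.
Qed.

(** The exceptional sets of the countably many levels project to a null set of
    the base. *)
Lemma ae_slices (P : XN -> Prop) : {ae nu, forall z, P z} ->
  exists N, [/\ measurable N, leb N = 0%E & forall x l, ~ N x -> P (x, l)].
Proof.
move=> [N [mN N0 PN]].
have msl l := measurable_slice l mN.
exists (\bigcup_l slice l N); split.
- exact: bigcup_measurable.
- apply/eqP; rewrite -measure_le0.
  apply: (le_trans (measure_sigma_subadditive leb _ _ (@subset_refl _ _))) => //.
    exact: bigcup_measurable.
  by rewrite -nu_slices ?N0.
- move=> x l nN; apply: contrapT => nP; apply: nN; exists l => //.
  exact: PN.
Qed.

End Slices.

(** * Regular base points *)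

(** The points which are sent outside of the set by one of the maps are
    removed, and this is repeated; only countably many null sets are removed
    in total. *)
Lemma closed_conull {R : realType} {d} {X : measurableType d} (m : {measure set X -> \bar R})
    (I E N : set X) (g : nat -> X -> X) :
  measurable I -> measurable E -> E `<=` I -> m (I `\` E) = 0%E ->
  measurable N -> m N = 0%E ->
  (forall n, measurable_fun E (g n)) -> (forall n x, E x -> I (g n x)) ->
  (forall n A, measurable A -> A `<=` I -> m A = 0%E -> m (E `&` g n @^-1` A) = 0%E) ->
  exists Y, [/\ measurable Y, Y `<=` E, m (I `\` Y) = 0%E, (forall x, Y x -> ~ N x) &
    forall n x, Y x -> Y (g n x)].
Proof.
move=> mI mE EI IE0 mN N0 mg gI gnull.
pose step S := S `&` \bigcap_n (E `&` g n @^-1` S).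
pose F k := iter k step (E `\` N).
have FS k : F k.+1 = step (F k) by [].
have null_sub A B : measurable A -> measurable B -> A `<=` B -> m B = 0%E -> m A = 0%E.
  move=> mA mB AB B0; apply/eqP; rewrite -measure_le0 -[leRHS]B0.
  by apply: le_measure; rewrite ?inE.
have HF k : [/\ measurable (F k), F k `<=` E & m (I `\` F k) = 0%E].
  elim: k => [|k [mF FE F0]].
    have mEN : measurable (E `\` N) by exact: measurableD.
    split => //=; apply: (@null_sub _ ((I `\` E) `|` N)).
    - exact: measurableD.
    - by apply: measurableU => //; exact: measurableD.
    - move=> x [Ix nEN]; have [Nx|nN] := pselect (N x); [by right|left; split => // Ex].
      by apply: nEN.
    apply/eqP; rewrite -measure_le0; apply: (@le_trans _ _ (m (I `\` E) + m N)%E).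
      by apply: measureU2 => //; exact: measurableD.
    by rewrite IE0 N0 adde0.
  have mgF n : measurable (E `&` g n @^-1` F k) by exact: mg.
  have mIF : measurable (I `\` F k) by exact: measurableD.
  have mgN n : measurable (E `&` g n @^-1` (I `\` F k)) by exact: mg.
  have mS : measurable (F k.+1).
    by rewrite FS; apply: measurableI => //; exact: bigcapT_measurable.
  split => //; first by move=> x [/FE].
  have mU : measurable (\bigcup_n (E `&` g n @^-1` (I `\` F k))) by exact: bigcup_measurable.
  have U0 : m (\bigcup_n (E `&` g n @^-1` (I `\` F k))) = 0%E.
    apply/eqP; rewrite -measure_le0.
    apply: (le_trans (measure_sigma_subadditive m mgN mU (@subset_refl _ _))).
    rewrite eseries0// => n _ _; apply: gnull => //; by move=> x [].
  apply: (@null_sub _ ((I `\` F k) `|` \bigcup_n (E `&` g n @^-1` (I `\` F k)))).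
  - exact: measurableD.
  - exact: measurableU.
  - move=> x [Ix nS]; have [Fx|nF] := pselect (F k x); [right|by left].
    have Ex := FE _ Fx.
    apply: contrapT => nU; apply: nS; split => // n _; split => //=.
    apply: contrapT => nFg; apply: nU; exists n => //; split => //; split => //.
    exact: gI.
  apply/eqP; rewrite -measure_le0.
  apply: (@le_trans _ _ (m (I `\` F k) + m (\bigcup_n (E `&` g n @^-1` (I `\` F k))))%E).
    exact: measureU2.
  by rewrite F0 U0 adde0.
exists (\bigcap_k F k); split.
- by apply: bigcapT_measurable => k; have [] := HF k.
- by move=> x /(_ 0%N Logic.I); have [_ + _] := HF 0%N; apply.
- have IF : I `\` \bigcap_k F k = \bigcup_k (I `\` F k).
    apply/seteqP; split => [x [Ix nF]|x [k _ [Ix nF]]].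
      apply: contrapT => nU; apply: nF => k _; apply: contrapT => nFk.
      by apply: nU; exists k.
    by split => // /(_ k Logic.I).
  have mIF k : measurable (I `\` F k) by apply: measurableD => //; have [] := HF k.
  have mU : measurable (\bigcup_k (I `\` F k)) by exact: bigcup_measurable.
  rewrite IF; apply/eqP; rewrite -measure_le0.
  apply: (le_trans (measure_sigma_subadditive m mIF mU (@subset_refl _ _))).
  by rewrite eseries0// => k _ _; have [] := HF k.
- by move=> x /(_ 0%N Logic.I) [].
- move=> n x Fx k _; have := Fx k.+1 Logic.I; rewrite FS => -[_ /(_ n Logic.I)[_ Fg]]; exact: Fg.
Qed.

Lemma measurable_inv_pos {R : realType} {d} {X : measurableType d} (D : set X) (f : X -> R) :
  measurable D -> measurable_fun D f -> (forall x, D x -> 0 < f x) ->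
  measurable_fun D (fun x => (f x)^-1).
Proof.
move=> mD mf f0; apply: (eq_measurable_fun (fun x => f x `^ (-1))).
  by move=> x /[!inE] /f0 /ltW f0x; rewrite powR_inv1.
apply: (@measurableT_comp _ _ _ _ _ _ (fun y : R => y `^ (-1)) _ f _ mf).
exact: measurable_powR.
Qed.

Section GoodSet.
Context {R : realType}.
Local Notation leb := (@lebesgue_measure R).
Local Notation X := (measurableTypeR R).
Variables (alpha x0 : R) (T : R -> R).
Hypothesis pmT : pomeau_manneville alpha x0 T.
Hypothesis nsF : nonsingular x0 T.
Variable JF : @tower_pt R -> R.
Hypothesis jacF : is_jacobian x0 T JF.

Local Notation G := (return_map x0 T).
Local Notation rt := (return_time x0 T).
Local Notation win := (window x0 T).
Local Notation br := (branch x0 T).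

Let E0 : set X := \bigcup_i win i.
Let I : set X := [set y | x0 < y < 1].

Let mwin i : measurable (win i : set X). Proof. exact: (measurable_window pmT). Qed.
Let mE0 : measurable E0. Proof. exact: bigcup_measurable. Qed.
Let mI : measurable I.
Proof.
rewrite (_ : I = [set` `]x0, 1[]); first exact: measurable_itv.
by apply/seteqP; split => x /=; rewrite in_itv.
Qed.
Let le_leb (A B : set X) : measurable A -> measurable B -> A `<=` B ->
  (leb A <= leb B)%E.
Proof. by move=> mA mB AB; apply: le_measure; rewrite ?inE. Qed.
Let E0I : E0 `<=` I. Proof. by move=> x [i _ /(window_base pmT)]. Qed.

Lemma null_countable (A : set X) : countable A -> measurable A /\ leb A = 0%E.
Proof.
move=> cA; split; last exact: countable_lebesgue_measure0.
by apply: countable_measurable => // t; exact: measurable_set1.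
Qed.

Lemma base_cover : leb (I `\` E0) = 0%E.
Proof.
apply: (null_countable _).2; apply: sub_countable (countable_base_exc pmT).
by apply: subset_card_le => x [/andP[/ltW x0x /ltW x1] nE]; split => //=; rewrite x0x.
Qed.

Lemma measurable_tower : measurable (tower x0 T : set (measurableTypeR R * nat)).
Proof.
rewrite (lift_slices (tower x0 T)); apply: bigcup_measurable => l _.
apply: measurable_lift.
rewrite (_ : slice l _ = (\bigcup_i (if (l <= i)%N then win i else set0)) `|`
   (slice l (tower x0 T) `\` E0)).
  apply: measurableU.
    by apply: bigcup_measurable => i _; case: ifP.
  apply: (null_countable _).1; apply: sub_countable (countable_base_exc pmT).
  by apply: subset_card_le => x [[xI _] nE]; split.
apply/seteqP; split => [x xl|x [[i _]|[]//]].
  have [[i _ wx]|nE] := pselect (E0 x); last by right.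
  left; exists i => //; have [ri _ _] := windowK pmT wx.
  by move: xl => [_ /=]; rewrite ri ltnS => ->.
case: ifP => // li wx; have [ri _ _] := windowK pmT wx.
split => /=; last by rewrite ri ltnS.
by have /andP[/ltW-> /ltW->] := window_base pmT wx.
Qed.

Lemma window_cell i l u : win i u -> (l <= i)%N -> cell x0 T l i.+1 (u, l).
Proof.
move=> wu li; have [ri _ _] := windowK pmT wu; split => //; split => //.
by have /andP[/ltW-> /ltW->] := window_base pmT wu.
Qed.

Lemma cell_tower l i z : cell x0 T l i z -> tower x0 T z.
Proof. by move=> [li [xI _ ri] zl]; split => //; rewrite zl ri. Qed.

Lemma measurable_JF i l (A : set X) : (l <= i)%N -> measurable A -> A `<=` win i ->
  measurable_fun A (fun u => JF (u, l)).
Proof.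
move=> li mA Aw; have [mJ _ _] := jacF.
apply: measurable_fun_lift => //; apply: measurable_funS mJ.
  exact: measurable_tower.
by move=> [u k] [/Aw wu /= ->]; exact: cell_tower (window_cell wu li).
Qed.

Lemma JF_ge0 i l u : (l <= i)%N -> win i u -> 0 <= JF (u, l).
Proof. by move=> li wu; have [_ + _] := jacF; apply; exact: cell_tower (window_cell wu li). Qed.

Lemma jac_lift i l (A : set X) : (l <= i)%N -> measurable A -> A `<=` win i ->
  tower_measure (tower_map x0 T @` lift l A) = (\int[leb]_(u in A) (JF (u, l))%:E)%E.
Proof.
move=> li mA Aw; have [mJ J0 jac] := jacF.
have AC : lift l A `<=` cell x0 T l i.+1.
  by move=> [u k] [/Aw wu /= ->]; exact: window_cell.
rewrite (jac l i.+1)//; last exact: measurable_lift.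
rewrite int_lift//.
  apply/measurable_EFinP; apply: measurable_funS mJ; first exact: measurable_tower.
  by move=> z /AC; exact: cell_tower.
by move=> z /AC /cell_tower zt; rewrite lee_fin J0.
Qed.

(** [F] translates below the top level. *)
Lemma jac_step i l (A : set X) : (l < i)%N -> measurable A -> A `<=` win i ->
  (\int[leb]_(u in A) (JF (u, l))%:E = leb A)%E.
Proof.
move=> li mA Aw; rewrite -(jac_lift (ltnW li) mA Aw).
rewrite -(nu_lift l.+1 mA); congr (tower_measure _); apply/seteqP; split.
  move=> _ [[u k] [/= Au ->] <-]; have [ri _ _] := windowK pmT (Aw _ Au).
  by rewrite /tower_map/= ri ltnS li.
move=> [u k] [/= Au ->]; exists (u, l) => //.
by have [ri _ _] := windowK pmT (Aw _ Au); rewrite /tower_map/= ri ltnS li.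
Qed.

Lemma branch_window i x : I x -> win i (br i x).
Proof. by move=> Ix; exists x. Qed.

Lemma jac_top i (A : set X) : measurable A -> A `<=` win i ->
  leb (I `&` br i @^-1` A) = (\int[leb]_(u in A) (JF (u, i))%:E)%E.
Proof.
move=> mA Aw; rewrite -(jac_lift (leqnn i) mA Aw).
rewrite -(nu_lift 0); last exact: (measurable_branch pmT).
congr (tower_measure _); apply/seteqP; split.
  move=> [x k] [/= [Ix Ax] ->]; exists (br i x, i) => //.
  have [ri _ _] := windowK pmT (Aw _ Ax).
  by rewrite /tower_map/= ri ltnn (return_map_branch pmT).
move=> _ [[u k] [/= Au ->] <-]; have [ri Gu bu] := windowK pmT (Aw _ Au).
by rewrite /tower_map/= ri ltnn; split => //=; split => //=; rewrite bu.
Qed.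

Lemma null_branch i (N : set X) : measurable N -> leb N = 0%E ->
  leb (I `&` br i @^-1` N) = 0%E.
Proof.
move=> mN N0.
have -> : I `&` br i @^-1` N = I `&` br i @^-1` (N `&` win i).
  apply/seteqP; split => x [Ix /=]; last by move=> [].
  by move=> Nx; split => //; split => //; exact: branch_window.
have mNw : measurable (N `&` win i : set X) by exact: measurableI.
have NW : N `&` win i `<=` win i by move=> x [].
rewrite jac_top//; apply: null_set_integral => //.
  by apply/measurable_EFinP; exact: measurable_JF NW.
apply/eqP; rewrite -measure_le0 -[leRHS]N0; apply: le_measure; rewrite ?inE//.
Qed.

Lemma measurable_preimage0 (B : set X) : measurable B ->
  measurable (tower x0 T `&` tower_map x0 T @^-1` lift 0 B).
Proof.
move=> mB; set S := _ `&` _; rewrite (lift_slices S); apply: bigcup_measurable => l _.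
apply: measurable_lift.
rewrite (_ : slice l S = (win l `&` G @^-1` B) `|` (slice l S `\` E0)).
  apply: measurableU; first exact: (@measurable_return_map _ _ _ _ pmT l (mwin l)).
  apply: (null_countable _).1; apply: sub_countable (countable_base_exc pmT).
  by apply: subset_card_le => x [[[xI _] _] nE]; split.
apply/seteqP; split => [x xl|x [[wx Bx]|[]//]].
  have [[i _ wx]|nE] := pselect (E0 x); last by right.
  have [ri _ _] := windowK pmT wx.
  move: xl => [[_ /=]]; rewrite /tower_map/= ri !ltnS => li.
  case: ifPn => [_ [_ //]|]; rewrite -leqNgt => il [Bx _].
  have li' : l = i by apply/eqP; rewrite eqn_leq li il.
  by left; rewrite li'.
have [ri _ _] := windowK pmT wx; split; first exact: cell_tower (window_cell wx (leqnn l)).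
by rewrite /= /tower_map/= ri ltnn.
Qed.

(** The points of [N] outside the windows are countably many, and so are their
    preimages in one window. For the others this is the nonsingularity of [F],
    applied to a set at level 0. *)
Lemma null_return i (N : set X) : measurable N -> N `<=` I -> leb N = 0%E ->
  leb (win i `&` G @^-1` N) = 0%E.
Proof.
move=> mN NI N0; have mG := @measurable_return_map _ _ _ _ pmT i (mwin i).
have mNE : measurable (N `&` E0) by exact: measurableI.
have c1 : countable (win i `&` G @^-1` (N `\` E0)).
  apply: (@sub_countable _ _ _ (br i @` (I `\` E0))).
    apply: subset_card_le => u [wu [NG nE]]; have [_ GI bu] := windowK pmT wu.
    by exists (G u).
  apply: (card_le_trans (card_image_le _ _)).
  apply: sub_countable (countable_base_exc pmT).
  by apply: subset_card_le => x [/andP[/ltW x0x /ltW x1] nE]; split => //=; rewrite x0x.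
have [mc c0] := null_countable c1.
pose W : set X := win i `&` G @^-1` (N `&` E0).
have mw1 : measurable W by exact: mG.
have w10 : leb W = 0%E.
  have mA : measurable (lift 0 (N `&` E0)) by exact: measurable_lift.
  have At : lift 0 (N `&` E0) `<=` tower x0 T.
    by move=> [x k] [/= [_ [j _ wx]] ->]; exact: cell_tower (window_cell wx (leq0n j)).
  have A0 : tower_measure (lift 0 (N `&` E0)) = 0%E.
    rewrite nu_lift//; apply/eqP; rewrite -measure_le0 -[leRHS]N0.
    by apply: le_measure; rewrite ?inE.
  have := nsF mA At A0.
  have mL : measurable (lift i W) by exact: measurable_lift.
  move=> F0; rewrite -(nu_lift i mw1); apply/eqP; rewrite -measure_le0 -[leRHS]F0.
  have sub : lift i W `<=`
     tower x0 T `&` tower_map x0 T @^-1` lift 0 (N `&` E0).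
    move=> [u k] [/= [wu Gu] ->]; split; first exact: cell_tower (window_cell wu (leqnn i)).
    by have [ri _ _] := windowK pmT wu; rewrite /= /tower_map/= ri ltnn.
  by apply: le_measure; rewrite ?inE//; exact: measurable_preimage0.
apply/eqP; rewrite -measure_le0.
have -> : win i `&` G @^-1` N = W `|` (win i `&` G @^-1` (N `\` E0)).
  by rewrite -setIUr -preimage_setU setUIDK.
apply: (@le_trans _ _ (leb W + leb (win i `&` G @^-1` (N `\` E0)))%E).
  exact: measureU2.
by rewrite w10 c0 adde0.
Qed.

Lemma null_return_base (N : set X) : measurable N -> N `<=` I -> leb N = 0%E ->
  leb (E0 `&` G @^-1` N) = 0%E.
Proof.
move=> mN NI N0; have mw i : measurable (win i `&` G @^-1` N : set X).
  exact: (@measurable_return_map _ _ _ _ pmT i (mwin i)).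
rewrite setI_bigcupl; apply/eqP; rewrite -measure_le0.
apply: (le_trans (measure_sigma_subadditive leb mw _ (@subset_refl _ _))).
  exact: bigcup_measurable.
by rewrite eseries0// => i _ _; exact: null_return.
Qed.

(** Below the top level [JF] has mean 1 on every measurable set. Where [JF]
    vanishes at the top level, the image under [G] is null, hence so is the
    set itself by [null_return]. *)
Lemma JF_regular : exists N : set X, [/\ measurable N, leb N = 0%E &
  forall i u, win i u -> ~ N u ->
    (forall l, (l < i)%N -> JF (u, l) = 1) /\ 0 < JF (u, i)].
Proof.
have wfin i : (leb (win i) < +oo)%E.
  apply: (@le_lt_trans _ _ (leb [set` `]x0, 1[])).
    apply: le_leb => //.
    by move=> x /(window_base pmT); rewrite /= in_itv.
  by rewrite lebesgue_measure_itv; case: ifP => _; rewrite ?ltry// -EFinB ltry.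
have neg1 i l : leb.-negligible (win i `&` [set u | (l < i)%N /\ JF (u, l) <> 1]).
  have [li|il] := ltnP l i; last first.
    by apply: (@negligibleS _ _ _ leb set0); [move=> u [_ [/=]]|exact: negligible_set0].
  have i1 : leb.-integrable (win i) (cst 1%E).
    apply/integrableP; split; first exact: measurable_cst.
    rewrite (@eq_integral _ _ _ _ _ (cst 1%E)); last by move=> x _; rewrite /= normr1.
    rewrite integral_cst// mul1e; exact: wfin.
  have mJ : measurable_fun (win i : set X) (fun u => (JF (u, l))%:E).
    by apply/measurable_EFinP; exact: measurable_JF (ltnW li) (mwin i) (@subset_refl _ _).
  have [|N [mN N0 hN]] := integral_ae_eq (mwin i) i1 mJ.
    by move=> A Aw mA; rewrite integral_cst// mul1e; exact/esym/(jac_step li).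
  exists N; split => // u [wu [_ nJ]]; apply: hN => /= /(_ wu)[] J1.
  by apply: nJ; rewrite -J1.
have neg2 i : leb.-negligible (win i `&` [set u | JF (u, i) = 0]).
  pose Z := win i `&` [set u | JF (u, i) = 0].
  have mZ : measurable Z.
    have := measurable_JF (leqnn i) (mwin i) (@subset_refl _ _) (mwin i) (measurable_set1 0).
    by [].
  have Zw : Z `<=` win i by move=> u [].
  have mGZ : measurable (I `&` br i @^-1` Z) by exact: (measurable_branch pmT).
  have GZ0 : leb (I `&` br i @^-1` Z) = 0%E.
    rewrite jac_top//; apply: integral0_eq => u [_ /= ->]//.
  have := @null_return i _ mGZ (@subIsetl _ _ _) GZ0.
  have mW : measurable (win i `&` G @^-1` (I `&` br i @^-1` Z)).
    exact: (@measurable_return_map _ _ _ _ pmT i (mwin i)).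
  move=> W0; exists (win i `&` G @^-1` (I `&` br i @^-1` Z)); split => //.
  by move=> u Zu; have [_ GI bu] := windowK pmT (Zw _ Zu); split;
     [exact: Zw|split => //=; rewrite bu].
have : leb.-negligible (\bigcup_i (win i `&` [set u | JF (u, i) = 0]) `|`
   \bigcup_i \bigcup_l (win i `&` [set u | (l < i)%N /\ JF (u, l) <> 1])).
  apply: negligibleU; first exact: negligible_bigcup.
  by apply: negligible_bigcup => i; exact: negligible_bigcup.
move=> [N [mN N0 hN]]; exists N; split => // i u wu nN; split.
  move=> l li; apply: contrapT => nJ; apply: nN; apply: hN; right.
  by exists i => //; exists l.
rewrite lt_neqAle eq_sym (JF_ge0 (leqnn i) wu) andbT.
by apply/eqP => J0; apply: nN; apply: hN; left; exists i.
Qed.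

(** Closedness under [G] and under its inverse branches makes it possible to
    use the almost sure properties of a point and of all its images and
    preimages simultaneously. *)
Record good_set (Y : set X) : Prop := GoodSet {
  gs_meas : measurable Y ;
  gs_sub : Y `<=` E0 ;
  gs_full : leb (I `\` Y) = 0%E ;
  gs_G : forall x, Y x -> Y (G x) ;
  gs_br : forall i x, Y x -> Y (br i x) ;
  gs_JF1 : forall i u l, Y u -> win i u -> (l < i)%N -> JF (u, l) = 1 ;
  gs_JF : forall i u, Y u -> win i u -> 0 < JF (u, i) }.

Lemma good_set_exists (N : set X) : measurable N -> leb N = 0%E ->
  exists2 Y, good_set Y & forall x, Y x -> ~ N x.
Proof.
move=> mN N0; have [M [mM M0 JM]] := JF_regular.
pose g n := if n is i.+1 then br i else G.
have mNM : measurable (N `|` M) by exact: measurableU.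
have NM0 : leb (N `|` M) = 0%E.
  apply/eqP; rewrite -measure_le0; apply: (@le_trans _ _ (leb N + leb M)%E).
    exact: measureU2.
  by rewrite N0 M0 adde0.
have [|||Y [mY YE Y0 YN Yg]] := @closed_conull _ _ _ leb I E0 _ g mI mE0 E0I base_cover mNM NM0.
- case=> [|i] /=.
    apply/measurable_fun_bigcup => // i; exact: (measurable_return_map pmT).
  by apply: measurable_funS (@measurable_branch _ _ _ _ pmT i).
- case=> [|i] x [j _ wx] /=; have [_ GI _] := windowK pmT wx => //.
  have Ix := E0I (ex_intro2 _ _ j Logic.I wx).
  by apply: (branch_base pmT); exact: (base01 pmT).
- case=> [|i] A mA AI A0 /=; first exact: null_return_base.
  have mb : measurable (I `&` br i @^-1` A) by exact: (measurable_branch pmT).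
  apply/eqP; rewrite -measure_le0 -[leRHS](null_branch i mA A0).
  apply: le_measure; rewrite ?inE//; last exact: setSI.
  rewrite -(setIidl E0I) -setIA; exact: measurableI.
exists Y; last by move=> x /YN nNM Nx; apply: nNM; left.
split => //.
- by move=> x Yx; exact: (Yg 0%N).
- by move=> i x Yx; exact: (Yg i.+1).
- move=> i u l Yu wu; have nM : ~ M u by move=> Mu; apply: (YN _ Yu); right.
  by have [+ _] := JM i u wu nM; exact.
- move=> i u Yu wu; have nM : ~ M u by move=> Mu; apply: (YN _ Yu); right.
  by have [_] := JM i u wu nM.
Qed.

(** * Full-branch structure of the return map *)

Section FullBranch.
Variables beta c C : R.
Hypothesis beta01 : 0 < beta < 1.
Hypothesis distF : distortion x0 T beta c JF.
Hypothesis C_gt0 : 0 < C.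
Hypothesis C_ge : c / (1 - beta) <= C.

Definition branch_index (x : X) := (rt x).-1.
Definition branch_weight i (x : X) : R := (JF (br i x, i))^-1.
Definition sep_base (x y : X) : R := sep_pow x0 T beta (x, 0%N) (y, 0%N).

Let together (x y : R) k := exists i, base_cell x0 T i (iter k G x) /\
                              base_cell x0 T i (iter k G y).

Lemma separation_timeP (x y : R) k : ~ together x y k ->
  (forall j, (j < k)%N -> together x y j) -> separation_time x0 T x y = Some k.
Proof.
move=> nk tk; apply: xget_unique; first by exists k.
move=> _ [l [nl tl] <-]; have [kl|lk|->//] := ltngtP k l.
- by exfalso; exact/nk/tl.
- by exfalso; exact/nl/tk.
Qed.

Lemma separation_timeN (x y : R) : (forall k, together x y k) ->
  separation_time x0 T x y = None.
Proof. by move=> t; apply: xgetPN => _ [k [nk _] _]; exact/nk/t. Qed.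

Lemma separation_time_ex (x y : R) : (forall k, together x y k) \/
  exists k, ~ together x y k /\ forall j, (j < k)%N -> together x y j.
Proof.
have [h|h] := pselect (forall k, together x y k); [by left|right].
have [k nk] : exists k, `[< ~ together x y k >].
  apply: contrapT => nh; apply: h => k; apply: contrapT => nk; apply: nh.
  by exists k; apply/asboolP.
have [k' /asboolP nk' kmin] := ex_minnP (ex_intro (fun k => `[< ~ together x y k >]) k nk).
exists k'; split => // j jk; apply: contrapT => nj.
by have := kmin j (introT (asboolP _) nj); rewrite leqNgt jk.
Qed.

Lemma separation_time_sym (x y : R) : separation_time x0 T x y = separation_time x0 T y x.
Proof.
have sym a b k : together a b k -> together b a k by move=> [i [? ?]]; exists i.
have [t|[k [nk tk]]] := separation_time_ex x y.
  by rewrite !separation_timeN// => k; exact: sym.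
by rewrite (separation_timeP nk tk) (@separation_timeP _ _ k)// => [/sym//|j /tk/sym].
Qed.

Lemma sep_base_sym (x y : R) : sep_base x y = sep_base y x.
Proof. by rewrite /sep_base /sep_pow/= separation_time_sym. Qed.

Lemma sep_base_bounds (x y : R) : 0 <= sep_base x y <= 1.
Proof.
have /andP[b0 b1] := beta01.
rewrite /sep_base /sep_pow; case: separation_time => [k|]; last by rewrite lexx ler01.
by rewrite exprn_ge0 ?exprn_ile1 ?(ltW b0) ?(ltW b1).
Qed.

(** The preimages under one branch share the first symbol, and return to the
    given points afterwards. *)
Lemma sep_base_branch i (x y : R) : I x -> I y ->
  sep_base (br i x) (br i y) = beta * sep_base x y.
Proof.
move=> Ix Iy; have wx := branch_window i Ix; have wy := branch_window i Iy.
have [rx _ _] := windowK pmT wx; have [ry _ _] := windowK pmT wy.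
have t0 : together (br i x) (br i y) 0%N.
  exists i.+1; split; split => //.
  - by have /andP[/ltW-> /ltW->] := window_base pmT wx.
  - by have /andP[/ltW-> /ltW->] := window_base pmT wy.
have tS k : together (br i x) (br i y) k.+1 = together x y k.
  by rewrite /together !iterSr !(return_map_branch pmT).
rewrite /sep_base /sep_pow/=; have [t|[k [nk tk]]] := separation_time_ex x y.
  by rewrite !separation_timeN ?mulr0// => -[|k]; rewrite ?tS.
rewrite (separation_timeP nk tk) (@separation_timeP _ _ k.+1) ?exprS//.
  by rewrite tS.
by case=> // j; rewrite ltnS tS; exact: tk.
Qed.

Section Instance.
Variable Y : set X.
Hypothesis gsY : good_set Y.

Lemma good_I x : Y x -> I x. Proof. by move=> /(gs_sub gsY)/E0I. Qed.

Lemma branch_index_window i u : win i u -> branch_index u = i.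
Proof. by move=> wu; have [ri _ _] := windowK pmT wu; rewrite /branch_index ri. Qed.

Lemma piece_window i : piece Y branch_index i = Y `&` win i.
Proof.
apply/seteqP; split=> u [Yu]; last by move=> wu; split => //=; exact: branch_index_window.
by move=> /= iu; have [j _ wu] := gs_sub gsY Yu; split => //; rewrite -iu (branch_index_window wu).
Qed.

(** The Jacobian at the top level of a column is that of the branch of [G], so
    [distF] bounds the ratio of two weights by the exponential of [c * sep];
    the hypothesis [C_ge] turns [c] into [C * (1 - beta)]. *)
Lemma full_branch_good :
  full_branch leb Y G branch_index br branch_weight sep_base beta C (1 - x0).
Proof.
have /andP[x00 x01] := pm_x0 pmT; have /andP[b0 b1] := beta01.
have mY := gs_meas gsY.
have mp i : measurable (piece Y branch_index i).
  by rewrite piece_window; exact: measurableI.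
have mbr i : measurable_fun Y (br i).
  by apply: measurable_funS (@measurable_branch _ _ _ _ pmT i) => //; exact: good_I.
have mbw i : measurable_fun Y (fun x => JF (br i x, i)).
  apply: (@measurable_comp _ _ _ _ _ _ (win i) (fun u => JF (u, i))) => //.
  - exact: mwin.
  - by move=> _ [x Yx <-]; exact/branch_window/good_I.
  - exact: measurable_JF (leqnn i) (mwin i) (@subset_refl _ _).
have mw i : measurable_fun Y (branch_weight i).
  by apply: measurable_inv_pos => // x Yx; apply: (gs_JF gsY); [exact: (gs_br gsY i Yx)|exact/branch_window/good_I].
split => //.
- by rewrite subr_gt0.
- have IV : leb I = (1 - x0)%:E.
    rewrite (_ : I = [set` `]x0, 1[]); last by apply/seteqP; split => x /=; rewrite in_itv.
    by rewrite lebesgue_measure_itv/= lte_fin x01 EFinB.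
  have : leb I = (leb Y + leb (I `\` Y))%E.
    rewrite -measureU//.
    - congr (leb _); apply/seteqP; split => [x Ix|x [/good_I|[]]//].
      by have [Yx|nY] := pselect (Y x); [left|right].
    - exact: measurableD.
    - by apply/seteqP; split => // x [Yx [_]].
  by rewrite (gs_full gsY) adde0 IV => h; exact: esym h.
- by move=> x Yx; exact: (gs_G gsY Yx).
- by move=> i x Yx; exact: (gs_br gsY i Yx).
- by move=> i x Yx; exact/branch_index_window/branch_window/good_I.
- by move=> i x Yx; exact/(return_map_branch pmT)/good_I.
- move=> x Yx; have [i _ wx] := gs_sub gsY Yx.
  by rewrite (branch_index_window wx); have [] := windowK pmT wx.
- apply: (@measurable_funS _ _ _ _ E0) => //; first exact: gs_sub gsY.
  by apply/measurable_fun_bigcup => // i; exact: (measurable_return_map pmT).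
- move=> i x Yx; rewrite invr_gt0; apply: (gs_JF gsY (i := i)).
    exact: (gs_br gsY i Yx).
  exact/branch_window/good_I.
- move=> i f mf f0.
  pose J u := JF (u, i).
  have Jw u : piece Y branch_index i u -> 0 < J u.
    by rewrite piece_window => -[Yu wu]; apply: (gs_JF gsY (i := i)).
  have pw : piece Y branch_index i `<=` win i by rewrite piece_window => u [].
  have mJ : measurable_fun (piece Y branch_index i) J by exact: measurable_JF (leqnn i) (mp i) pw.
  pose q u := (((J u)^-1)%:E * f u)%E.
  transitivity (\int[leb]_(u in piece Y branch_index i) (q u * (J u)%:E))%E.
    apply: (@ge0_change_of_variables _ _ _ leb Y (piece Y branch_index i) (br i) (EFin \o J) q) => //.
  + exact: mbr.
  + move=> x Yx; rewrite piece_window; split; first exact: (gs_br gsY i Yx).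
    exact/branch_window/good_I.
  + exact/measurable_EFinP.
  + by move=> u /Jw /ltW; rewrite lee_fin.
  + move=> A mA Ap; rewrite -jac_top//; last by move=> u /Ap/pw.
    congr (leb _); apply/seteqP; split => x [h Ax]; split => //; first exact: good_I.
    have [Yb _] := Ap _ Ax.
    by have := gs_G gsY Yb; rewrite (return_map_branch pmT).
  + apply: emeasurable_funM.
      by apply/measurable_EFinP; exact: measurable_inv_pos.
    by apply: measurable_funS mf => // u [].
  + by move=> u pu; rewrite mule_ge0 ?lee_fin ?invr_ge0 ?(ltW (Jw _ pu))// f0//; case: pu.
  apply: eq_integral => u /[!inE] /Jw Ju /=.
  by rewrite muleAC -EFinM mulVf ?gt_eqF// mul1e.
- move=> i x y Yx Yy.
  have Ix := good_I Yx; have Iy := good_I Yy.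
  have wx := branch_window i Ix; have wy := branch_window i Iy.
  have Jx : 0 < JF (br i x, i) by apply: (gs_JF gsY (i := i)) => //; exact: (gs_br gsY i Yx).
  have Jy : 0 < JF (br i y, i) by apply: (gs_JF gsY (i := i)) => //; exact: (gs_br gsY i Yy).
  have := distF (window_cell wy (leqnn i)) (window_cell wx (leqnn i)).
  have tm z : I z -> tower_map x0 T (br i z, i) = (z, 0%N).
    move=> Iz; have [rz _ _] := windowK pmT (branch_window i Iz).
    by rewrite /tower_map/= rz ltnn (return_map_branch pmT).
  rewrite !tm// -/(sep_base y x) sep_base_sym ger0_norm ?divr_ge0 ?(ltW Jx) ?(ltW Jy)//.
  move=> h; rewrite /branch_weight -ler_pdivrMl ?invr_gt0// invrK.
  apply: (le_trans h); rewrite ler_expR ler_wpM2r//.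
    by have /andP[] := sep_base_bounds x y.
  by rewrite -ler_pdivrMr// subr_gt0.
- exact: sep_base_bounds.
- by move=> i x y /good_I Ix /good_I Iy; exact: sep_base_branch.
Qed.

End Instance.
End FullBranch.
End GoodSet.

(** * Measures given by set functions and densities *)

Lemma probability_of {R : realType} {d} {X : measurableType d} (f : set X -> \bar R) :
  f set0 = 0%E -> (forall A, 0 <= f A)%E -> semi_sigma_additive f -> f setT = 1%E ->
  exists P : probability X R, forall A, P A = f A.
Proof.
move=> f0 fge0 fsig f1; pose isM := isMeasure.Build d X R f f0 fge0 fsig.
pose M : {measure set X -> \bar R} := HB.pack f isM.
pose isP := @Measure_isProbability.Build d X R M f1.
pose P : probability X R := HB.pack f isM isP.
by exists P.
Qed.

Lemma finite_measure_of {R : realType} {d} {X : measurableType d} (f : set X -> \bar R) :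
  f set0 = 0%E -> (forall A, 0 <= f A)%E -> semi_sigma_additive f -> (f setT < +oo)%E ->
  exists m : {finite_measure set X -> \bar R}, forall A, m A = f A.
Proof.
move=> f0 fge0 fsig fT; pose isM := isMeasure.Build d X R f f0 fge0 fsig.
pose M : {measure set X -> \bar R} := HB.pack f isM.
have fin : fin_num_fun M.
  move=> A mA; rewrite ge0_fin_numE//; move: fT; apply: le_lt_trans.
  by apply: (@le_measure _ _ _ M); rewrite ?inE.
pose isF := @Measure_isFinite.Build d X R M fin.
pose Q : {finite_measure set X -> \bar R} := HB.pack f isM isF.
by exists Q.
Qed.

Lemma probability_of_density {R : realType} {d} {X : measurableType d}
    (m : {measure set X -> \bar R}) (f : X -> R) :
  measurable_fun setT f -> (forall x, 0 <= f x) -> (\int[m]_x (f x)%:E = 1)%E ->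
  exists P : probability X R, forall A, P A = (\int[m]_(x in A) (f x)%:E)%E.
Proof.
move=> mf f0 f1.
apply: (@probability_of R d X (fun A => \int[m]_(x in A) (f x)%:E)%E) => //.
- by rewrite integral_set0.
- by move=> A; apply: integral_ge0 => x _; rewrite lee_fin.
- move=> /= A mA tA mUA; rewrite ge0_integral_bigcup//=.
  + apply: is_cvg_ereal_nneg_natsum_cond => n _ _.
    by apply: integral_ge0 => x _; rewrite lee_fin.
  + by apply/measurable_EFinP; exact: measurable_funTS.
  + by move=> x _; rewrite lee_fin.
Qed.

(** * The tower over the regular base points *)

Section TowerOver.
Context {R : realType}.
Local Notation leb := (@lebesgue_measure R).
Local Notation nu := (@tower_measure R).
Local Notation X := (measurableTypeR R).
Local Notation XN := (measurableTypeR R * nat)%type.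
Variables (alpha x0 : R) (T : R -> R).
Hypothesis pmT : pomeau_manneville alpha x0 T.
Variable JF : @tower_pt R -> R.
Hypothesis jacF : is_jacobian x0 T JF.
Variables beta c C : R.
Hypothesis beta01 : 0 < beta < 1.
Hypothesis distF : distortion x0 T beta c JF.
Hypothesis C_gt0 : 0 < C.
Hypothesis C_ge : c / (1 - beta) <= C.
Variable Y : set X.
Hypothesis gsY : good_set x0 T JF Y.

Local Notation G := (return_map x0 T).
Local Notation rt := (return_time x0 T).
Local Notation win := (window x0 T).
Local Notation br := (branch x0 T).
Local Notation idx := (branch_index x0 T).
Local Notation wgt := (branch_weight x0 T JF).
Local Notation sep := (sep_base x0 T beta).
Local Notation V := (1 - x0).

Let FB : full_branch leb Y G idx br wgt sep beta C V.
Proof. exact: (full_branch_good pmT jacF beta01 distF C_gt0 C_ge gsY). Qed.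

Let mY := fb_mY FB.

Let le_leb (A B : set X) : measurable A -> measurable B -> A `<=` B ->
  (leb A <= leb B)%E.
Proof. by move=> mA mB AB; apply: le_measure; rewrite ?inE. Qed.

Lemma return_time_index x : Y x -> rt x = (idx x).+1.
Proof.
move=> Yx; have [i _ wx] := gs_sub gsY Yx; have [ri _ _] := windowK pmT wx.
by rewrite /branch_index ri.
Qed.

Lemma good_window x : Y x -> win (idx x) x.
Proof.
by move=> Yx; have [i _ wx] := gs_sub gsY Yx; rewrite (branch_index_window pmT wx).
Qed.

Definition late n : set X := Y `&` [set x | (n < rt x)%N].

Lemma measurable_late n : measurable (late n).
Proof.
rewrite (_ : late n = \bigcup_i (if (n <= i)%N then piece Y idx i else set0)).
  by apply: bigcup_measurable => i _; case: ifP => // _; exact: (fb_mpiece FB).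
apply/seteqP; split => [x [Yx /=]|x [i _]].
  by rewrite return_time_index// ltnS => nx; exists (idx x); rewrite ?nx.
by case: ifP => // ni [Yx /= ix]; split => //=; rewrite return_time_index// ltnS ix.
Qed.

Lemma late_fin n : leb (late n) \is a fin_num.
Proof.
rewrite ge0_fin_numE// (@le_lt_trans _ _ (leb Y)) ?(fb_mYV FB) ?ltry//.
by rewrite -(fb_mYV FB); apply: le_leb (measurable_late n) _ _ => // x [].
Qed.

Lemma late0 : late 0 = Y.
Proof. by apply/seteqP; split => [x []//|x Yx]; split => //=; rewrite return_time_index. Qed.

Lemma leb_late_le n : (leb (late n.+1) <= (left_preimage x0 T n)%:E)%E.
Proof.
have sub : late n.+1 `<=` [set` `]x0, x0 + left_preimage x0 T n[].
  move=> x [Yx /=]; rewrite return_time_index// ltnS => nx; rewrite in_itv/=.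
  exact: (late_return pmT (good_window Yx) nx).
have mI : measurable ([set` `]x0, x0 + left_preimage x0 T n[] : set X) by exact: measurable_itv.
apply: (le_trans (le_leb (measurable_late _) mI sub)).
rewrite lebesgue_measure_itv/= lte_fin ltrDl.
have /andP[-> _] := left_preimage_bounds pmT n.
by rewrite -EFinB addrAC subrr add0r.
Qed.

Definition tower_over : set XN := [set z | Y z.1 /\ (z.2 < rt z.1)%N].

Lemma slice_tower_over l : slice l tower_over = late l. Proof. by []. Qed.

Lemma measurable_tower_over : measurable tower_over.
Proof.
rewrite (lift_slices tower_over); apply: bigcup_measurable => l _.
by apply: measurable_lift; exact: measurable_late.
Qed.

Lemma tower_over_sub : tower_over `<=` tower x0 T.
Proof.
move=> [x l] [Yx /= lx]; split => //=.
by have /andP[/ltW -> /ltW ->] := window_base pmT (good_window Yx).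
Qed.

Lemma tower_over_conull : nu (tower x0 T `\` tower_over) = 0%E.
Proof.
have mD : measurable (tower x0 T `\` tower_over).
  by apply: measurableD; [exact: (measurable_tower pmT)|exact: measurable_tower_over].
rewrite nu_slices// eseries0// => l _ _.
have msl := measurable_slice l mD.
have mI : measurable ([set x | x0 <= x <= 1] : set X).
  rewrite (_ : [set x | _] = [set` `[x0, 1]]); first exact: measurable_itv.
  by apply/seteqP; split => x /=; rewrite in_itv.
apply/eqP; rewrite -measure_le0.
pose I : set X := [set y | x0 < y < 1].
have mI' : measurable I.
  rewrite (_ : I = [set` `]x0, 1[]); first exact: measurable_itv.
  by apply/seteqP; split => x /=; rewrite in_itv.
have m2 : measurable ([set x0; 1] : set X) by exact: measurableU.
apply: (@le_trans _ _ (leb ((I `\` Y) `|` [set x0; 1]))).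
  apply: le_leb => //; first by apply: measurableU => //; exact: measurableD.
  move=> x [[/= /andP[x0x x1] lx] nTY].
  have [->|xx0] := eqVneq x x0; first by right; left.
  have [->|xx1] := eqVneq x 1; first by right; right.
  left; split; first by rewrite /I/= !lt_neqAle eq_sym xx0 x0x xx1 x1.
  by move=> Yx; apply: nTY.
apply: (@le_trans _ _ (leb (I `\` Y) + leb [set x0; 1%R])%E).
  by apply: measureU2 => //; exact: measurableD.
rewrite (gs_full gsY) add0e.
have /null_countable[_ ->] // : countable ([set x0; 1] : set R).
exact: finite_set_countable.
Qed.

Lemma nu_tower_over_lty : (nu tower_over < +oo)%E.
Proof.
rewrite nu_slices; last exact: measurable_tower_over.
have [M HM] := left_preimage_sum pmT.
apply: (@le_lt_trans _ _ (V + M)%:E); last by rewrite ltry.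
apply: lime_le; first exact: is_cvg_nneseries.
apply: nearW => -[|n].
  rewrite big_geq// lee_fin addr_ge0//; first exact: ltW (fb_V FB).
  by have := HM 0%N; rewrite big_ord0.
rewrite big_nat_recl//= EFinD slice_tower_over late0 (fb_mYV FB).
apply: leeD => //; apply: (@le_trans _ _ (\sum_(k < n) left_preimage x0 T k)%:E); last by rewrite lee_fin.
rewrite big_mkord -sumEFin; apply: lee_sum => k _.
by rewrite slice_tower_over leb_late_le.
Qed.

Definition tail n : set XN := tower_over `&` [set z | (n < rt z.1)%N].

Lemma slice_tail l n : slice l (tail n) = late (maxn l n).
Proof.
apply/seteqP; split => x; rewrite /slice/late/=.
  by move=> [[Yx /= lx] /= nx]; split => //=; rewrite gtn_max lx.
by move=> [Yx /=]; rewrite gtn_max => /andP[lx nx].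
Qed.

Lemma measurable_tail n : measurable (tail n).
Proof.
rewrite (lift_slices (tail n)); apply: bigcup_measurable => l _.
by apply: measurable_lift; rewrite slice_tail; exact: measurable_late.
Qed.

Definition tail_mass n : R := fine (nu (tail n)).

Lemma tail_fin n : nu (tail n) \is a fin_num.
Proof.
rewrite ge0_fin_numE//; apply: le_lt_trans nu_tower_over_lty.
apply: le_measure; rewrite ?inE; [exact: measurable_tail|exact: measurable_tower_over|].
by move=> z [].
Qed.

Lemma tail_massE n : nu (tail n) = (tail_mass n)%:E. Proof. by rewrite fineK// tail_fin. Qed.

Lemma cvg_tail_mass : tail_mass n @[n --> \oo] --> 0.
Proof.
have : (nu \o tail) n @[n --> \oo] --> nu (\bigcap_n tail n).
  apply: nonincreasing_cvg_mu.
  - by rewrite tail_massE ltry.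
  - exact: measurable_tail.
  - by apply: bigcapT_measurable; exact: measurable_tail.
  - move=> n k nk; apply/subsetPset => z [Tz /= kz]; split => //=.
    exact: leq_ltn_trans kz.
rewrite (_ : \bigcap_n _ = set0); last first.
  by apply/seteqP; split => // z /(_ (rt z.1) Logic.I)[_ /=]; rewrite ltnn.
rewrite measure0 => /fine_cvgP[_]; exact.
Qed.

(** Over the points returning after time [n] there are at least [n.+1] levels,
    each of the measure of [late n]. *)
Lemma late_tail_mass n k : (k <= n.+1)%N -> (k%:R%:E * leb (late n) <= (tail_mass n)%:E)%E.
Proof.
move=> kn; rewrite -tail_massE nu_slices; last exact: measurable_tail.
apply: (@le_trans _ _ (\sum_(0 <= l < k) leb (slice l (tail n)))%E); last first.
  by apply: nneseries_lim_ge.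
rewrite big_nat (eq_bigr (fun=> leb (late n))); last first.
  move=> l /andP[_ lk]; rewrite slice_tail (maxn_idPr _)//.
  by rewrite -ltnS (leq_trans lk).
rewrite -big_nat; elim: {kn} k => [|k IH]; first by rewrite big_geq// mul0e.
rewrite big_nat_recr//= -natr1 EFinD ge0_muleDl ?lee_fin// mul1e.
exact: leeD.
Qed.

(** * Conditional eigenfunctions *)

(** Pointwise form of the eigenvector relations. Below the top, [F] is a
    translation with Jacobian 1, whence [eo_up]; the tops of the columns of
    height more than [n] lie in the hole, whence the finite sum of [eo_base].
    *)
Record eigen_over (n : nat) (phi : @tower_pt R -> R) (lam : R) : Prop := EigenOver {
  eo_n_gt0 : (0 < n)%N ;
  eo_meas : measurable_fun tower_over phi ;
  eo_ge0 : forall z, tower_over z -> 0 <= phi z ;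
  eo_cone : forall x y, Y x -> Y y ->
    phi (x, 0%N) <= phi (y, 0%N) * expR (C * sep x y) ;
  eo_hole : forall x l, Y x -> (0 < l < rt x)%N -> (n < rt x)%N -> phi (x, l) = 0 ;
  eo_up : forall x l, Y x -> (l.+1 < rt x)%N -> (rt x <= n)%N ->
    lam * phi (x, l.+1) = phi (x, l) ;
  eo_base : forall x, Y x ->
    lam * phi (x, 0%N) = \sum_(i < n) wgt i x * phi (br i x, i : nat) ;
  eo_int : (\int[nu]_(z in tower_over) (phi z)%:E = 1)%E ;
  eo_lam_ge0 : 0 <= lam ;
  eo_lam_lt1 : lam < 1 }.

Section Eigen.
Variables (n : nat) (phi : @tower_pt R -> R) (lam : R).
Hypothesis EO : eigen_over n phi lam.
Let n_gt0 := eo_n_gt0 EO.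
Let mphi := eo_meas EO.
Let phi_ge0 := eo_ge0 EO.
Let phi_cone := eo_cone EO.
Let phi_hole := eo_hole EO.
Let phi_up := eo_up EO.
Let phi_base := eo_base EO.
Let phi_int := eo_int EO.
Let lam_ge0 := eo_lam_ge0 EO.
Let lam_lt1 := eo_lam_lt1 EO.

Let psi x := phi (x, 0%N).

Let V_gt0 : 0 < V. Proof. exact: fb_V FB. Qed.

Lemma tower_overP l x : Y x -> (l < rt x)%N -> tower_over (x, l). Proof. by []. Qed.

Lemma Y_point : exists x, Y x.
Proof.
have [Y0|/set0P//] := eqVneq Y set0.
have := fb_mYV FB; rewrite Y0 measure0 => -[] V0'; move: V_gt0; by rewrite -V0' ltxx.
Qed.

Lemma psi_ge0 x : Y x -> 0 <= psi x.
Proof. by move=> Yx; apply: phi_ge0; split => //=; rewrite return_time_index. Qed.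

Lemma psi_zero x : Y x -> psi x = 0 -> forall y, Y y -> psi y = 0.
Proof.
move=> Yx px y Yy; apply/eqP; rewrite eq_le psi_ge0// andbT.
by apply: (le_trans (phi_cone Yy Yx)); rewrite -/(psi x) px mul0r.
Qed.

Lemma not_all_zero : ~ (forall z, tower_over z -> phi z = 0).
Proof.
move=> p0; move: phi_int; rewrite integral0_eq => [[] /eqP|z /p0 ->//].
by rewrite eq_sym oner_eq0.
Qed.

(** If the eigenvalue vanishes, then so does [phi] at the tops of the columns
    not meeting the hole, in particular at those of height 1, which lie in the
    base. By the cone condition it vanishes on the base, and finally on all
    levels. *)
Lemma lam_gt0 : 0 < lam.
Proof.
rewrite lt_neqAle lam_ge0 andbT; apply/eqP => lam0.
have b0 x i : Y x -> (i < n)%N -> phi (br i x, i) = 0.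
  move=> Yx ni; have := phi_base Yx; rewrite -lam0 mul0r => /esym.
  have t0 (j : 'I_n) : 0 <= wgt j x * phi (br j x, j : nat).
    rewrite mulr_ge0 ?(ltW (fb_w_gt0 FB j Yx))//.
    apply: phi_ge0; split => /=; first exact: fb_brY FB _ _ Yx.
    by rewrite return_time_index ?(fb_idx_br FB)//; exact: (fb_brY FB).
  move/eqP; rewrite psumr_eq0// => /allP/(_ (Ordinal ni)).
  rewrite mem_index_enum => /(_ isT) /=; rewrite mulf_eq0 => /orP[|/eqP//].
  by rewrite gt_eqF// (fb_w_gt0 FB).
have psi0 x : Y x -> psi x = 0.
  have [y Yy] := Y_point; apply: (@psi_zero (br 0 y)); first exact: (fb_brY FB).
  exact: b0.
apply: not_all_zero => -[x l] [/= Yx lx].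
have [nx|rn] := ltnP n (rt x).
  by case: l lx => [|l] lx; [exact: psi0|apply: phi_hole].
have [lx'|] := ltnP l.+1 (rt x).
  by rewrite -(phi_up Yx lx' rn) -lam0 mul0r.
rewrite return_time_index// ltnS => il; have li : l = idx x.
  by apply/eqP; rewrite eqn_leq il andbT -ltnS -return_time_index.
rewrite li -{1}(fb_GK FB Yx); apply: b0; first exact: (fb_GY FB).
by move: rn; rewrite return_time_index.
Qed.

Lemma phi_level x l : Y x -> (l < rt x)%N -> (rt x <= n)%N ->
  phi (x, l) = lam ^- l * psi x.
Proof.
move=> Yx; elim: l => [|l IH] lx rn; first by rewrite expr0 invr1 mul1r.
rewrite exprS invfM -mulrA -IH ?(ltnW lx)// -(phi_up Yx lx rn) mulKf//.
by rewrite gt_eqF// lam_gt0.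
Qed.

Lemma psi_gt0 x : Y x -> 0 < psi x.
Proof.
move=> Yx; rewrite lt_neqAle psi_ge0// andbT eq_sym; apply/eqP => px.
apply: not_all_zero => -[y l] [/= Yy ly].
have [ny|yn] := ltnP n (rt y).
  by case: l ly => [|l] ly; [exact: psi_zero Yx px _ Yy|apply: phi_hole].
by rewrite phi_level// (psi_zero Yx px Yy) mulr0.
Qed.

Lemma lift_tower_over : lift 0 Y `<=` tower_over.
Proof. by move=> [x l] [/= Yx ->]; apply: tower_overP => //; rewrite return_time_index. Qed.

Lemma mpsi : measurable_fun Y psi.
Proof.
apply: measurable_fun_lift => //; apply: measurable_funS mphi.
- exact: measurable_tower_over.
- exact: lift_tower_over.
Qed.

Lemma int_psi_le1 : (\int[leb]_(x in Y) (psi x)%:E <= 1)%E.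
Proof.
rewrite -phi_int -(@int_lift _ 0 Y (EFin \o phi))//.
- apply: ge0_subset_integral => //.
  + exact: measurable_lift.
  + exact: measurable_tower_over.
  + exact/measurable_EFinP.
  + exact: lift_tower_over.
- apply/measurable_EFinP; apply: measurable_funS mphi; [exact: measurable_tower_over|exact: lift_tower_over].
- by move=> z /lift_tower_over Tz; rewrite lee_fin phi_ge0.
Qed.

Definition base_mass : R := fine (\int[leb]_(x in Y) (psi x)%:E).

Lemma base_massE : (\int[leb]_(x in Y) (psi x)%:E = base_mass%:E)%E.
Proof.
rewrite fineK// ge0_fin_numE; last by apply: integral_ge0 => x Yx; rewrite lee_fin psi_ge0.
by apply: le_lt_trans int_psi_le1 _; rewrite ltry.
Qed.

Lemma psi_density : density leb Y G idx sep 0 C base_mass psi.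
Proof.
have cc : cone_on Y G idx sep 0 C psi by move=> x y Yx Yy _; exact: phi_cone.
split => //; [exact: mpsi|exact: psi_ge0| |exact: base_massE].
by apply: (cone_bounded FB (ltW C_gt0)) cc; exact: psi_ge0.
Qed.

Lemma base_mass_gt0 : 0 < base_mass.
Proof.
have [x Yx] := Y_point.
have := cone_le FB (ltW C_gt0) psi_density Yx.
have h : 0 < psi x * V by rewrite mulr_gt0// psi_gt0.
by move=> /(lt_le_trans h); rewrite pmulr_lgt0// expR_gt0.
Qed.

Definition profile x := psi x / base_mass.

Lemma profile_density : density leb Y G idx sep 0 C 1 profile.
Proof.
have [m1 p1 c1 [M b1] i1] := psi_density; have a0 := base_mass_gt0; split.
- by apply: measurable_funM.
- by move=> x Yx; rewrite divr_ge0 ?p1// ltW.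
- move=> x y Yx Yy xy; rewrite /profile mulrAC ler_wpM2r ?invr_ge0 ?(ltW a0)//.
  exact: c1.
- exists (M / base_mass) => x Yx; rewrite normrM normfV (gtr0_norm a0) ler_wpM2r ?b1//.
  by rewrite invr_ge0 ltW.
- under eq_integral do rewrite /profile mulrC EFinM.
  rewrite ge0_integralZl//.
  + by rewrite i1 -EFinM mulVf// gt_eqF.
  + exact/measurable_EFinP.
  + by rewrite lee_fin invr_ge0 ltW.
Qed.

Definition profile_bound : R := expR C / V.

Lemma profile_le x : Y x -> profile x <= profile_bound.
Proof.
move=> Yx; have := cone_le FB (ltW C_gt0) profile_density Yx.
by rewrite mul1r /profile_bound ler_pdivlMr.
Qed.

Lemma measurable_idx (q : nat -> R) : measurable_fun Y (fun x => q (idx x)).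
Proof.
move=> _ B mB; rewrite (_ : _ `&` _ = \bigcup_i (if q i \in B then piece Y idx i else set0)).
  by apply: bigcup_measurable => i _; case: ifP => // _; exact: (fb_mpiece FB).
apply/seteqP; split => [x [Yx /= Bx]|x [i _]].
  by exists (idx x) => //; rewrite mem_set.
case: ifP => // Bi [Yx /= ix]; split => //=; rewrite ix; exact: set_mem.
Qed.

(** The factor that the eigenfunction picks up between two returns; the return
    time is [(idx x).+1]. *)
Definition gain x := if (idx x < n)%N then lam ^- (idx x).+1 else 0.

Lemma gain_le x : 0 <= gain x <= lam ^- n.
Proof.
have l0 := lam_gt0; rewrite /gain; case: ifP => ix; last first.
  by rewrite lexx invr_ge0 exprn_ge0// ltW.
rewrite invr_ge0 exprn_ge0 ?(ltW l0)//= lef_pV2 ?posrE ?exprn_gt0//.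
by rewrite ler_wiXn2l// ltW.
Qed.

Let u x := gain x * profile x.

Lemma u_ge0 x : Y x -> 0 <= u x.
Proof.
move=> Yx; rewrite mulr_ge0 ?(dens_ge0 profile_density)//.
by have /andP[] := gain_le x.
Qed.

Lemma u_bounded : bounded_on Y u.
Proof.
exists (lam ^- n * profile_bound) => x Yx; rewrite ger0_norm ?u_ge0//.
have /andP[g0 gn] := gain_le x.
by rewrite ler_pM ?profile_le// (dens_ge0 profile_density).
Qed.

Lemma measurable_u : measurable_fun Y u.
Proof.
apply: measurable_funM; last exact: dens_meas profile_density.
exact: (measurable_idx (fun i => if (i < n)%N then lam ^- i.+1 else 0)).
Qed.

Lemma profile_transfer x : Y x -> profile x = transfer br wgt u x.
Proof.
move=> Yx; have l0 := lam_gt0.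
have E : profile x = \sum_(i < n) wgt i x * u (br i x).
  apply: (mulfI (lt0r_neq0 l0)).
  rewrite /profile mulrA [lam * _]phi_base// mulr_suml mulr_sumr.
  apply: eq_bigr => i _; rewrite /u /gain /profile (fb_idx_br FB)// ltn_ord.
  rewrite phi_level; [|exact: (fb_brY FB)|by rewrite return_time_index ?(fb_idx_br FB)//; exact: (fb_brY FB)..].
  by rewrite exprS invfM; field; rewrite !gt_eqF// ?base_mass_gt0// exprn_gt0.
rewrite E /transfer; apply/esym/cvg_lim => //.
apply: cvg_near_cst; exists n => // k /= nk.
rewrite /series/= -(big_mkord predT (fun i => wgt i x * u (br i x))).
rewrite (@big_cat_nat _ _ _ n)//= [X in _ + X]big_nat [X in _ + X]big1 ?addr0//.
move=> i /andP[ni _]; rewrite /u /gain (fb_idx_br FB)//.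
by rewrite ltnNge ni mul0r mulr0.
Qed.

(** The transfer operator preserves integrals, so [gain * profile] has
    integral 1. Multiplied by [lam], it is at least the profile where the
    return time is at most [n]. *)
Lemma lam_defect : 1 - lam <= profile_bound * fine (leb (late n)).
Proof.
have l0 := lam_gt0.
have mL := measurable_late n.
have fL := late_fin n.
have bnd0 : 0 <= profile_bound by rewrite divr_ge0 ?expR_ge0// ltW.
have [mp p0 _ bp ip] := profile_density.
have iu : (\int[leb]_(x in Y) (u x)%:E = 1)%E.
  have := int_transfer FB measurable_u u_ge0 u_bounded mY (@subset_refl _ _).
  rewrite (_ : Y `&` G @^-1` Y = Y); last first.
    by apply/seteqP; split => [x []//|x Yx]; split => //; exact: (fb_GY FB).
  move=> <-; rewrite -ip; apply: eq_integral => x /[!inE] Yx.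
  by rewrite [in RHS]profile_transfer.
rewrite lerBlDr -lee_fin EFinD EFinM fineK// -ip.
have -> : (profile_bound%:E * leb (late n) = \int[leb]_(x in Y) (profile_bound * \1_(late n) x)%:E)%E.
  under eq_integral do rewrite EFinM.
  rewrite ge0_integralZl ?lee_fin//; last first.
  - by apply/measurable_EFinP; exact: measurable_indic.
  rewrite integral_indic//; congr (_ * leb _)%E.
  by apply/seteqP; split => [x xL|x []//]; split => //; case: xL.
have -> : (lam%:E = \int[leb]_(x in Y) (lam * u x)%:E)%E.
  under eq_integral do rewrite EFinM.
  rewrite ge0_integralZl ?lee_fin ?iu ?mule1 ?ltW//.
  - by apply/measurable_EFinP; exact: measurable_u.
  - by move=> x Yx; rewrite lee_fin u_ge0.
have mi : measurable_fun Y (fun x => profile_bound * \1_(late n) x : R).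
  by apply: measurable_funM => //; exact: measurable_indic.
have ml : measurable_fun Y (fun x => lam * u x : R).
  by apply: measurable_funM => //; exact: measurable_u.
rewrite addeC -ge0_integralD//; last 4 first.
- by move=> x Yx; rewrite lee_fin mulr_ge0 ?u_ge0// ltW.
- exact/measurable_EFinP.
- by move=> x Yx; rewrite lee_fin mulr_ge0// indicE.
- exact/measurable_EFinP.
apply: ge0_le_integral => //.
- exact/measurable_EFinP.
- by apply: emeasurable_funD; exact/measurable_EFinP.
move=> x Yx; rewrite -EFinD lee_fin indicE.
have [rn|nx] := ltnP (idx x) n.
  rewrite (_ : _ \in _ = false); last first.
    by apply/memNset => -[_] /=; rewrite return_time_index// ltnS leqNgt rn.
  rewrite mulr0 addr0 /u /gain rn exprS invfM !mulrA mulfV ?gt_eqF// mul1r -mulrA -/(profile x).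
  rewrite ler_peMl ?p0// invf_ge1 ?exprn_gt0// exprn_ile1// ltW//.
rewrite mem_set; last by split => //=; rewrite return_time_index// ltnS.
by rewrite mulr1 /u /gain ltnNge nx mul0r mulr0 add0r profile_le.
Qed.

Lemma late_saturated : saturated Y G idx 1 (late n).
Proof.
move=> x x' Yx Yx' /(_ 0%N isT) /= ix [_ /=].
by rewrite return_time_index// ix -return_time_index.
Qed.

Lemma late_density : density leb Y G idx sep 1 C (fine (leb (late n))) \1_(late n).
Proof.
apply: (saturated_density FB); [exact: measurable_late|by move=> x []|].
exact: late_saturated.
Qed.

(** The defect is the image of [gain * profile - profile]. This function is at
    most [profile_bound * t] in modulus where the return time is at most [n];
    elsewhere it is bounded, and the operator sends the indicator function of
    [late n] to a density of the cone, which is uniformly small as its mass is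
    small. *)
Lemma profile_almost_invariant (t : R) : lam ^- n <= 1 + t -> 0 <= t -> forall x, Y x ->
  `|profile x - transfer br wgt profile x| <= profile_bound * (t + fine (leb (late n)) / V) * expR C.
Proof.
move=> lt t0 x Yx; have l0 := lam_gt0.
have [mp p0 _ bp _] := profile_density.
have bu := u_bounded.
have [_ i0 _ bi _] := late_density.
have bnd0 : 0 <= profile_bound by rewrite divr_ge0 ?expR_ge0// ltW.
rewrite profile_transfer// -(transferB FB)//.
pose g z := profile_bound * (t * cst 1 z + \1_(late n) z).
have b1 := bounded_on_cst Y (1 : R).
have bt1 := bounded_onZ t b1.
have bg : bounded_on Y (fun z => t * cst 1 z + \1_(late n) z).
  exact: (bounded_onD bt1 bi).
apply: (@le_trans _ _ (transfer br wgt g x)).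
  apply: (norm_transfer_le FB) => //; [exact: bounded_onB|exact: bounded_onZ|].
  move=> z Yz /=; rewrite /g indicE/=.
  have pz := p0 _ Yz; have pb := profile_le Yz.
  have [zn|nz] := ltnP (idx z) n.
    rewrite (_ : _ \in _ = false); last first.
      by apply/memNset => -[_] /=; rewrite return_time_index// ltnS leqNgt zn.
    rewrite mulr1 addr0 /u.
    have /andP[_ gz] := gain_le z.
    have g1 : 1 <= gain z.
      by rewrite /gain zn invf_ge1 ?exprn_gt0// exprn_ile1// ltW//.
    have -> : gain z * profile z - profile z = (gain z - 1) * profile z by ring.
    have g0 : 0 <= gain z - 1 by rewrite subr_ge0.
    rewrite ger0_norm; last exact: mulr_ge0.
    rewrite mulrC; apply: ler_pM => //.
    by rewrite lerBlDl (le_trans gz).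
  rewrite mem_set; last by split => //=; rewrite return_time_index// ltnS.
  rewrite /u /gain ltnNge nz mul0r sub0r normrN ger0_norm//.
  by rewrite (le_trans pb)// mulr1 ler_peMr// lerDr.
have -> : transfer br wgt g x =
    profile_bound * (t * transfer br wgt (cst 1) x + transfer br wgt \1_(late n) x).
  transitivity (profile_bound * transfer br wgt ((fun z => t * cst 1 z) \+ \1_(late n)) x).
    exact: (transferZ FB profile_bound bg Yx).
  congr (_ * _); transitivity (transfer br wgt (fun z => t * cst 1 z) x + transfer br wgt \1_(late n) x).
    exact: (transferD FB bt1 bi Yx).
  by congr (_ + _); exact: (transferZ FB t b1 Yx).
rewrite -mulrA ler_wpM2l//.
rewrite mulrDl lerD//.
  rewrite ler_wpM2l// (le_trans (ler_norm _))// -[leRHS]mulr1.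
  by apply: (transfer_sup FB) => // z _; rewrite /= normr1.
have := cone_le FB (ltW C_gt0) (transfer_density0 FB late_density) Yx.
by rewrite -ler_pdivlMr// mulrAC.
Qed.

End Eigen.

(** * Convergence of the conditional eigenfunctions *)

Local Notation h := (inv_density br wgt V).
Local Notation hbound := (expR (2 * C) / V).

Let h_dens := inv_density_density FB.

Lemma inv_density_ge0 x : Y x -> 0 <= h x. Proof. exact: (dens_ge0 h_dens). Qed.

Lemma inv_density_le x : Y x -> h x <= hbound.
Proof.
move=> Yx; have C2 : 0 <= 2 * C by rewrite mulr_ge0// ltW.
by have := cone_le FB C2 h_dens Yx; rewrite mul1r ler_pdivlMr// (fb_V FB).
Qed.

Lemma inv_density_bound_ge0 : 0 <= hbound.
Proof. by rewrite divr_ge0 ?expR_ge0// ltW// (fb_V FB). Qed.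

Lemma profile_bound_ge0 : 0 <= profile_bound.
Proof. by rewrite divr_ge0 ?expR_ge0// ltW// (fb_V FB). Qed.

Lemma measurable_over (f : X -> R) : measurable_fun Y f ->
  measurable_fun tower_over (fun z : XN => f z.1).
Proof.
move=> mf; apply: (measurable_comp mY _ mf); first by move=> _ [z [Yz _] <-].
by apply: measurable_funTS; exact: measurable_fst.
Qed.

Definition tower_volume : R := fine (nu tower_over).

Lemma tower_volumeE : nu tower_over = tower_volume%:E.
Proof. by rewrite fineK// ge0_fin_numE// nu_tower_over_lty. Qed.

Lemma int_cst_tail (k1 k2 : R) : 0 <= k1 -> 0 <= k2 -> forall n,
  (\int[nu]_(z in tower_over) (k1 + k2 * \1_(tail n) z)%:E = (k1 * tower_volume + k2 * tail_mass n)%:E)%E.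
Proof.
move=> k10 k20 n; have mT := measurable_tower_over; have mt := measurable_tail n.
under eq_integral do rewrite EFinD EFinM.
rewrite ge0_integralD//; last 2 first.
- by move=> z _; rewrite -EFinM lee_fin mulr_ge0// indicE.
- by apply: measurable_funeM; apply/measurable_EFinP; exact: measurable_indic.
rewrite integral_cst// tower_volumeE ge0_integralZl ?lee_fin//; last first.
- by apply/measurable_EFinP; exact: measurable_indic.
rewrite integral_indic// setIidl; last by move=> z [].
by rewrite tail_massE.
Qed.

Lemma int_inv_density_bounds : (1 <= \int[nu]_(z in tower_over) (h z.1)%:E)%E /\
  (\int[nu]_(z in tower_over) (h z.1)%:E < +oo)%E.
Proof.
have mT := measurable_tower_over; have mh := measurable_over (dens_meas h_dens).
have h0 z : tower_over z -> 0 <= h z.1 by move=> [Yz _]; exact: inv_density_ge0.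
split; last first.
  have := int_cst_tail inv_density_bound_ge0 (lexx 0) 0.
  rewrite mul0r addr0 => I; apply: (@le_lt_trans _ _ (hbound * tower_volume)%:E); last by rewrite ltry.
  rewrite -I; apply: ge0_le_integral => //.
  - exact/measurable_EFinP.
  - apply/measurable_EFinP; apply: measurable_funD => //.
    by apply: measurable_funM => //; apply: measurable_indic; exact: measurable_tail.
  - by move=> z [Yz _]; rewrite lee_fin mul0r addr0 inv_density_le.
rewrite -(dens_int h_dens) -(@int_lift _ 0 Y (fun z => (h z.1)%:E))//.
- apply: ge0_subset_integral => //.
  + exact: measurable_lift.
  + exact/measurable_EFinP.
  + by move=> [x l] [/= Yx ->]; apply: tower_overP => //; rewrite return_time_index.
- apply/measurable_EFinP; apply: measurable_funS mh => //.
  by move=> [x l] [/= Yx ->]; apply: tower_overP => //; rewrite return_time_index.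
- by move=> [x l] [/= Yx _]; rewrite lee_fin inv_density_ge0.
Qed.

Definition height : R := fine (\int[nu]_(z in tower_over) (h z.1)%:E).

Lemma heightE : (\int[nu]_(z in tower_over) (h z.1)%:E = height%:E)%E.
Proof.
have [h1 hoo] := int_inv_density_bounds.
by rewrite fineK// ge0_fin_numE//; apply: le_trans h1.
Qed.

Lemma height_ge1 : 1 <= height.
Proof. by have [h1 _] := int_inv_density_bounds; rewrite -lee_fin -heightE. Qed.

(** Divided by its base mass, [phi] is uniformly close to [h] over the points
    with return time at most [n], and at bounded distance from it over the
    others, where it vanishes above the base. Both [phi] and [h / height] have
    integral 1, so the two normalising constants differ by no more than the
    functions do; the base mass of [phi] is at most 1. *)
Lemma eigen_near (n : nat) (phi : @tower_pt R -> R) (lam t e : R) :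
  eigen_over n phi lam -> 0 <= t -> 0 <= e -> lam ^- n <= 1 + t ->
  (forall x, Y x -> `|profile phi x - h x| <= e) ->
  (\int[nu]_(z in tower_over) `|phi z - h z.1 / height|%:E <=
   (2 * ((profile_bound * t + e) * tower_volume + (profile_bound + hbound) * tail_mass n))%:E)%E.
Proof.
move=> EO t0 e0 lt pe; have mT := measurable_tower_over.
have mh := measurable_over (dens_meas h_dens).
have h0 z : tower_over z -> 0 <= h z.1 by move=> [Yz _]; exact: inv_density_ge0.
have mphi := eo_meas EO; have phi0 := eo_ge0 EO.
have bd0 := profile_bound_ge0; have hb0 := inv_density_bound_ge0.
have hg0 : 0 < height by rewrite (lt_le_trans _ height_ge1).
have l0 := lam_gt0 EO; have l1 := eo_lam_lt1 EO.
set a := base_mass phi; have a0 : 0 < a by exact: (base_mass_gt0 EO).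
have a1 : a <= 1 by rewrite -lee_fin -(base_massE EO); exact: (int_psi_le1 EO).
pose F z := phi z / a.
have F0 z : tower_over z -> 0 <= F z by move=> Tz; rewrite divr_ge0 ?phi0// ltW.
have mF : measurable_fun tower_over F by exact: measurable_funM.
pose D := (profile_bound * t + e) * tower_volume + (profile_bound + hbound) * tail_mass n.
have k10 : 0 <= profile_bound * t + e by rewrite addr_ge0// mulr_ge0.
have k20 : 0 <= profile_bound + hbound by rewrite addr_ge0.
have mFh : measurable_fun tower_over (fun z => `|F z - h z.1|).
  by apply: measurableT_comp => //; exact: measurable_funB.
have FhE z : tower_over z -> `|F z - h z.1| <= profile_bound * t + e + (profile_bound + hbound) * \1_(tail n) z.
  move: z => [x l] [/= Yx lx]; rewrite indicE.
  have p0 := dens_ge0 (profile_density EO) Yx; have pb := profile_le EO Yx.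
  have hx0 := inv_density_ge0 Yx; have hxb := inv_density_le Yx.
  have [rn|nx] := leqP (rt x) n.
    rewrite (_ : _ \in _ = false) ?mulr0 ?addr0; last first.
      by apply/memNset => -[_] /=; rewrite ltnNge rn.
    rewrite /F (phi_level EO Yx lx rn) -mulrA -/(profile phi x).
    rewrite (_ : _ - _ = (lam ^- l - 1) * profile phi x + (profile phi x - h x)); last by ring.
    rewrite (le_trans (ler_normD _ _))// lerD ?pe//.
    have g1 : 1 <= lam ^- l by rewrite invf_ge1 ?exprn_gt0// exprn_ile1// ltW.
    have gn : lam ^- l <= lam ^- n.
      rewrite lef_pV2 ?posrE ?exprn_gt0//.
      by rewrite ler_wiXn2l// ?(ltW l0)// ?(ltW l1)// ltnW// (leq_trans lx).
    have g0 : 0 <= lam ^- l - 1 by rewrite subr_ge0.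
    rewrite ger0_norm; last exact: mulr_ge0.
    by rewrite mulrC; apply: ler_pM => //; rewrite lerBlDl (le_trans gn).
  rewrite mem_set ?mulr1; last by split.
  have Fb : F (x, l) <= profile_bound.
    rewrite /F; case: l lx => [|l] lx; first exact: pb.
    by rewrite (eo_hole EO)// mul0r.
  have FF : 0 <= F (x, l) by apply: F0.
  by rewrite ler_norml; apply/andP; split; lra.
have ID : (\int[nu]_(z in tower_over) `|F z - h z.1|%:E <= D%:E)%E.
  rewrite -int_cst_tail//; apply: ge0_le_integral => //.
  - exact/measurable_EFinP.
  - apply/measurable_EFinP; apply: measurable_funD => //.
    by apply: measurable_funM => //; apply: measurable_indic; exact: measurable_tail.
have D0 : 0 <= D by rewrite -lee_fin (le_trans _ ID)// integral_ge0// => z _; rewrite lee_fin.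
have IF : (\int[nu]_(z in tower_over) (F z)%:E = a^-1%:E)%E.
  rewrite /F; under eq_integral do rewrite mulrC EFinM.
  rewrite ge0_integralZl ?lee_fin ?invr_ge0 ?(ltW a0)//.
  - by rewrite (eo_int EO) mule1.
  - exact/measurable_EFinP.
have near : `|a^-1 - height| <= D.
  rewrite ler_norml; apply/andP; split.
    rewrite lerBrDr addrC lerBlDr -lee_fin EFinD -heightE -IF.
    apply: (@le_trans _ _ (\int[nu]_(z in tower_over) (F z)%:E +
        \int[nu]_(z in tower_over) `|F z - h z.1|%:E)%E); last by rewrite leeD2l.
    rewrite -ge0_integralD//; do ?exact/measurable_EFinP.
    apply: ge0_le_integral => //.
    - exact/measurable_EFinP.
    - by apply: emeasurable_funD; exact/measurable_EFinP.
    - move=> z _; rewrite -EFinD lee_fin -lerBlDl -normrN opprB.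
      exact: ler_norm.
  rewrite lerBlDr -lee_fin EFinD -heightE -IF.
  apply: (@le_trans _ _ (\int[nu]_(z in tower_over) `|F z - h z.1|%:E +
      \int[nu]_(z in tower_over) (h z.1)%:E)%E); last by rewrite leeD2r.
  rewrite -ge0_integralD//; do ?exact/measurable_EFinP.
  apply: ge0_le_integral => //.
  - exact/measurable_EFinP.
  - by apply: emeasurable_funD; exact/measurable_EFinP.
  - by move=> z _; rewrite -EFinD lee_fin -lerBlDr ler_norm.
have near' : `|a - height^-1| * height <= a * D.
  have -> : `|a - height^-1| * height = a * `|a^-1 - height|.
    rewrite -{2}(gtr0_norm hg0) -normrM -{2}(gtr0_norm a0) -normrM.
    rewrite -normrN; congr `|_|; field; rewrite !gt_eqF//.
  by rewrite ler_wpM2l// ltW.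
apply: (@le_trans _ _ (\int[nu]_(z in tower_over) (a * `|F z - h z.1| + `|a - height^-1| * h z.1)%:E)%E).
  apply: ge0_le_integral => //.
  - apply/measurable_EFinP; apply: measurableT_comp => //.
    by apply: measurable_funB => //; exact: measurable_funM.
  - by apply/measurable_EFinP; apply: measurable_funD; apply: measurable_funM.
  - move=> z Tz; rewrite lee_fin.
    have -> : phi z - h z.1 / height = a * (F z - h z.1) + (a - height^-1) * h z.1.
      by rewrite /F; field; rewrite !gt_eqF.
    by rewrite (le_trans (ler_normD _ _))// !normrM (gtr0_norm a0) (ger0_norm (h0 _ Tz)).
under eq_integral do rewrite EFinD !EFinM.
rewrite ge0_integralD//; last 4 first.
- by move=> z Tz; rewrite mule_ge0 ?lee_fin// ltW.
- by apply: measurable_funeM; exact/measurable_EFinP.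
- by move=> z Tz; rewrite mule_ge0 ?lee_fin ?h0.
- by apply: measurable_funeM; exact/measurable_EFinP.
rewrite !ge0_integralZl ?lee_fin ?(ltW a0)//; do ?exact/measurable_EFinP.
rewrite heightE -EFinM mulr2n mulrDl mul1r EFinD.
apply: leeD.
  rewrite -[leRHS]mul1e; apply: lee_pmul => //; rewrite ?lee_fin ?(ltW a0)//.
  by apply: integral_ge0 => z _; rewrite lee_fin.
by rewrite lee_fin (le_trans near')// ler_piMl.
Qed.

Lemma cvge0_le (f : nat -> \bar R) : (forall n, 0 <= f n)%E ->
  (forall e : R, 0 < e -> \forall n \near \oo, (f n <= e%:E)%E) ->
  f n @[n --> \oo] --> 0%E.
Proof.
move=> f0 fe; apply/fine_cvgP; split.
  near=> n; rewrite ge0_fin_numE//; apply: (@le_lt_trans _ _ 1%:E); last by rewrite ltry.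
  by near: n; exact: fe.
apply/cvgr0Pnorm_le => e e0; near=> n.
have fn : (f n <= e%:E)%E by near: n; exact: fe.
rewrite /= ger0_norm ?fine_ge0// -lee_fin fineK// ge0_fin_numE//.
by apply: (le_lt_trans fn); rewrite ltry.
Unshelve. all: by end_near. Qed.

Lemma tail_mass_ge0 n : 0 <= tail_mass n. Proof. exact: fine_ge0. Qed.

Lemma tail_mass_small (K e : R) : 0 < e -> \forall n \near \oo, K * tail_mass n <= e.
Proof.
move=> e0; have : K * tail_mass n @[n --> \oo] --> K * 0 by apply: cvgMr; exact: cvg_tail_mass.
rewrite mulr0 => /cvgr0Pnorm_le/(_ _ e0); apply: filterS => n.
exact/le_trans/ler_norm.
Qed.

Lemma leb_late_tail_mass n : fine (leb (late n)) <= tail_mass n.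
Proof.
by have := @late_tail_mass n 1 isT; rewrite mul1e -(fineK (late_fin n)) lee_fin.
Qed.

(** Bernoulli's inequality gives [lam ^+ n >= 1 - n * (1 - lam)], and [n * (1
    - lam)] is at most [profile_bound * tail_mass n] by [lam_defect] and
    [late_tail_mass]. *)
Lemma lam_pow n phi lam : eigen_over n phi lam -> profile_bound * tail_mass n <= 2^-1 ->
  lam ^- n <= 1 + 2 * profile_bound * tail_mass n.
Proof.
move=> EO b2; have l0 := lam_gt0 EO; have l1 := eo_lam_lt1 EO.
have bern (k : nat) : 1 - k%:R * (1 - lam) <= lam ^+ k.
  elim: k => [|k IH]; first by rewrite mul0r subr0 expr0.
  have lk : lam ^+ k <= 1 by rewrite exprn_ile1// ltW.
  rewrite exprS -natr1.
  have -> : lam * lam ^+ k = lam ^+ k - (1 - lam) * lam ^+ k by ring.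
  have : (1 - lam) * lam ^+ k <= (1 - lam) * 1 by rewrite ler_wpM2l// subr_ge0 ltW.
  lra.
have nd : n%:R * (1 - lam) <= profile_bound * tail_mass n.
  have := @late_tail_mass n n (leqnSn n).
  have fL := late_fin n.
  rewrite -(fineK fL) -EFinM lee_fin => nl.
  apply: (@le_trans _ _ (n%:R * (profile_bound * fine (leb (late n))))).
    by rewrite ler_wpM2l//; exact: (lam_defect EO).
  by rewrite mulrCA ler_wpM2l// profile_bound_ge0.
have ln : 1 - profile_bound * tail_mass n <= lam ^+ n by apply: le_trans (bern n); rewrite lerB.
have y0 : 0 <= profile_bound * tail_mass n by rewrite mulr_ge0 ?profile_bound_ge0 ?tail_mass_ge0.
have lp : 0 < lam ^+ n by exact: exprn_gt0.
rewrite -div1r ler_pdivrMr//; move: ln lp y0 b2; rewrite -mulrA.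
move: (profile_bound * tail_mass n) (lam ^+ n) => y p; nra.
Qed.

Lemma eigen_lim (phi : nat -> @tower_pt R -> R) (lam : nat -> R) :
  (forall n, (0 < n)%N -> eigen_over n (phi n) (lam n)) ->
  (\int[nu]_(z in tower_over) `|phi n z - h z.1 / height|%:E)%E @[n --> \oo] --> 0%E.
Proof.
move=> EO; apply: cvge0_le => [n|e e0]; first by apply: integral_ge0 => z _; rewrite lee_fin.
have vol0 : 0 <= tower_volume by exact: fine_ge0.
have bd0 := profile_bound_ge0; have hb0 := inv_density_bound_ge0.
pose e' := e / (4 * (tower_volume + 1)).
have e'0 : 0 < e' by rewrite divr_gt0// mulr_gt0// ltr_wpDl.
have [dl dl0 near_h] := near_inv_density FB e'0.
pose K := 2 * (profile_bound * (2 * profile_bound) * tower_volume + (profile_bound + hbound)).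
have e2 : 0 < e / 2 by rewrite divr_gt0.
near=> n.
have n0 : (0 < n)%N by near: n; exact: nbhs_infty_gt.
have t1 : profile_bound * tail_mass n <= 2^-1 by near: n; exact: tail_mass_small.
have t2 : profile_bound * (2 * profile_bound + V^-1) * expR C * tail_mass n <= dl.
  by near: n; exact: tail_mass_small.
have t3 : K * tail_mass n <= e / 2 by near: n; exact: tail_mass_small.
have {}EO := EO _ n0; have tau0 := tail_mass_ge0 n.
pose t := 2 * profile_bound * tail_mass n.
have t0 : 0 <= t by rewrite mulr_ge0// mulr_ge0.
have lt := lam_pow EO t1.
have pe x : Y x -> `|profile (phi n) x - h x| <= e'.
  apply: near_h (profile_density EO) _ _ => {}x Yx.
  apply: (le_trans (profile_almost_invariant EO lt t0 Yx)); apply: le_trans t2.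
  have -> : profile_bound * (2 * profile_bound + V^-1) * expR C * tail_mass n =
      profile_bound * (t + tail_mass n / V) * expR C by rewrite /t; ring.
  rewrite ler_wpM2r ?expR_ge0// ler_wpM2l// lerD2l ler_wpM2r ?leb_late_tail_mass//.
  by rewrite invr_ge0 ltW// (fb_V FB).
apply: (le_trans (eigen_near EO t0 (ltW e'0) lt pe)); rewrite lee_fin.
have ev : e' * tower_volume <= e / 4.
  have v1 : 0 < tower_volume + 1 by exact: (ltr_wpDl vol0 ltr01).
  rewrite /e' invfM mulrA -mulrA -[leRHS]mulr1 ler_wpM2l ?divr_ge0 ?(ltW e0)//.
  by rewrite mulrC ler_pdivrMr// mul1r lerDl.
move: t3 ev; rewrite /K /t => t3 ev.
have -> : 2 * ((profile_bound * (2 * profile_bound * tail_mass n) + e') * tower_volume + (profile_bound + hbound) * tail_mass n) =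
  2 * (profile_bound * (2 * profile_bound) * tower_volume + (profile_bound + hbound)) * tail_mass n + 2 * (e' * tower_volume) by ring.
lra.
Unshelve. all: by end_near. Qed.

(** * The eigenvector relations over the regular base points *)

Lemma holeP n z : hole x0 T n z <-> [/\ tower x0 T z, (n < rt z.1)%N & (0 < z.2)%N].
Proof.
split.
  move=> [i [l [ni /andP[l1 li] [_ [xI i0 ri] zl]]]].
  by split; rewrite ?zl ?ri//; split; rewrite // zl ri.
move=> [[xI lx] nx l0]; exists (rt z.1), z.2; split => //; first by rewrite l0.
by split => //; split => //; exact: leq_ltn_trans lx.
Qed.

Lemma measurable_hole n : measurable (hole x0 T n : set XN).
Proof.
rewrite (lift_slices (hole x0 T n)); apply: bigcup_measurable => l _; apply: measurable_lift.
rewrite (_ : slice l _ = if l is 0 then set0 else slice (maxn l n) (tower x0 T)).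
  by case: l => // l; apply: measurable_slice; exact: (measurable_tower pmT).
apply/seteqP; split => x; rewrite /slice /=.
  by move=> /holeP[[/= xI lx] /= nx]; case: l lx => // l lx _; split => //=; rewrite gtn_max lx.
case: l => // l [/= xI]; rewrite gtn_max => /andP[lx nx].
by apply/holeP; split.
Qed.

Lemma fibre_up x l : tower x0 T (x, l.+1) ->
  [set y | tower x0 T y /\ tower_map x0 T y = (x, l.+1)] = [set (x, l)].
Proof.
move=> [/= xI lx]; apply/seteqP; split => [[u k] []|_ ->]; last first.
  by split; [split => //=; exact: ltnW|rewrite /tower_map/= lx].
by move=> _; rewrite /tower_map/=; case: ifP => // _ [-> ->].
Qed.

Definition unbranched : set X := [set x | x0 <= x <= 1] `\` \bigcup_i win i.

Lemma fibre_base x : Y x -> ~ (G @` unbranched) x ->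
  [set y | tower x0 T y /\ tower_map x0 T y = (x, 0%N)] = range (fun i => (br i x, i) : XN).
Proof.
move=> Yx nx; apply/seteqP; split => [[u k] [[/= uI ku]]|_ [i _ <-]].
  rewrite /tower_map/=; case: ifP => // /negbT; rewrite -leqNgt => uk [Gu].
  have [[i _ wi]|nw] := pselect ((\bigcup_i win i) u); last first.
    by exfalso; apply: nx; exists u.
  have [ri _ bi] := windowK pmT wi; exists i => //.
  rewrite -Gu bi; congr pair; apply/eqP.
  by move: ku uk; rewrite ri !ltnS eqn_leq => -> ->.
have Yi : Y (br i x) by exact: (fb_brY FB).
have ri : rt (br i x) = i.+1 by rewrite return_time_index// (fb_idx_br FB).
split; last by rewrite /tower_map/= ri ltnn (fb_brK FB).
by apply: (tower_over_sub); apply: tower_overP => //; rewrite ri.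
Qed.

Lemma perron_frobenius_ge0 (f : @tower_pt R -> R) z :
  let F := [set y | tower x0 T y /\ tower_map x0 T y = z] in
  (forall y, F y -> 0 <= f y) -> (forall y, F y -> 0 <= JF y) ->
  perron_frobenius x0 T JF f z = fine (\esum_(y in F) (f y / JF y)%:E).
Proof.
move=> F f0 J0; rewrite /perron_frobenius -/F [X in _ - X](_ : _ = 0); last first.
  rewrite esum1// => y Fy; rewrite (_ : Num.max _ _ = 0) ?mul0r//.
  by apply/max_idPr; rewrite oppr_le0 f0.
rewrite subr0; congr fine; apply: eq_esum => y Fy.
by rewrite ger0_norm ?J0// (max_idPl _)// f0.
Qed.

(** The fibre of [F] over a point above the base is the point below it, with
    Jacobian 1. The fibre over a base point consists of the tops reached by
    the branches, of which those of index at least [n] lie in the hole. *)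
Lemma eigenpair_over n (phi : @tower_pt R -> R) lam (Nc : set XN) : (0 < n)%N ->
  conditional_eigenpair x0 T beta C JF n phi lam -> lam < 1 ->
  (forall x, Y x -> ~ (G @` unbranched) x) ->
  (forall x l, Y x -> ~ Nc (x, l)) ->
  (forall z w, ~ Nc z -> ~ Nc w -> Defs.comparable x0 T z w ->
     phi z <= phi w * expR (C * sep_pow x0 T beta z w)) ->
  (forall z, Y z.1 -> tower x0 T z -> 0 <= phi z) ->
  (forall z, Y z.1 -> hole x0 T n z -> phi z = 0) ->
  (forall z, Y z.1 -> tower x0 T z ->
     conditional_operator x0 T JF n phi z = lam * phi z) ->
  eigen_over n phi lam.
Proof.
move=> n0 [[[phiL _ _] phi1 _] _ lamE] lam1 nU nN cphi phi0 phiH phiE.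
have mT := measurable_tower pmT; have mTY := measurable_tower_over.
have mH := measurable_hole n.
have phi0' z : tower_over z -> 0 <= phi z by move=> Tz; apply: phi0; [case: Tz|exact: tower_over_sub].
have mphi : measurable_fun (tower x0 T) (phi : XN -> R).
  by apply/measurable_EFinP; exact: measurable_int phiL.
have open_hole z : tower x0 T z -> ~ hole x0 T n z -> \1_(tower x0 T `\` hole x0 T n) z = 1 :> R.
  by move=> Tz nH; rewrite indicE mem_set.
have in_hole z : hole x0 T n z -> \1_(tower x0 T `\` hole x0 T n) z = 0 :> R.
  by move=> Hz; rewrite indicE memNset// => -[].
have winY x : Y x -> win (rt x).-1 x by move=> Yx; rewrite return_time_index//; exact: good_window.
split => //.
- exact: measurable_funS tower_over_sub mphi.
- move=> x y Yx Yy; apply: cphi; [exact: nN|exact: nN|right; split => //].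
  + by apply: tower_over_sub; apply: tower_overP => //; rewrite return_time_index.
  + by apply: tower_over_sub; apply: tower_overP => //; rewrite return_time_index.
- move=> x l Yx /andP[l0 lx] nx; apply: phiH => //.
  by apply/holeP; split => //; apply: tower_over_sub.
- move=> x l Yx lx rn.
  have Tl : tower x0 T (x, l.+1) by apply: tower_over_sub; exact: tower_overP.
  have Tl' : tower x0 T (x, l) by apply: tower_over_sub; apply: tower_overP => //; exact: ltnW.
  have nH k : ~ hole x0 T n (x, k) by move=> /holeP[_ /=]; rewrite ltnNge rn.
  rewrite -phiE// /conditional_operator/= open_hole// mul1r.
  have J1 : JF (x, l) = 1.
    by apply: (gs_JF1 gsY Yx (winY _ Yx)); rewrite -ltnS prednK//; exact: leq_ltn_trans lx.
  have f0 : 0 <= phi (x, l) by exact: phi0.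
  rewrite perron_frobenius_ge0 fibre_up//.
  + by rewrite esum_set1 /= ?lee_fin open_hole// J1 mulr1 divr1.
  + by move=> _ ->; rewrite /= open_hole// mulr1.
  + by move=> _ ->; rewrite J1.
- move=> x Yx.
  have Yi i : Y (br i x) by exact: (fb_brY FB).
  have ri i : rt (br i x) = i.+1 by rewrite return_time_index// (fb_idx_br FB).
  have Ti i : tower_over (br i x, i) by apply: tower_overP => //; rewrite ri.
  have Tx : tower x0 T (x, 0%N) by apply: tower_over_sub; apply: tower_overP => //; rewrite return_time_index.
  have nH0 : ~ hole x0 T n (x, 0%N) by move=> /holeP[_ _].
  have Ji i : 0 < JF (br i x, i) by apply: (gs_JF gsY (Yi i)); have := winY _ (Yi i); rewrite ri.
  rewrite -phiE// /conditional_operator/= open_hole// mul1r.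
  pose f i := wgt i x * (phi (br i x, i) * \1_(tower x0 T `\` hole x0 T n) (br i x, i)).
  have f0 i : 0 <= f i.
    by rewrite mulr_ge0 ?(ltW (fb_w_gt0 FB i Yx))// mulr_ge0 ?phi0'// indicE.
  have FE := fibre_base Yx (nU _ Yx).
  rewrite perron_frobenius_ge0 FE; last 2 first.
  + by move=> _ [i _ <-]; rewrite /= mulr_ge0 ?phi0'// indicE.
  + by move=> _ [i _ <-]; exact: ltW.
  rewrite (@reindex_esum _ _ _ [set: nat] _ (fun i => (br i x, i) : XN)); last first.
    by split => //; move=> i j _ _ [].
  rewrite (eq_esum (b := fun i => (f i)%:E)); last first.
    by move=> i _; rewrite /= /f /branch_weight mulrC.
  rewrite -nneseries_esumT; last by move=> i; rewrite lee_fin.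
  rewrite (nneseries_split 0 n) ?add0n; last by move=> k _; rewrite lee_fin.
  rewrite [X in (_ + X)%E]eseries0 ?adde0; last first.
    move=> k nk _; rewrite /f in_hole ?mulr0//; apply/holeP; split => /=.
    * by apply: tower_over_sub.
    * by rewrite ri ltnS.
    * exact: leq_trans nk.
  rewrite big_mkord sumEFin /=; apply: eq_bigr => i _.
  rewrite /f open_hole ?mulr1//; first exact: tower_over_sub.
  by move=> /holeP[_ /=]; rewrite ri ltnS leqNgt ltn_ord.
- have mD : measurable (tower x0 T `\` hole x0 T n : set XN) by exact: measurableD.
  have mN : measurable (tower x0 T `\` tower_over : set XN) by exact: measurableD.
  rewrite -phi1 (negligible_integral mN mD _ tower_over_conull); last first.
    by apply: (integrableS mT mD _ phiL) => z [].
  rewrite (_ : _ `\` _ = tower_over `&` ~` hole x0 T n); last first.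
    apply/seteqP; split => z.
      by move=> [[Tz nH] nT]; split => //; apply: contrapT => nTY; apply: nT.
    move=> [Tz nH]; split; last by case.
    by split => //; exact: tower_over_sub.
  rewrite [RHS]integral_mkcondr; apply: eq_integral => z /[!inE] Tz.
  rewrite patchE; case: ifPn => // /negP; rewrite inE => /contrapT Hz.
  by rewrite phiH//; case: Tz.
- by rewrite -lee_fin lamE; apply: integral_ge0 => z _; rewrite lee_fin.
Qed.

(** * Invariant probability measure of the tower *)

Local Notation F := (tower_map x0 T).
Let mTY := measurable_tower_over.
Let mtow := measurable_tower pmT.
Let overT := tower_over_sub.

Lemma slice_preimage (B : set XN) l : B `<=` tower_over ->
  slice l (tower_over `&` F @^-1` B) =
  slice l.+1 B `|` (piece Y idx l `&` G @^-1` slice 0 B).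
Proof.
move=> BT; apply/seteqP; split => x; rewrite /slice /=.
  move=> [[/= Yx lx]]; rewrite /tower_map/=; case: ifPn => [_|]; first by left.
  rewrite -leqNgt => xl BG; right; split => //; split => //=.
  by apply/eqP; rewrite eqn_leq -ltnS -return_time_index// xl -ltnS -return_time_index.
move=> [Bx|[[Yx /= xl] BG]].
  have [/= Yx lx] := BT _ Bx; split; last by rewrite /tower_map/= lx.
  by split => //=; exact: ltnW.
by split; [split => //=; rewrite return_time_index// xl|rewrite /tower_map/= return_time_index// xl ltnn].
Qed.

Let mpG l (A : set X) : measurable A -> measurable (piece Y idx l `&` G @^-1` A).
Proof.
move=> mA; rewrite -[piece Y idx l](setIidl (@sub_piece _ _ Y idx l)) -setIA.
by apply: measurableI; [exact: (fb_mpiece FB)|exact: (fb_mG FB)].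
Qed.

Lemma measurable_preimage (B : set XN) : measurable B -> B `<=` tower_over ->
  measurable (tower_over `&` F @^-1` B).
Proof.
move=> mB BT; rewrite (lift_slices (tower_over `&` _)); apply: bigcup_measurable => l _.
apply: measurable_lift; rewrite slice_preimage//; apply: measurableU.
  exact: measurable_slice.
by apply: mpG; exact: measurable_slice.
Qed.

Lemma bigcup_pieceG (A : set X) : \bigcup_l (piece Y idx l `&` G @^-1` A) = Y `&` G @^-1` A.
Proof. by rewrite -setI_bigcupl bigcup_piece. Qed.

Lemma trivIset_pieceG (A : set X) : trivIset setT (fun l => piece Y idx l `&` G @^-1` A).
Proof. exact: trivIset_setIr (@trivIset_piece _ _ Y idx). Qed.

(** The slice of the preimage of [B] at level [l] is the slice of [B] at level
    [l.+1] together with the points of the base that return after [l.+1] steps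
    to the slice of [B] at level 0. Summed over [l], the former give all
    slices above the base, and the latter give the preimage under [G] of the
    slice at level 0. *)
Lemma int_invariant (f : X -> R) (B : set XN) :
  measurable_fun Y f -> (forall x, Y x -> 0 <= f x) ->
  (forall A, measurable A -> A `<=` Y ->
    (\int[leb]_(x in Y `&` G @^-1` A) (f x)%:E = \int[leb]_(x in A) (f x)%:E)%E) ->
  measurable B -> B `<=` tower_over ->
  (\int[nu]_(z in tower_over `&` F @^-1` B) (f z.1)%:E = \int[nu]_(z in B) (f z.1)%:E)%E.
Proof.
move=> mf f0 finv mB BT.
have mS := measurable_preimage mB BT.
have mfT : measurable_fun tower_over (fun z : XN => (f z.1)%:E).
  apply/measurable_EFinP; exact: measurable_over.
have f0T z : tower_over z -> (0 <= (f z.1)%:E)%E by move=> [Yz _]; rewrite lee_fin f0.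
have BY l : slice l B `<=` Y by move=> x /BT[].
have msB l := measurable_slice l mB.
rewrite !int_slices//; first last.
- by move=> z [Tz _]; exact: f0T.
- by apply: measurable_funS mfT => // z [].
- by move=> z /BT; exact: f0T.
- exact: measurable_funS mfT.
have i0 (A : set X) : A `<=` Y -> (0 <= \int[leb]_(x in A) (f x)%:E)%E.
  by move=> AY; apply: integral_ge0 => x /AY Yx; rewrite lee_fin f0.
rewrite [RHS]nneseries_recl//; last by move=> k _; exact: (i0 _ (BY k)).
rewrite /= -finv//.
have mE (A : set X) : A `<=` Y -> measurable_fun A (EFin \o f).
  by move=> AY; apply/measurable_EFinP; exact: measurable_funS mf.
rewrite -bigcup_pieceG ge0_integral_bigcup//; last 4 first.
- by move=> l; exact: mpG.
- by rewrite bigcup_pieceG; apply: mE => x [].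
- by rewrite bigcup_pieceG => x [Yx _]; rewrite lee_fin f0.
- exact: trivIset_pieceG.
rewrite addeC -(@nneseries_addn _ (fun k => \int[leb]_(x in slice k B) (f x)%:E)%E 1); last by move=> k; exact: (i0 _ (BY k)).
rewrite -nneseriesD//; last 2 first.
- by move=> l _ _; exact: i0.
- by move=> l _ _; apply: i0 => x [[]].
apply: eq_eseriesr => l _; rewrite slice_preimage// ge0_integral_setU//.
- by rewrite addn1.
- exact: mpG.
- by apply: mE => x [/BY//|[[]]].
- by move=> x [/BY Yx|[[Yx _] _]]; rewrite lee_fin f0.
- apply/disj_set2P/seteqP; split => // x [/BT[/= Yx]]; rewrite return_time_index// => lx [[_ /= xl] _].
  by move: lx; rewrite xl ltnn.
Qed.

Definition limit_density (z : XN) : R := if z \in tower_over then h z.1 / height else 0.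

Let hgt0 : 0 < height. Proof. exact: lt_le_trans height_ge1. Qed.
Let mh : measurable_fun tower_over (fun z : XN => h z.1).
Proof.
exact: (measurable_over (dens_meas h_dens)).
Qed.

Lemma limit_density_ge0 z : 0 <= limit_density z.
Proof.
by rewrite /limit_density; case: ifP => // /[!inE] -[Yz _]; rewrite divr_ge0 ?inv_density_ge0// ltW.
Qed.

Lemma measurable_limit_density : measurable_fun setT limit_density.
Proof.
rewrite (_ : limit_density = (fun z : XN => h z.1 / height) \_ tower_over); last first.
  by apply/funext => z; rewrite patchE.
by apply/(measurable_restrictT _ mTY); exact: measurable_funM.
Qed.

Lemma int_limit_density A :
  (\int[nu]_(z in A) (limit_density z)%:E = \int[nu]_(z in A `&` tower_over) (h z.1 / height)%:E)%E.
Proof.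
rewrite [RHS]integral_mkcondr; apply: eq_integral => z _.
by rewrite patchE /limit_density; case: ifP.
Qed.

Lemma int_limit_densityZ A : measurable A -> A `<=` tower_over ->
  (\int[nu]_(z in A) (h z.1 / height)%:E = height^-1%:E * \int[nu]_(z in A) (h z.1)%:E)%E.
Proof.
move=> mA AT; under eq_integral do rewrite mulrC EFinM.
rewrite ge0_integralZl ?lee_fin ?invr_ge0 ?(ltW hgt0)//.
- by apply/measurable_EFinP; exact: measurable_funS mh.
- by move=> z /AT[Yz _]; rewrite lee_fin inv_density_ge0.
Qed.

Lemma acip_exists : exists2 mu : probability XN R, is_acip x0 T mu &
  forall A, mu A = (\int[nu]_(z in A) (limit_density z)%:E)%E.
Proof.
have [|mu muE] := probability_of_density (m := nu) measurable_limit_density limit_density_ge0.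
  rewrite int_limit_density setTI int_limit_densityZ//.
  by rewrite heightE -EFinM mulVf// gt_eqF.
exists mu => //; split => [|A mA At A0|A mA At].
- rewrite muE int_limit_density setIidr// int_limit_densityZ//.
  by rewrite heightE -EFinM mulVf// gt_eqF.
- rewrite muE null_set_integral//; apply/measurable_EFinP.
  exact: measurable_funTS measurable_limit_density.
- pose B := A `&` tower_over.
  have mB : measurable B by exact: measurableI.
  have BT : B `<=` tower_over by move=> z [].
  rewrite !muE !int_limit_density -/B.
  have -> : tower x0 T `&` F @^-1` A `&` tower_over = tower_over `&` F @^-1` B.
    apply/seteqP; split => [z [[_ FA] Tz]|z [Tz [FA _]]]; last first.
      by split => //; split => //; exact: tower_over_sub.
    split => //; split => //; case: z Tz FA => x l [/= Yx lx] _.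
    rewrite /tower_map/=; case: ifP => // _; split => /=; first exact: (fb_GY FB).
    by rewrite return_time_index//; exact: (fb_GY FB).
  have mS := measurable_preimage mB BT.
  rewrite !int_limit_densityZ//.
  congr (_ * _)%E; apply: int_invariant => //.
  + exact: (dens_meas h_dens).
  + exact: inv_density_ge0.
  + exact: (inv_density_invariant FB).
Qed.

(** Translations preserve [mu'], so the mass of a subset of a level is that of
    its projection to the base. The restriction [rho] of [mu'] to the base is
    then invariant under [G], hence a multiple of the invariant density; the
    constant is determined by the total mass. *)
Lemma acip_unique (mu mu' : probability XN R) : is_acip x0 T mu' ->
  (forall A, mu A = (\int[nu]_(z in A) (limit_density z)%:E)%E) ->
  forall A, measurable A -> mu' A = mu A.
Proof.
move=> [tow1 nul inv] muE.
have null_sub (A B : set XN) : measurable A -> measurable B -> A `<=` B -> mu' B = 0%E -> mu' A = 0%E.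
  move=> mA mB AB B0; apply/eqP; rewrite -measure_le0 -B0.
  by apply: le_measure; rewrite ?inE.
have out0 : mu' (~` tower_over) = 0%E.
  have mD : measurable (tower x0 T `\` tower_over : set XN) by exact: measurableD.
  have mC : measurable (~` tower x0 T : set XN) by exact: measurableC.
  apply: (null_sub _ ((~` tower x0 T) `|` (tower x0 T `\` tower_over))).
  - exact: measurableC.
  - exact: measurableU.
  - move=> z nTz; have [Tz|nz] := pselect (tower x0 T z); [by right|by left].
  apply/eqP; rewrite -measure_le0; apply: (le_trans (measureU2 _ mC mD)).
  have c0 : (mu' (~` tower x0 T) <= 0)%E by rewrite (probability_setC mu' mtow) tow1 subee.
  have d0 : (mu' (tower x0 T `\` tower_over) <= 0)%E.
    rewrite nul//.
    exact: tower_over_conull.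
  by apply: adde_le0; [exact: c0|exact: d0].
have onTY (A : set XN) : measurable A -> mu' A = mu' (A `&` tower_over).
  move=> mA; rewrite -{1}(setIT A) -(setUv tower_over) setIUr measureU//.
  - rewrite [X in (_ + X)%E](null_sub _ (~` tower_over))// ?adde0//.
    + by apply: measurableI => //; exact: measurableC.
    + exact: measurableC.
  - exact: measurableI.
  - by apply: measurableI => //; exact: measurableC.
  - by rewrite setIACA setICr setI0.
have lateY l : late l `<=` Y by move=> x [].
have shift l (B : set X) : measurable B -> B `<=` late l -> mu' (lift l B) = mu' (lift 0 B).
  elim: l B => // l IH B mB Bl; have Bl' : B `<=` late l.
    by move=> x /Bl[Yx /= lx]; split => //=; exact: ltnW.
  rewrite -IH// -inv//.
  - congr (mu' _); apply/seteqP; split => [[x k] [_]|[x k] [/= Bx ->]].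
      rewrite /= /tower_map/=; case: ifP => _ [/= Bx kl]; last by [].
      by split => //=; case: kl.
    have [Yx /= lx] := Bl _ Bx.
    split; last by rewrite /tower_map/= lx.
    by apply: tower_over_sub; split => //=; exact: ltnW.
  - exact: measurable_lift.
  - by move=> [x k] [/= Bx ->]; apply: tower_over_sub; have [] := Bl _ Bx.
have mlY (A : set X) : measurable A -> measurable (lift 0 (A `&` Y)).
  by move=> mA; apply: measurable_lift; exact: measurableI.
have [||||rho rhoE] := @finite_measure_of R _ X (fun A => mu' (lift 0 (A `&` Y))).
- by rewrite set0I (_ : lift 0 set0 = set0) ?measure0//; apply/seteqP; split => z [].
- by [].
- move=> /= A mA tA mUA.
  rewrite (_ : lift 0 _ = \bigcup_i lift 0 (A i `&` Y)).
    apply: measure_semi_sigma_additive.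
    + by move=> i; exact: mlY.
    + move=> i j _ _ [z [[[Ai _] _] [[Aj _] _]]]; apply: tA => //.
      by exists z.1.
    + by apply: bigcup_measurable => i _; exact: mlY.
  apply/seteqP; split => [z [[[i _ Ai] Yz] zl]|z [i _ [[Ai Yz] zl]]].
    by exists i.
  by split => //; split => //; exists i.
- by apply: (le_lt_trans (probability_le1 _ _)); [exact: mlY|rewrite ltry].
have rhoY (A : set X) : A `<=` Y -> rho A = mu' (lift 0 A).
  by move=> AY; rewrite rhoE setIidl.
have lift_tower (A : set X) : A `<=` Y -> lift 0 A `<=` tower x0 T.
  by move=> AY [x k] [/= /AY Yx ->]; apply: tower_over_sub; split => //=; rewrite return_time_index.
have rho_h : forall A, measurable A -> A `<=` Y ->
    rho A = (rho Y * \int[leb]_(x in A) (h x)%:E)%E.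
  apply: (@invariant_unique R Y G idx _ _ _ _ _ _ x0 1 FB).
  - by move=> x /(gs_sub gsY)[i _ wx]; exact: (window_base pmT wx).
  - rewrite -[RHS](gs_full gsY); congr (leb _).
  - move=> x y z Yx Yy Yz xyz xz.
    have wx := good_window Yx; have wz := good_window Yz.
    rewrite -xz in wz.
    by rewrite (branch_index_window pmT (window_convex pmT wx wz xyz)).
  - move=> x y Yx Yy xy ixy; apply: (return_map_homo pmT (good_window Yx)) => //.
    by rewrite ixy; exact: (good_window Yy).
  - move=> A mA AY A0; rewrite rhoY// nul ?nu_lift//; first exact: measurable_lift.
    exact: lift_tower.
  - by rewrite rhoE setICl (_ : lift 0 set0 = set0) ?measure0//; apply/seteqP; split => z [].
  - move=> A mA AY; rewrite !rhoY//.
    rewrite -[RHS]inv; [|exact: measurable_lift|exact: lift_tower].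
    rewrite [RHS]onTY; last exact: (measurable_preimage0 pmT).
    have TA : lift 0 A `<=` tower_over by move=> [x k] [/= Ax ->]; split => /=; rewrite ?return_time_index//; exact: AY.
    have -> : tower x0 T `&` F @^-1` lift 0 A `&` tower_over = tower_over `&` F @^-1` lift 0 A.
      by apply/seteqP; split => [z [[]]|z [Tz Fz]] //; split => //; split => //; exact: tower_over_sub.
    have mlA : measurable (lift 0 A) by exact: measurable_lift.
    have pl l : piece Y idx l `&` G @^-1` A `<=` late l.
      by move=> x [[Yx /= xl] _]; split => //=; rewrite return_time_index// xl.
    rewrite (lift_slices (tower_over `&` _)) -bigcup_pieceG.
    rewrite (_ : lift 0 _ = \bigcup_l lift 0 (piece Y idx l `&` G @^-1` A)); last first.
      apply/seteqP; split => [[x k] [/= [l _ Px] ->]|[x k] [l _ [/= Px ->]]].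
        by exists l.
      by split => //; exists l.
    rewrite !measure_bigcup//; last 4 first.
    + move=> l _; apply: measurable_lift; apply: measurable_slice.
      exact: measurable_preimage.
    + exact: trivIset_lift.
    + by move=> l _; apply: measurable_lift; exact: mpG.
    + move=> i j _ _ [[x k] [[Pi _] [Pj _]]].
      by apply: (trivIset_pieceG (A := A)) => //; exists x.
    apply: eq_eseriesr => l _; transitivity (mu' (lift l (piece Y idx l `&` G @^-1` A))).
      by apply/esym/shift; [exact: mpG|exact: pl].
    congr (mu' (lift l _)); rewrite slice_preimage// slice_lift.
    rewrite (_ : slice l.+1 _ = set0) ?set0U//.
    by apply/seteqP; split => x // [].
have mSl (A : set XN) l : measurable A -> measurable (slice l (A `&` tower_over)).
  by move=> mA; apply: measurable_slice; exact: measurableI.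
have SlY (A : set XN) l : slice l (A `&` tower_over) `<=` late l by move=> x [_ []].
have mu'E (A : set XN) : measurable A ->
    mu' A = (rho Y * \int[nu]_(z in A `&` tower_over) (h z.1)%:E)%E.
  move=> mA; rewrite onTY// int_slices//; first last.
  - by move=> z [_ [Yz _]]; rewrite lee_fin inv_density_ge0.
  - by apply/measurable_EFinP; apply: measurable_funS mh => // z [].
  - exact: measurableI.
  have rY : rho Y = (fine (rho Y))%:E by rewrite fineK// fin_num_measure.
  rewrite rY -nneseriesZl; last first.
    move=> l _; apply: integral_ge0 => x /SlY/lateY Yx.
    by rewrite lee_fin inv_density_ge0.
  rewrite {1}(lift_slices (A `&` tower_over)) measure_bigcup//; last 2 first.
  - by move=> l _; apply: measurable_lift; exact: mSl.
  - exact: trivIset_lift.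
  have -> : (\sum_(0 <= i <oo | i \in [set: nat]) mu' (lift i (slice i (A `&` tower_over))))%E =
      (\sum_(0 <= i <oo) mu' (lift i (slice i (A `&` tower_over))))%E.
    by apply: eq_eseriesl => l; rewrite in_setT.
  have YSl l : slice l (A `&` tower_over) `<=` Y by move=> x /SlY; exact: lateY.
  apply: eq_eseriesr => l _; rewrite -rY.
  transitivity (mu' (lift 0 (slice l (A `&` tower_over)))).
    by apply: shift; [exact: mSl|exact: SlY].
  transitivity (rho (slice l (A `&` tower_over))); first by apply/esym/rhoY; exact: YSl.
  by apply: rho_h; [exact: mSl|exact: YSl].
move=> A mA; rewrite mu'E// muE int_limit_density int_limit_densityZ//; last exact: measurableI.
congr (_ * _)%E.
have := mu'E setT measurableT; rewrite probability_setT setTI.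
rewrite (heightE).
have -> : rho Y = (fine (rho Y))%:E by rewrite fineK// fin_num_measure.
by rewrite -EFinM => -[] th; congr EFin; apply: (mulIf (lt0r_neq0 hgt0)); rewrite -th mulVf// gt_eqF.
Qed.

End TowerOver.

Theorem theorem4p7 (R : realType) (alpha x0 : R) (T : R -> R)
    (pmT : pomeau_manneville alpha x0 T)
    (nsF : nonsingular x0 T)
    (JF : tower_pt -> R) (jacF : is_jacobian x0 T JF)
    (beta c : R) (beta01 : 0 < beta < 1) (distF : distortion x0 T beta c JF)
    (C : R) (C_gt0 : 0 < C) (C_ge : c / (1 - beta) <= C)
    (phi_ : nat -> tower_pt -> R) (lambda_ : nat -> R)
    (phi_eig : forall n, (1 <= n)%N ->
       conditional_eigenpair x0 T beta C JF n (phi_ n) (lambda_ n))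
    (lambda_lt1 : forall n, (1 <= n)%N -> lambda_ n < 1) :
  exists mu : probability (measurableTypeR R * nat)%type R,
    [/\ is_acip x0 T mu,
        forall mu' : probability (measurableTypeR R * nat)%type R,
          is_acip x0 T mu' -> forall A, measurable A -> mu' A = mu A &
        exists2 phi : tower_pt -> R, is_density x0 T mu phi &
          L1_norm x0 T (phi_ n \- phi) @[n --> \oo] --> 0%E].
Proof.
pose XN := (measurableTypeR R * nat)%type.
have /choice[Nc NcP] : forall n, exists N : set XN, (0 < n)%N ->
    (@tower_measure R).-negligible N /\
    forall z w, ~ N z -> ~ N w -> Defs.comparable x0 T z w ->
      phi_ n z <= phi_ n w * expR (C * sep_pow x0 T beta z w).
  move=> n; have [n0|] := ltnP 0 n; last by exists set0.
  have [[[_ _ [N negN cN]] _ _] _ _] := phi_eig n n0.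
  by exists N.
(* all exceptional sets, for all [n] and all levels, are projected to the base *)
have rel : {ae (@tower_measure R), forall z, forall n, (0 < n)%N ->
    [/\ ~ Nc n z, tower x0 T z -> 0 <= phi_ n z, hole x0 T n z -> phi_ n z = 0 &
        tower x0 T z -> conditional_operator x0 T JF n (phi_ n) z = lambda_ n * phi_ n z]}.
  apply: ae_foralln => n; have [n0|nn] := ltnP 0 n; last by apply: aeW => z.
  have [[[_ ph0 _] _ phH] phE _] := phi_eig n n0.
  have [negN _] := NcP n n0.
  apply: negligibleS (negligibleU (negligibleU ph0 phH) (negligibleU phE negN)).
  move=> z nP; apply: contrapT => nz; apply: nP => _.
  split; [|apply: contrapT => q; apply: nz..].
  - by move=> Nz; apply: nz; right; right.
  - by left; left.
  - by left; right.
  - by right; left.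
have [N [mN N0 NP]] := ae_slices rel.
(* points of the base with a preimage outside the branches *)
pose U := return_map x0 T @` unbranched x0 T.
have [mU U0] : measurable (U : set (measurableTypeR R)) /\ (@lebesgue_measure R) U = 0%E.
  apply: null_countable; apply: (card_le_trans (card_image_le _ _)).
  exact: (countable_base_exc pmT).
have NU0 : (@lebesgue_measure R) (N `|` U) = 0%E.
  have E : ((@lebesgue_measure R) N + (@lebesgue_measure R) U <= 0)%E by rewrite N0 U0 adde0.
  by apply/eqP; rewrite -measure_le0; apply: le_trans E; exact: measureU2.
have [Y gsY YN] := good_set_exists pmT nsF jacF (measurableU _ _ mN mU) NU0.
have YP x l : Y x -> forall n, (0 < n)%N ->
    [/\ ~ Nc n (x, l), tower x0 T (x, l) -> 0 <= phi_ n (x, l),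
        hole x0 T n (x, l) -> phi_ n (x, l) = 0 &
        tower x0 T (x, l) ->
        conditional_operator x0 T JF n (phi_ n) (x, l) = lambda_ n * phi_ n (x, l)].
  by move=> Yx; apply: NP => Nx; apply: (YN x Yx); left.
have EO n : (0 < n)%N -> eigen_over x0 T JF beta C Y n (phi_ n) (lambda_ n).
  move=> n0; have [_ cN] := NcP n n0.
  apply: (eigenpair_over pmT jacF beta01 distF C_gt0 C_ge gsY n0 (phi_eig n n0) (lambda_lt1 n n0)
    (Nc := Nc n)) => //.
  - by move=> x Yx Ux; apply: (YN x Yx); right.
  - by move=> x l Yx; have [] := YP x l Yx n n0.
  - by move=> [x l] Yx; have [] := YP x l Yx n n0.
  - by move=> [x l] Yx; have [] := YP x l Yx n n0.
  - by move=> [x l] Yx; have [] := YP x l Yx n n0.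
have [mu acip muE] := acip_exists pmT jacF beta01 distF C_gt0 C_ge gsY.
exists mu; split => // [mu' acip'|].
  exact: (acip_unique pmT jacF beta01 distF C_gt0 C_ge gsY acip' muE).
have mTo := measurable_tower pmT.
have mTY := measurable_tower_over pmT jacF beta01 distF C_gt0 C_ge gsY.
have md := measurable_limit_density pmT jacF beta01 distF C_gt0 C_ge gsY.
have d0 := limit_density_ge0 pmT jacF beta01 distF C_gt0 C_ge gsY.
pose d := limit_density x0 T JF Y.
exists d.
  split => //; apply/integrableP; split.
    by apply/measurable_EFinP; exact: measurable_funTS md.
  under eq_integral do rewrite /= ger0_norm ?d0//.
  by have [mu1 _ _] := acip; rewrite -muE mu1 ltry.
apply: cvg_trans (eigen_lim pmT jacF beta01 distF C_gt0 C_ge gsY EO).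
apply: near_eq_cvg; exists 1%N => // n /= n0.
have [[[phL _ _] _ _] _ _] := phi_eig n n0.
have mD : measurable (tower x0 T `\` tower_over x0 T Y : set XN) by exact: measurableD.
have TYt := tower_over_sub pmT gsY.
rewrite /L1_norm (ge0_negligible_integral mD mTo _ _ (tower_over_conull pmT jacF beta01 distF C_gt0 C_ge gsY))//.
- rewrite setDD setIidr//; apply: eq_integral => z /[!inE] Tz.
  by rewrite /= /d /limit_density mem_set.
- apply/measurable_EFinP; apply: measurableT_comp => //; apply: measurable_funB.
    by apply/measurable_EFinP; exact: measurable_int phL.
  exact: measurable_funTS md.
Qed.
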